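(* Let $\varphi\colon\mathbb{D}\to\mathbb{A}$ be a bijective conformal map from the open unit disk $\mathbb{D}$ onto a simply connected domain $\mathbb{A}\subset\mathbb{C}$, and let $G\in\mathcal{H}_2(\mathbb{A})$. Let $r\ge 1$ and consider functions of the form $$G_r(\cdot)=\sum_{j=1}^r\frac{\phi_j}{\varphi^{-1}(\cdot)-\lambda_j}+d_r,\qquad \lambda_j,\phi_j,d_r\in\mathbb{C},\ |\lambda_j|>1,\ j=1,\dots,r .$$ Suppose that $G_r\in\mathcal{H}_2(\mathbb{A})$ of this form, with parameters $(\lambda_1,\dots,\lambda_r,\phi_1,\dots,\phi_r,d_r)$, is a local minimizer of $$\min_{\substack{\lambda_j,d_r,\phi_j\in\mathbb{C}\\ |\lambda_j|>1\\ j=1,\dots,r}}\|G-G_r\|_{\mathcal{H}_2(\mathbb{A})}.$$ Then, for $p=1,\dots,r$, $$G(\varphi(0))=G_r(\varphi(0)),\qquad G\!\left(\varphi\!\left(\tfrac{1}{\overline{\lambda_p}}\right)\right)=G_r\!\left(\varphi\!\left(\tfrac{1}{\overline{\lambda_p}}\right)\right),\qquad G'\!\left(\varphi\!\left(\tfrac{1}{\overline{\lambda_p}}\right)\right)=G_r'\!\left(\varphi\!\left(\tfrac{1}{\overline{\lambda_p}}\right)\right).$$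
   Context: A conformal map is an analytic map with nowhere vanishing derivative. $\mathcal{H}_2$ is the Hardy space of analytic $F\colon\mathbb{D}\to\mathbb{C}$ with $\sup_{0<\rho<1}\frac1{2\pi}\int_0^{2\pi}|F(\rho e^{\mathrm{i}\theta})|^2\,\mathrm{d}\theta<\infty$, with inner product $\langle F,H\rangle_{\mathcal{H}_2}=\frac1{2\pi}\int_0^{2\pi}F(e^{\mathrm{i}\theta})\overline{H(e^{\mathrm{i}\theta})}\,\mathrm{d}\theta$ (using radial boundary values) and the induced norm. The space $\mathcal{H}_2(\mathbb{A})$ consists of the analytic $G\colon\mathbb{A}\to\mathbb{C}$ with $G\circ\varphi\in\mathcal{H}_2$, with inner product $\langle G,F\rangle_{\mathcal{H}_2(\mathbb{A})}=\langle G\circ\varphi,F\circ\varphi\rangle_{\mathcal{H}_2}$ and norm $\|G\|_{\mathcal{H}_2(\mathbb{A})}=\|G\circ\varphi\|_{\mathcal{H}_2}$. ''Local minimizer'' refers to the parameters $(\lambda_1,\dots,\lambda_r,\phi_1,\dots,\phi_r,d_r)$ in the open subset $\{|\lambda_j|>1,\ j=1,\dots,r\}$ of $\mathbb{C}^{2r+1}$. *)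

(* Defs.v *)
From HB Require Import structures.
From mathcomp Require Import all_boot all_order all_algebra.
From mathcomp Require Import complex.
From mathcomp Require Import all_classical all_reals all_analysis.

Set Implicit Arguments.
Unset Strict Implicit.
Unset Printing Implicit Defensive.

Import Order.TTheory GRing.Theory Num.Theory.
Import numFieldNormedType.Exports.

Local Open Scope ring_scope.
Local Open Scope classical_set_scope.

(* [R[i]] carries no topology by itself; viewed as a [numClosedFieldType] it
   inherits the one of its modulus, and is a normed module over itself, so that
   [f^`()] is the complex derivative of [f : cplx R -> cplx R]. *)
Definition cplx (R : realType) : numClosedFieldType := R[i].

Section ComplexAnalysis.
Context {R : realType}.
Local Notation C := (cplx R).

Definition unit_disk : set C := [set z | `|z| < 1].

(* Functions on a domain are total functions of which only the values on the
   domain matter; analytic means locally the sum of a power series. *)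
Definition analytic_on (A : set C) (f : C -> C) : Prop :=
  forall a, A a -> exists c : nat -> C,
    \forall z \near a, [series c n * (z - a) ^+ n]_n @ \oo --> f z.

Definition conformal_on (A : set C) (f : C -> C) : Prop :=
  analytic_on A f /\ forall z, A z -> f^`() z != 0.

Definition is_domain (A : set C) : Prop :=
  [/\ A !=set0, open A & connected A].

(* [H] is a homotopy, relative to the end points and within [A], from the loop
   [g] to the constant loop. *)
Definition loop_contraction (A : set C) (g : R -> C) (H : R * R -> C) : Prop :=
  [/\ {within `[0, 1] `*` `[0, 1], continuous H},
      H @` (`[0, 1] `*` `[0, 1]) `<=` A,
      forall t : R, t \in `[0, 1] -> H (0, t) = g t,
      forall t : R, t \in `[0, 1] -> H (1, t) = g 0 &
      forall s : R, s \in `[0, 1] -> H (s, 0) = g 0 /\ H (s, 1) = g 0].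

Definition simply_connected_domain (A : set C) : Prop :=
  is_domain A /\
  forall g : R -> C, {within `[0, 1], continuous g} -> g @` `[0, 1] `<=` A ->
    g 0 = g 1 -> exists H : R * R -> C, loop_contraction A g H.

Definition expi (t : R) : C := (cos t +i* sin t)%C.

Definition hardy2 (F : C -> C) : Prop :=
  analytic_on unit_disk F /\
  (ereal_sup [set ((2 * pi)^-1)%:E *
      \int[lebesgue_measure]_(t in `[0%R, (2 * pi)%R])
        ((Normc.normc (F (rho%:C%C * expi t))) ^+ 2)%:E
    | rho in `]0%R, 1%R[ ] < +oo)%E.

(* For [F] in the Hardy space this is the radial boundary value for almost every
   [t]; on the remaining null set [lim] returns a default value. *)
Definition radial_limit (F : C -> C) (t : R) : C :=
  lim (F (rho%:C%C * expi t) @[rho --> (1 : R)^'-]).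

(* The mean over the circle of a complex-valued function of the angle. *)
Definition circle_mean (f : R -> C) : C :=
  ((2 * pi)^-1 * \int[lebesgue_measure]_(t in `[0, 2 * pi]) complex.Re (f t)
   +i*
   ((2 * pi)^-1 * \int[lebesgue_measure]_(t in `[0, 2 * pi]) complex.Im (f t)))%C.

Definition hardy2_inner (F H : C -> C) : C :=
  circle_mean (fun t => radial_limit F t * (radial_limit H t)^*).

Definition hardy2_norm (F : C -> C) : R :=
  Num.sqrt (complex.Re (hardy2_inner F F)).

(* The Hardy space of [A = phi @` unit_disk], transported along [phi]. *)
Definition hardy2_via (phi : C -> C) (A : set C) (G : C -> C) : Prop :=
  analytic_on A G /\ hardy2 (G \o phi).

Definition hardy2_via_norm (phi G : C -> C) : R := hardy2_norm (G \o phi).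

(* The parameters [(lambda, residues, d)] of a reduced model. *)
Definition params (r : nat) : Type := ('rV[C]_r * 'rV[C]_r * C)%type.

Definition admissible (r : nat) : set (params r) :=
  [set q : params r | forall j : 'I_r, 1 < `|q.1.1 0 j|].

(* [pinv unit_disk phi] is the inverse of [phi : unit_disk -> A]. *)
Definition reduced_model (phi : C -> C) (r : nat) (q : params r) (z : C) : C :=
  (\sum_(j < r) q.1.2 0 j / (pinv unit_disk phi z - q.1.1 0 j)) + q.2.

End ComplexAnalysis.

Arguments params : clear implicits.

Definition local_minimizer {R : realType} {T : topologicalType}
    (S : set T) (f : T -> R) (p : T) : Prop :=
  S p /\ \forall q \near p, S q -> f p <= f q.

(* Main.v *)
Require Import Defs.
From mathcomp Require Import all_boot all_order all_algebra.
From mathcomp Require Import complex.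
From mathcomp Require Import all_classical all_reals all_analysis.
From mathcomp Require Import measurable_realfun simple_functions.
From mathcomp Require Import ring lra.
Import Order.TTheory GRing.Theory Num.Theory.
Import numFieldNormedType.Exports.
Local Open Scope ring_scope.
Local Open Scope classical_set_scope.

(* On the disk the error is the H^2 function e = (G - Gr) o phi, with boundary
   values E.  Perturbing the parameters perturbs E by an explicit rational
   function h, and minimality gives 2 Re <E, h> <= |h|^2, hence Re <E, h> = 0
   to first order.  For h = k and h = k / (z - lambda), the reproducing property
   <E, K_w> = e(w) of the Szego kernel K_w, and w = 1 / conj lambda, turn this
   into e(0) = 0 and e(w) = 0; moving lambda turns it into e'(w) = 0.

   The boundary values require Fatou's theorem in H^2.  The Taylor polynomials
   of e are cut into blocks of geometrically decreasing L^2 norm; each block is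
   bounded on radii by its Poisson integral, hence by the Hardy-Littlewood
   maximal function, and Borel-Cantelli gives uniform convergence of the blocks
   along almost every radius.  That e is the sum of its Taylor series on the
   whole disk comes from the maximum principle. *)

Set Implicit Arguments.
Unset Strict Implicit.
Unset Printing Implicit Defensive.

(** The norm to be minimized is an integral of radial limits, so minimality says nothing until these
    limits are known to exist almost everywhere, to be square integrable, and to be approximated in
    mean square by Taylor polynomials. The bounded circle means enter through the square summability
    of the Taylor coefficients alone, which passes from G and Gr to their difference.

    Complex identities are stated as identities of real parts with an arbitrary complex factor, so
    that all integrals are real.

    Moving a pole is not a linear perturbation. The moved pole is parametrized by its reflection w +
    v in the unit circle; since e(w) = 0 is already known, the pairing of E with the perturbation
    is, up to sign, the real part of conj k * (w + v) * e(w + v), and the kernel need not be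
    differentiated in lambda. What is obtained is e'(w) = 0 for e = (G - Gr) o phi, and phi'(w) != 0
    carries it over to G - Gr. *)

(** * The modulus as a real number, limits with real epsilons, and points of the unit circle *)

Section ComplexBasics.
Context {R : realType}.
Notation C := (cplx R).
Notation nrm := (@Normc.normc R).
Implicit Types z w : C.

Lemma nrmM z w : nrm (z * w) = nrm z * nrm w.
Proof. exact: Normc.normcM. Qed.

Lemma ler_nrmD z w : nrm (z + w) <= nrm z + nrm w.
Proof. by have := ler_normD z w; rewrite -[(_ <= _)%R]/(_%:C%C <= _%:C%C + _%:C%C) -rmorphD lecR. Qed.

Lemma nrmN z : nrm (- z) = nrm z.
Proof. exact: complexI (normrN z). Qed.

Lemma nrmB z w : nrm (z - w) = nrm (w - z).
Proof. by rewrite -nrmN opprB. Qed.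

Lemma nrm0 : nrm 0 = 0.
Proof. exact: Normc.normc0. Qed.

Lemma nrm1 : nrm 1 = 1.
Proof. exact: Normc.normc1. Qed.

Lemma nrm_ge0 z : 0 <= nrm z.
Proof. by have := normr_ge0 z; rewrite -[(_ <= _)%R]/(0%:C%C <= _%:C%C) lecR. Qed.

Lemma nrm0_eq0 z : nrm z = 0 -> z = 0.
Proof. exact: Normc.eq0_normc. Qed.

Lemma nrm_gt0 z : (0 < nrm z) = (z != 0).
Proof.
rewrite lt_def nrm_ge0 andbT; congr (~~ _); apply/eqP/eqP => [/nrm0_eq0 //|->].
exact: nrm0.
Qed.

Lemma nrmX z n : nrm (z ^+ n) = nrm z ^+ n.
Proof. by elim: n => [|n IH]; rewrite ?expr0 ?nrm1 // !exprS nrmM IH. Qed.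

Lemma nrmV z : nrm (z^-1) = (nrm z)^-1.
Proof. exact: Normc.normcV. Qed.

Lemma nrm_real (x : R) : nrm (x%:C%C) = `|x|.
Proof. by rewrite /= expr0n /= addr0 sqrtr_sqr. Qed.

Lemma nrmJ z : nrm (z^*) = nrm z.
Proof. by apply: complexI; have := norm_conjC z. Qed.

Lemma ler_nrm_sum (I : Type) (s : seq I) (P : pred I) (F : I -> C) :
  nrm (\sum_(i <- s | P i) F i) <= \sum_(i <- s | P i) nrm (F i).
Proof.
elim/big_rec2: _ => [|i y x _ IH]; first by rewrite nrm0.
by apply: le_trans (ler_nrmD _ _) _; rewrite lerD2l.
Qed.

Lemma ler_nrm_dist z w : `|nrm z - nrm w| <= nrm (z - w).
Proof.
rewrite ler_norml; have := ler_nrmD (z - w) w; have := ler_nrmD (w - z) z.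
by rewrite !subrK (nrmB w z) => ? ?; apply/andP; split; lra.
Qed.

Lemma ltr_norm_real z (r : R) : (`|z| < r%:C%C) = (nrm z < r).
Proof. by rewrite -ltcR. Qed.

Lemma norm_lt1 z : (`|z| < 1) = (nrm z < 1).
Proof. exact: ltr_norm_real. Qed.

Lemma norm_gt1 z : (1 < `|z|) = (1 < nrm z).
Proof. by rewrite -(ltcR 1). Qed.

Lemma unit_diskE z : unit_disk z <-> nrm z < 1.
Proof. by rewrite /unit_disk /= norm_lt1. Qed.

Lemma posC (e : C) : 0 < e -> exists2 r : R, 0 < r & e = r%:C%C.
Proof.
by case: e => x y; rewrite ltcE /= => /andP[/eqP /= -> x0]; exists x.
Qed.

Lemma nearC (a : C) (P : C -> Prop) : (\forall z \near a, P z) <->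
  exists2 r : R, 0 < r & forall z, nrm (z - a) < r -> P z.
Proof.
split=> [/nbhs_ballP[e /= e0 H]|[r r0 H]].
  have [r r0 re] := posC e0; exists r => // z zr; apply: H; rewrite -ball_normE /=.
  by rewrite re distrC ltr_norm_real.
apply/nbhs_ballP; exists (r%:C%C) => /=; first by rewrite ltcR.
move=> z; rewrite -ball_normE /= distrC ltr_norm_real; exact: H.
Qed.

Lemma cvgC (T : Type) (F : set_system T) (FF : Filter F) (f : T -> C) (l : C) :
  f @ F --> l <-> forall e : R, 0 < e -> \forall t \near F, nrm (f t - l) < e.
Proof.
split=> [/cvgrPdist_lt H e e0|H].
  have /H : (0 : C) < e%:C%C by rewrite ltcR.
  by apply: filterS => t; rewrite distrC ltr_norm_real.
apply/cvgrPdist_lt => e /posC[r r0 ->].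
by have := H r r0; apply: filterS => t; rewrite distrC ltr_norm_real.
Qed.

Lemma cReM z w : complex.Re (z * w) =
  complex.Re z * complex.Re w - complex.Im z * complex.Im w.
Proof. by case: z; case: w. Qed.

Lemma cImM z w : complex.Im (z * w) =
  complex.Re z * complex.Im w + complex.Im z * complex.Re w.
Proof. by case: z; case: w. Qed.

Lemma cReD z w : complex.Re (z + w) = complex.Re z + complex.Re w.
Proof. by case: z; case: w. Qed.

Lemma cImD z w : complex.Im (z + w) = complex.Im z + complex.Im w.
Proof. by case: z; case: w. Qed.

Lemma cReN z : complex.Re (- z) = - complex.Re z.
Proof. by case: z. Qed.

Lemma cImN z : complex.Im (- z) = - complex.Im z.
Proof. by case: z. Qed.

Lemma cReJ z : complex.Re (z^*) = complex.Re z.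
Proof. by case: z. Qed.

Lemma cImJ z : complex.Im (z^*) = - complex.Im z.
Proof. by case: z. Qed.

Lemma nrm2E z : nrm z ^+ 2 = complex.Re z ^+ 2 + complex.Im z ^+ 2.
Proof. by case: z => x y /=; rewrite sqr_sqrtr // addr_ge0 ?sqr_ge0. Qed.

Lemma mulcJ z : z * z^* = (nrm z ^+ 2)%:C%C.
Proof.
by rewrite nrm2E; case: z => x y; apply/eqP; rewrite eq_complex /=; apply/andP; split;
  apply/eqP; rewrite /=; ring.
Qed.

Lemma ler_Re_nrm z : `|complex.Re z| <= nrm z.
Proof.
by rewrite -(ler_pXn2r (n := 2)) ?nnegrE ?nrm_ge0 // nrm2E (real_normK (num_real _)) lerDl sqr_ge0.
Qed.

Lemma ler_Im_nrm z : `|complex.Im z| <= nrm z.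
Proof.
by rewrite -(ler_pXn2r (n := 2)) ?nnegrE ?nrm_ge0 // nrm2E (real_normK (num_real _)) lerDr sqr_ge0.
Qed.

Lemma ler_nrm_ReIm z : nrm z <= `|complex.Re z| + `|complex.Im z|.
Proof.
rewrite -(ler_pXn2r (n := 2)) ?nnegrE ?nrm_ge0 ?addr_ge0 // nrm2E.
by rewrite sqrrD !(real_normK (num_real _)) -addrA lerD2l lerDr mulrn_wge0 // mulr_ge0.
Qed.

Lemma le0_geometric (x B q : R) : 0 <= q < 1 ->
  (forall n, x <= B * q ^+ n.+1) -> x <= 0.
Proof.
move=> /andP[q0 q1] H.
have cv : (B * q) * q ^+ n @[n --> \oo] --> (0 : R).
  by apply: cvg_geometric; rewrite ger0_norm.
have <- := cvg_lim (@Rhausdorff R) cv; apply: limr_ge; first exact: cvgP cv.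
by apply: nearW => n; rewrite -mulrA -exprS.
Qed.

Lemma ler_sum_geometric (q : R) n : 0 <= q < 1 -> \sum_(i < n) q ^+ i <= (1 - q)^-1.
Proof.
move=> /andP[q0 q1]; have p1 : 0 < 1 - q by lra.
rewrite -(ler_pM2l p1) divff ?gt_eqF //.
have -> : (1 - q) * \sum_(i < n) q ^+ i = - (q ^+ n - 1) by rewrite subrX1; ring.
by have := exprn_ge0 n q0; lra.
Qed.



Lemma expi_nrm t : nrm (expi t : C) = 1.
Proof. by rewrite /= cos2Dsin2 sqrtr1. Qed.

Lemma expi0 : expi 0 = 1 :> C.
Proof. by rewrite /expi cos0 sin0. Qed.

Lemma expiD s t : expi (s + t) = expi s * expi t :> C.
Proof.
rewrite /expi sinD cosD; apply/eqP; rewrite eq_complex /=.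
by apply/andP; split; apply/eqP; rewrite ?cReM ?cImM /=; ring.
Qed.

Lemma expiX t n : (expi t : C) ^+ n = expi (t *+ n).
Proof. by elim: n => [|n IH]; rewrite ?mulr0n ?expi0 // exprS IH mulrS expiD. Qed.

Lemma expi2pi : expi (2 * pi) = 1 :> C.
Proof. by rewrite /expi mulr_natl cos2pi sin2pi. Qed.

Lemma expi_mulJ t : (expi t : C) * (expi t)^* = 1.
Proof. by rewrite mulcJ expi_nrm expr1n. Qed.

Lemma expi_neq1 t : 0 < t < 2 * pi -> expi t != 1 :> C.
Proof.
move=> /andP[t0 t1]; apply/eqP => /(congr1 (@complex.Re R)) /=.
(* The half angle lies strictly between 0 and pi, and cos t = 1 - 2 sin(t/2)^2 < 1. *)
have -> : t = (t / 2) *+ 2 by rewrite mulr2n; lra.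
have : 0 < sin (t / 2) by apply: sin_gt0_pi; rewrite divr_gt0 //=; lra.
rewrite mulr2n cosD -!expr2; have := cos2Dsin2 (t / 2).
by move=> ? ?; nra.
Qed.

Lemma exists_root_of_unity N : (0 < N)%N -> exists w : C,
  [/\ w ^+ N = 1, nrm w = 1 & forall j, (0 < j < N)%N -> w ^+ j != 1].
Proof.
move=> N0; have NR : (0 : R) < N%:R by rewrite ltr0n.
exists (expi (2 * pi / N%:R)); split; last move=> j /andP[j0 jN].
- by rewrite expiX -[_ *+ N]mulr_natr divfK ?expi2pi ?gt_eqF.
- exact: expi_nrm.
- rewrite expiX; apply: expi_neq1; rewrite -[_ *+ j]mulr_natr.
  have pp := pi_gt0 R; rewrite -mulrA; apply/andP; split.
    by rewrite !mulr_gt0 ?invr_gt0 ?ltr0n.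
  rewrite gtr_pMr ?mulr_gt0 // mulrC ltr_pdivrMr // mul1r ltr_nat //.
Qed.

End ComplexBasics.

(** * Local power series expansions with an explicit truncation error *)

Section PowerSeries.
Context {R : realType}.
Notation C := (cplx R).
Notation nrm := (@Normc.normc R).
Implicit Types (z w u : C) (f g : C -> C) (c : nat -> C).

Definition psum c n z : C := \sum_(k < n) c k * z ^+ k.

Lemma psumS c n z : psum c n.+1 z = psum c n z + c n * z ^+ n.
Proof. by rewrite /psum big_ord_recr. Qed.

Lemma psum0 c z : psum c 0 z = 0.
Proof. by rewrite /psum big_ord0. Qed.

Lemma psum_recl c n z : psum c n.+1 z = c 0%N + z * psum (fun k => c k.+1) n z.
Proof.
rewrite /psum big_ord_recl expr0 mulr1; congr (_ + _); rewrite big_distrr /=.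
by apply: eq_bigr => i _; rewrite exprS mulrCA.
Qed.

Lemma psumD c c' n z : psum (fun k => c k + c' k) n z = psum c n z + psum c' n z.
Proof. by rewrite /psum -big_split; apply: eq_bigr => i _; rewrite mulrDl. Qed.

Lemma psumZ a c n z : psum (fun k => a * c k) n z = a * psum c n z.
Proof. by rewrite /psum big_distrr; apply: eq_bigr => i _; rewrite -mulrA. Qed.

Lemma psum_dilate w c n z : psum (fun k => c k * w ^+ k) n z = psum c n (w * z).
Proof. by apply: eq_bigr => i _; rewrite exprMn mulrA. Qed.

Lemma ler_ratio_exp (x r r' : R) n : 0 <= x -> 0 < r -> r <= r' ->
  (x / r') ^+ n <= (x / r) ^+ n.
Proof.
move=> x0 r0 rr; have r'0 := lt_le_trans r0 rr.
rewrite lerXn2r ?nnegrE ?divr_ge0 ?(ltW r0) ?(ltW r'0) //.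
by rewrite ler_wpM2l // lef_pV2 ?posrE.
Qed.

(* All truncated expansions are required at once: [n = 0] bounds [f], [n = 1]
   gives continuity, [n = 2] differentiability, and [n --> oo] convergence of
   the series. *)
Definition ana f (a : C) (c : nat -> C) : Prop :=
  exists r B, [/\ 0 < r, 0 <= B &
    forall n u, nrm u < r -> nrm (f (a + u) - psum c n u) <= B * (nrm u / r) ^+ n].

Lemma psum_tail c (s B : R) n j u : 0 < s -> 0 <= B ->
  (forall k, nrm (c k) * s ^+ k <= B) -> nrm u < s ->
  nrm (psum c (n + j) u - psum c n u) <= B / (1 - nrm u / s) * (nrm u / s) ^+ n.
Proof.
move=> s0 B0 cB us; set q := nrm u / s.
have q01 : 0 <= q < 1 by rewrite /q divr_ge0 ?nrm_ge0 ?ltW // ltr_pdivrMr // mul1r.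
have -> : psum c (n + j) u - psum c n u = \sum_(i < j) c (n + i)%N * u ^+ (n + i).
  by rewrite /psum big_split_ord /= addrAC subrr add0r.
apply: le_trans (ler_nrm_sum _ _ _) _.
apply: (@le_trans _ _ (\sum_(i < j) B * q ^+ n * q ^+ i)).
  apply: ler_sum => i _; rewrite nrmM nrmX -mulrA -exprD.
  have -> : nrm u = q * s by rewrite /q divfK ?gt_eqF.
  rewrite exprMn mulrCA [leRHS]mulrC ler_wpM2l //.
  by rewrite exprn_ge0 //; case/andP: q01.
rewrite -big_distrr /= [leRHS]mulrAC ler_wpM2l ?ler_sum_geometric //.
by rewrite mulr_ge0 // exprn_ge0 //; case/andP: q01.
Qed.

Lemma cvg_terms_bounded (t : nat -> C) (l : C) :
  series t n @[n --> \oo] --> l -> exists2 B : R, 0 <= B & forall n, nrm (t n) <= B.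
Proof.
move=> /cvgC/(_ _ ltr01)[N _ HN].
exists (\sum_(i < N) nrm (t i) + 2).
  by rewrite addr_ge0 ?sumr_ge0 // => i _; exact: nrm_ge0.
move=> n; have [nN|Nn] := ltnP n N.
  rewrite (bigD1 (Ordinal nN)) //= -!addrA lerDl addr_ge0 ?sumr_ge0 // => i _.
  exact: nrm_ge0.
have h1 := HN n Nn; have h2 := HN n.+1 (leqW Nn).
rewrite /series /= in h1 h2; rewrite big_nat_recr //= in h2.
set s := \sum_(0 <= k < n) t k in h1 h2.
have -> : t n = (s + t n - l) + - (s - l) by ring.
have := ler_nrmD (s + t n - l) (- (s - l)); rewrite (nrmN (s - l)).
have : 0 <= \sum_(i < N) nrm (t i) by apply: sumr_ge0 => i _; exact: nrm_ge0.
by move=> ? ?; lra.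
Qed.

(** Convergence at the single point a + s bounds all |c k| s^k by some B, as in Abel's lemma. On the
    disk of radius s/2 the tails are then geometric with ratio below 1/2, hence the constant 2 *
    B. *)
Lemma analytic_on_ana (A : set C) f a : analytic_on A f -> A a -> exists c, ana f a c.
Proof.
move=> H /H [c /nearC[e e0 {}H]]; exists c.
pose s := e / 2; have s0 : 0 < s by rewrite divr_gt0.
have [B B0 cB] : exists2 B : R, 0 <= B & forall k, nrm (c k) * s ^+ k <= B.
  have /H cv : nrm ((a + s%:C%C) - a) < e.
    by rewrite addrC addKr nrm_real gtr0_norm // /s; lra.
  have [B B0 HB] := cvg_terms_bounded cv; exists B => // k.
  by have := HB k; rewrite nrmM nrmX addrC addKr nrm_real gtr0_norm.
exists (s / 2), (2 * B); split; rewrite ?divr_gt0 ?mulr_ge0 // => n u us.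
have /H/cvgC cv : nrm ((a + u) - a) < e by rewrite addrC addKr; rewrite /s in us; lra.
have q0 : 0 <= nrm u / s by rewrite divr_ge0 ?nrm_ge0 ?ltW.
have q2 : nrm u / s < 1 / 2 by rewrite ltr_pdivrMr //; lra.
apply/ler_addgt0Pr => eps eps0; have [N _ HN] := cv _ eps0.
have {HN} := HN (n + N)%N (leq_addl _ _).
rewrite /series /= (_ : \sum_(0 <= k < n + N) _ = psum c (n + N) u); last first.
  by rewrite big_mkord; apply: eq_bigr => i _; rewrite [a + u]addrC addrK.
have us' : nrm u < s by lra.
have := @psum_tail c s B n N u s0 B0 cB us'.
set x := psum c (n + N) u => h1; rewrite nrmB => h2.
have -> : f (a + u) - psum c n u = (f (a + u) - x) + (x - psum c n u) by ring.
apply: le_trans (ler_nrmD _ _) _; rewrite addrC lerD //; last exact: ltW.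
have pq : 0 < 1 - nrm u / s by lra.
apply: le_trans h1 _; rewrite ler_pM ?exprn_ge0 //.
- by rewrite divr_ge0 // subr_ge0; lra.
- by rewrite ler_pdivrMr; last lra; nra.
- by rewrite ler_ratio_exp ?nrm_ge0 ?divr_gt0 //; lra.
Qed.

Lemma ana_coef0 f a c : ana f a c -> c 0%N = f a.
Proof.
move=> [r [B [r0 B0 H]]]; have := H 1%N 0; rewrite nrm0 mul0r expr1 mulr0 addr0.
rewrite /psum big_ord1 expr0 mulr1 => /(_ r0) h.
have /nrm0_eq0/eqP : nrm (f a - c 0%N) = 0 by apply/eqP; rewrite eq_le h nrm_ge0.
by rewrite subr_eq0 => /eqP.
Qed.

(** The term c n * u^n is the difference of two consecutive truncation errors, taken here at u =
    r/2. *)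
Lemma ana_coef_bound f a c (r B : R) : 0 < r -> 0 <= B ->
  (forall n u, nrm u < r -> nrm (f (a + u) - psum c n u) <= B * (nrm u / r) ^+ n) ->
  forall n, nrm (c n) * (r / 2) ^+ n <= 2 * B.
Proof.
move=> r0 B0 H n; pose u : C := (r / 2)%:C%C.
have nu : nrm u = r / 2 by rewrite nrm_real gtr0_norm // divr_gt0.
have ur : nrm u < r by rewrite nu; lra.
have q : nrm u / r = 1 / 2 by rewrite nu; field; rewrite gt_eqF.
have := H n.+1 u ur; have := H n u ur; rewrite q psumS => h1 h2.
have := ler_nrmD (f (a + u) - psum c n u) (- (f (a + u) - (psum c n u + c n * u ^+ n))).
rewrite (_ : _ + _ = c n * u ^+ n); last by ring.
rewrite nrmM nrmX nu nrmN => h3; apply: le_trans h3 _.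
have l1 m : B * (1 / 2) ^+ m <= B.
  by rewrite ler_piMr // exprn_ile1 //; lra.
by have := l1 n; have := l1 n.+1; lra.
Qed.

(** Two expansions can thus share a radius: a smaller r only increases |u| / r, so the same B
    serves. *)
Lemma ana_shrink f a c r' : 0 < r' -> ana f a c -> exists r B,
  [/\ 0 < r, r <= r', 0 <= B &
    forall n u, nrm u < r -> nrm (f (a + u) - psum c n u) <= B * (nrm u / r) ^+ n].
Proof.
move=> r'0 [r [B [r0 B0 H]]]; exists (Num.min r r'), B.
split; rewrite ?lt_min ?r0 ?r'0 ?ge_min ?lexx ?orbT // => n u; rewrite lt_min => /andP[ur _].
apply: le_trans (H n u ur) _; rewrite ler_wpM2l // ler_ratio_exp ?nrm_ge0 ?lt_min ?r0 //.
by rewrite ge_min lexx.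
Qed.

Lemma anaD f g a c c' : ana f a c -> ana g a c' ->
  ana (fun z => f z + g z) a (fun k => c k + c' k).
Proof.
move=> [r' [B' [r'0 B'0 H']]] /(ana_shrink r'0) [r [B [r0 rr' B0 H]]].
exists r, (B' + B); split; rewrite ?addr_ge0 // => n u ur.
rewrite psumD (_ : _ - _ = (f (a + u) - psum c n u) + (g (a + u) - psum c' n u)); last by ring.
apply: le_trans (ler_nrmD _ _) _; rewrite mulrDl lerD // ?H //.
apply: le_trans (H' n u (lt_le_trans ur rr')) _.
by rewrite ler_wpM2l // ler_ratio_exp ?nrm_ge0.
Qed.

Lemma anaZ b f a c : ana f a c -> ana (fun z => b * f z) a (fun k => b * c k).
Proof.
move=> [r [B [r0 B0 H]]]; exists r, (nrm b * B).
split; rewrite ?mulr_ge0 ?nrm_ge0 // => n u ur.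
by rewrite psumZ -mulrBr nrmM -mulrA ler_wpM2l ?nrm_ge0 ?H.
Qed.

Lemma ana_rotate w f a c : nrm w = 1 -> ana f (w * a) c ->
  ana (fun z => f (w * z)) a (fun k => c k * w ^+ k).
Proof.
move=> w1 [r [B [r0 B0 H]]]; exists r, B; split=> // n u ur.
have nu : nrm (w * u) = nrm u by rewrite nrmM w1 mul1r.
by rewrite psum_dilate mulrDr -nu H // nu.
Qed.

Lemma ana_cst b a : ana (fun=> b) a (fun k => if k == 0%N then b else 0).
Proof.
exists 1, (nrm b); split; rewrite ?nrm_ge0 // => -[|n] u u1.
  by rewrite psum0 subr0 expr0 mulr1.
rewrite psum_recl /= /psum big1 ?mulr0 ?addr0 ?subrr ?nrm0 => [|i _]; last by rewrite mul0r.
by rewrite mulr_ge0 ?exprn_ge0 ?divr_ge0 ?nrm_ge0.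
Qed.

Lemma ana_sum N (F : 'I_N -> C -> C) a : (forall i, exists c, ana (F i) a c) ->
  exists c, ana (fun z => \sum_(i < N) F i z) a c.
Proof.
elim: N F => [|N IH] F H.
  have [c hc] : exists c, ana (fun=> 0) a c by eexists; exact: ana_cst.
  by exists c; rewrite (_ : (fun _ => _) = fun=> 0) //; apply/funext => z; rewrite big_ord0.
have [c hc] := IH (fun i => F (widen_ord (leqnSn N) i)) (fun i => H _).
have [c' hc'] := H ord_max; have := anaD hc hc'.
set c'' := fun k : nat => _; exists c''.
by rewrite (_ : (fun z => \sum_(i < N.+1) F i z) = fun z => \sum_(i < N) F (widen_ord (leqnSn N) i) z + F ord_max z) //; apply/funext => z; rewrite big_ord_recr.
Qed.

Lemma ana_continuous f a c : ana f a c -> forall e : R, 0 < e ->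
  exists2 d : R, 0 < d & forall z, nrm (z - a) < d -> nrm (f z - f a) < e.
Proof.
move=> af e e0; have c0 := ana_coef0 af; move: af => [r [B [r0 B0 H]]].
have B1 : 0 < B + 1 by lra.
exists (Num.min r (r * e / (B + 1))); first by rewrite lt_min r0 divr_gt0 ?mulr_gt0.
move=> z; rewrite lt_min => /andP[zr ze]; have := H 1%N (z - a) zr.
rewrite psum_recl psum0 mulr0 addr0 c0 expr1 [a + _]addrC subrK => h.
apply: le_lt_trans h _; rewrite ltr_pdivlMr // in ze.
rewrite mulrA ltr_pdivrMr //; have := nrm_ge0 (z - a); nra.
Qed.

Lemma ana_derive1 f a c : ana f a c -> f^`() a = c 1%N.
Proof.
move=> af; have c0 := ana_coef0 af; move: af => [r [B [r0 B0 H]]].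
apply: cvg_lim; first exact: norm_hausdorff.
apply/cvgC => e e0.
have B1 : 0 < B + 1 by lra.
have r2 : 0 < r ^+ 2 by rewrite exprn_gt0.
apply/nearC; exists (Num.min r (e * r ^+ 2 / (B + 1))).
  by rewrite lt_min r0 divr_gt0 ?mulr_gt0.
move=> h; rewrite subr0 lt_min => /andP[hr he] h0.
have nh : 0 < nrm h by rewrite nrm_gt0.
have := H 2%N h hr; rewrite !psum_recl psum0 mulr0 addr0 c0 [a + h]addrC => hB.
have -> : h^-1 *: (f (h + a) - f a) - c 1%N = h^-1 * (f (h + a) - (f a + h * c 1%N)).
  by rewrite -[_ *: _]/(_ * _); field.
rewrite nrmM nrmV mulrC ltr_pdivrMr //; apply: le_lt_trans hB _.
rewrite ltr_pdivlMr // in he.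
rewrite expr_div_n mulrA ltr_pdivrMr //.
have : nrm h * (B + 1) * nrm h < e * r ^+ 2 * nrm h by rewrite ltr_pM2r.
by have := mulr_gt0 nh nh; lra.
Qed.

(** The quotient is constructed formally: comparing coefficients in (a + u) * sum d k u^k = sum c k
    u^k determines d, and [dE] is this identity after truncation, with its one extra term. A
    geometric bound on d controls that term, and |a + u| >= |a|/2 allows the final division. *)
Lemma ana_div a f c : a != 0 -> ana f a c -> exists c', ana (fun z => f z / z) a c'.
Proof.
move=> a0; have na : 0 < nrm a by rewrite nrm_gt0.
have na2 : 0 < nrm a / 2 by rewrite divr_gt0.
move=> /(ana_shrink na2) [r [B [r0 ra B0 H]]].
pose d := fix d n := if n is n'.+1 then (c n - d n') / a else c 0%N / a.
have dE n u : (a + u) * psum d n.+1 u = psum c n.+1 u + d n * u ^+ n.+1.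
  elim: n => [|n IH]; first by rewrite !psum_recl !psum0 /=; field.
  by rewrite psumS mulrDr IH [in RHS]psumS /= !exprS; field.
have cB := ana_coef_bound r0 B0 H.
pose s := r / 2; have s0 : 0 < s by rewrite divr_gt0.
(* Chosen to be preserved by the recursion for d: as s <= |a|/2 gives D * s <= 2 * B, the next term
   is at most (2 * B + D * s) / |a| <= D. *)
pose D := 2 * (2 * B) / nrm a.
have D0 : 0 <= D by rewrite divr_ge0 ?mulr_ge0 ?nrm_ge0.
have dB n : nrm (d n) * s ^+ n <= D.
  elim: n => [|n IH] /=.
    rewrite nrmM nrmV expr0 mulr1 /D ler_pM2r ?invr_gt0 //.
    by have := cB 0%N; rewrite expr0 mulr1 => ?; lra.
  rewrite nrmM nrmV mulrAC /D ler_pM2r ?invr_gt0 //.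
  have h1 : nrm (c n.+1 - d n) * s ^+ n.+1 <= nrm (c n.+1) * s ^+ n.+1 + nrm (d n) * s ^+ n.+1.
    rewrite -mulrDl ler_wpM2r ?exprn_ge0 ?(ltW s0) //.
    by have := ler_nrmD (c n.+1) (- d n); rewrite nrmN.
  have h2 : nrm (d n) * s ^+ n.+1 <= 2 * B.
    rewrite exprS mulrCA; apply: le_trans (ler_wpM2l (ltW s0) IH) _.
    rewrite /D [leLHS]mulrA ler_pdivrMr //.
    have ss : s <= nrm a / 2 by rewrite /s; lra.
    by have := ler_wpM2l B0 ss; lra.
  by have := cB n.+1; lra.
exists d, s, (2 * (B + D * s) / nrm a).
have E0 : 0 <= B + D * s by rewrite addr_ge0 // mulr_ge0 // ltW.
split=> // [|n u us]; first by rewrite divr_ge0 ?mulr_ge0 ?nrm_ge0.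
have ur : nrm u < r by rewrite /s in us; lra.
have au : nrm a / 2 <= nrm (a + u).
  have := ler_nrmD (a + u) (- u); rewrite addrK nrmN; rewrite /s in us; lra.
have au0 : a + u != 0 by rewrite -nrm_gt0; lra.
have q0 : 0 <= nrm u / s by rewrite divr_ge0 ?nrm_ge0 ?ltW.
have sr : s <= r by rewrite /s; lra.
have key : nrm ((a + u) * (f (a + u) / (a + u) - psum d n u)) <= (B + D * s) * (nrm u / s) ^+ n.
  rewrite mulrBr mulrCA divff // mulr1.
  case: n => [|n].
    have := H 0%N u ur; rewrite !psum0 mulr0 expr0 !mulr1 => h; apply: le_trans h _.
    by rewrite lerDl mulr_ge0 // ltW.
  rewrite dE opprD addrA; apply: le_trans (ler_nrmD _ _) _; rewrite mulrDl lerD //.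
    by apply: le_trans (H n.+1 u ur) _; rewrite ler_wpM2l // ler_ratio_exp ?nrm_ge0.
  rewrite nrmN nrmM nrmX expr_div_n.
  have -> : D * s * (nrm u ^+ n.+1 / s ^+ n.+1) = D / s ^+ n * nrm u ^+ n.+1.
    have sn : s ^+ n != 0 by rewrite expf_neq0 // gt_eqF.
    have s1 : s != 0 by rewrite gt_eqF.
    rewrite [s ^+ n.+1]exprS; move: (s ^+ n) (nrm u ^+ n.+1) sn s1 => x y.
    by move: (D) (s) => D' s' ? ?; field; apply/andP.
  by rewrite ler_wpM2r ?exprn_ge0 ?nrm_ge0 // ler_pdivlMr ?exprn_gt0.
rewrite nrmM in key.
rewrite mulrAC ler_pdivlMr // mulrAC -mulrA mulrC.
have := nrm_ge0 (f (a + u) / (a + u) - psum d n u).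
by move: key au; set x := nrm _; set y := nrm (_ - _) => *; nra.
Qed.

Definition ana_disk f := forall a, nrm a < 1 -> exists c, ana f a c.

Lemma ana_eq_near f g a c : (exists2 d : R, 0 < d & forall z, nrm (z - a) < d -> f z = g z) ->
  ana f a c -> ana g a c.
Proof.
move=> [d d0 fg] /(ana_shrink d0) [r [B [r0 rd B0 H]]]; exists r, B; split=> // n u ur.
by rewrite -fg ?H // addrC addKr; apply: lt_le_trans rd.
Qed.

(** The quotient (f z - f 0) / z needs no theorem on removable singularities: at 0 the expansion of
    f is divided term by term, and elsewhere [ana_div] applies. *)
Lemma ana_disk_shift f : ana_disk f ->
  exists2 g, ana_disk g & forall z, f z = f 0 + z * g z.
Proof.
move=> af; have [|c fc] := af 0; first by rewrite nrm0.
pose g z := if z == 0 then c 1%N else (f z - f 0) / z.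
exists g => [a a1|z]; last first.
  rewrite /g; case: eqVneq => [->|z0]; first by rewrite mul0r addr0.
  by rewrite mulrCA divff // mulr1 addrC subrK.
have [->|a0] := eqVneq a 0; last first.
  have [c' fc'] := af a a1.
  have [c'' h] := ana_div a0 (anaD fc' (ana_cst (- f 0) a)); exists c''.
  apply: ana_eq_near h; exists (nrm a); first by rewrite nrm_gt0.
  move=> z za; rewrite /g; case: eqVneq => // z0; move: za.
  by rewrite z0 sub0r nrmN ltxx.
exists (fun k => c k.+1); have c0 := ana_coef0 fc; have [r [B [r0 B0 H]]] := fc.
have cB := ana_coef_bound r0 B0 H 1%N; rewrite expr1 in cB.
(* The constant is dictated by u = 0 and n = 0, where the error is |c 1| <= 4 * B / r. *)
exists r, (4 * B / r); split=> //; first by rewrite divr_ge0 ?mulr_ge0 // ltW.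
move=> n u ur; rewrite add0r.
have [->|u0] := eqVneq u 0.
  rewrite /g eqxx nrm0 mul0r; case: n => [|n].
    by rewrite psum0 subr0 expr0 mulr1 ler_pdivlMr //; lra.
  by rewrite psum_recl mul0r addr0 subrr nrm0 expr0n mulr0.
have nu : 0 < nrm u by rewrite nrm_gt0.
have := H n.+1 u ur; rewrite add0r psum_recl c0 => h.
rewrite -(ler_pM2l nu) -nrmM mulrBr /g (negbTE u0) mulrCA divff // mulr1.
rewrite -addrA -opprD; apply: le_trans h _.
rewrite exprS [leRHS](_ : _ = 4 * (B * (nrm u / r * (nrm u / r) ^+ n))); last by ring.
have : 0 <= B * (nrm u / r * (nrm u / r) ^+ n).
  by rewrite mulr_ge0 // -exprS exprn_ge0 // divr_ge0 ?nrm_ge0 ?ltW.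
lra.
Qed.

End PowerSeries.

(** * The maximum principle on disks centered at 0 *)

Section MaximumPrinciple.
Context {R : realType}.
Notation C := (cplx R).
Notation nrm := (@Normc.normc R).
Implicit Types (z w u : C) (f g : C -> C) (c : nat -> C).

(** Compactness is taken from the square in [R * R], a product of segments, and carried to C by this
    map. *)
Definition cpair (p : R * R) : C := (p.1 +i* p.2)%C.

Lemma cpair_near (p : R * R) (d : R) : 0 < d ->
  \forall q \near p, nrm (cpair q - cpair p) < d.
Proof.
move=> d0; apply/nbhs_ballP; exists (d / 2); first by rewrite /= divr_gt0.
move=> q [b1 b2]; rewrite -ball_normE /= in b1; rewrite -ball_normE /= in b2.
apply: le_lt_trans (ler_nrm_ReIm _) _.
rewrite cReD cImD cReN cImN /cpair /= (distrC q.1) (distrC q.2); lra.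
Qed.

Definition cts_at (h : C -> R) z := forall e : R, 0 < e ->
  exists2 d : R, 0 < d & forall z', nrm (z' - z) < d -> `|h z' - h z| < e.

Lemma cpair_max (P : C -> Prop) (h : C -> R) rho :
  (exists z, P z) -> (forall z, P z -> nrm z <= rho) ->
  (forall z, ~ P z -> exists2 d : R, 0 < d & forall z', nrm (z' - z) < d -> ~ P z') ->
  (forall z, P z -> cts_at h z) ->
  exists2 z0, P z0 & forall z, P z -> h z <= h z0.
Proof.
move=> [z1 Pz1] Pb Pc hc; pose K := [set p | P (cpair p)].
have cE z : cpair (complex.Re z, complex.Im z) = z by case: z.
have cK : compact K.
  have := compact_setX (@segment_compact R (- rho) rho) (@segment_compact R (- rho) rho).
  move=> cS; apply: (subclosed_compact _ cS).
    rewrite -[K]setCK; apply: open_closedC; rewrite openE => p Kp.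
    have [d d0 H] := Pc _ Kp; rewrite /interior.
    by apply: filterS (cpair_near p d0) => q /H.
  move=> [x y] /Pb h1; have := ler_Re_nrm (cpair (x, y)); have := ler_Im_nrm (cpair (x, y)).
  move=> h2 h3; have /= := le_trans h2 h1; have /= := le_trans h3 h1.
  by rewrite !ler_norml => ? ?; split; rewrite /= in_itv.
have K0 : K !=set0 by exists (complex.Re z1, complex.Im z1); rewrite /K /= cE.
have [|p Kp pM] := @compact_EVT_max _ R (h \o cpair) K K0 cK.
  apply: continuous_in_subspaceT => p /set_mem Kp.
  apply/cvgrPdist_lt => e e0; have [d d0 H] := hc _ Kp e e0.
  by apply: filterS (cpair_near p d0) => q /H; rewrite distrC.
exists (cpair p); first exact: set_mem Kp.
move=> z Pz; rewrite -{1}(cE z); apply: pM.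
by rewrite inE /K /= cE.
Qed.

Lemma cts_nrm z : cts_at nrm z.
Proof.
move=> e e0; exists e => // z' h; exact: le_lt_trans (ler_nrm_dist _ _) h.
Qed.

Lemma ana_cts_nrm f z c : ana f z c -> cts_at (fun z => nrm (f z)) z.
Proof.
move=> fc e e0; have [d d0 H] := ana_continuous fc e0.
exists d => // z' h; exact: le_lt_trans (ler_nrm_dist _ _) (H _ h).
Qed.

Lemma disk_max f rho : 0 <= rho < 1 -> ana_disk f ->
  exists2 z0, nrm z0 <= rho & forall z, nrm z <= rho -> nrm (f z) <= nrm (f z0).
Proof.
move=> /andP[r0 r1] af; apply: (@cpair_max (fun z => nrm z <= rho) _ rho) => //.
- by exists 0; rewrite nrm0.
- move=> z /negP; rewrite -ltNge => h.
  have e0 : 0 < nrm z - rho by rewrite subr_gt0.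
  have [d d0 H] := cts_nrm z e0; exists d => // z' /H.
  by rewrite ltr_norml => /andP[? ?] ?; lra.
- move=> z zr; have [|c fc] := af z; first exact: le_lt_trans r1.
  exact: ana_cts_nrm fc.
Qed.

(** If some coefficient of positive order is nonzero, a small step of length s, in the direction
    where the first such term has the phase of f a, increases |f| by |c m.+1| s^(m+1) up to an error
    of order s^(m+2), against maximality. Otherwise the truncation errors show that f itself is
    constant near a. *)
Lemma ana_locmax f a c (d : R) : ana f a c -> 0 < d ->
  (forall u, nrm u < d -> nrm (f (a + u)) <= nrm (f a)) ->
  exists2 d' : R, 0 < d' & forall u, nrm u < d' -> nrm (f (a + u)) = nrm (f a).
Proof.
move=> fc d0 fM; have c0 := ana_coef0 fc.
have [fa0|fa0] := eqVneq (f a) 0.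
  exists d => // u /fM; rewrite fa0 nrm0 => h; apply/eqP.
  by rewrite eq_le h nrm_ge0.
move: fc => /(ana_shrink d0) [r [B [r0 rd B0 H]]].
have [[k ck]|cz] := pselect (exists k, c k.+1 != 0); last first.
  exists r => // u ur; congr (nrm _); apply/eqP; rewrite -subr_eq0; apply/eqP/nrm0_eq0.
  apply/eqP; rewrite eq_le nrm_ge0 andbT.
  apply: (@le0_geometric _ _ B (nrm u / r)) => [|n].
    by rewrite divr_ge0 ?nrm_ge0 ?(ltW r0) // ltr_pdivrMr // mul1r.
  have := H n.+1 u ur; rewrite psum_recl c0 /psum big1 ?mulr0 ?addr0 // => i _.
  case: (eqVneq (c i.+1) 0) => [->|ci]; first by rewrite mul0r.
  by case: cz; exists i.
have exk : exists k, c k.+1 != 0 by exists k.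
case: (ex_minnP exk) => m cm mmin {k ck exk}; exfalso.
have nf : 0 < nrm (f a) by rewrite nrm_gt0.
have nc : 0 < nrm (c m.+1) by rewrite nrm_gt0.
(* The quotient of the two phases; its root [w] of order m+1 is the direction sought. *)
pose x : C := (f a / (nrm (f a))%:C%C) / (c m.+1 / (nrm (c m.+1))%:C%C).
have nx : nrm x = 1.
  rewrite /x !nrmM !nrmV !nrmM !nrmV !nrm_real !ger0_norm ?nrm_ge0 //.
  by field; rewrite !gt_eqF.
pose w : C := (m.+1).-root x.
have wm : w ^+ m.+1 = x by rewrite /w rootCK.
have nw : nrm w = 1.
  by apply/eqP; rewrite -(@pexpr_eq1 _ (nrm w) m.+1) ?nrm_ge0 // -nrmX wm nx.
have B1 : 0 < B + 1 by lra.
(* Small enough for the error B (s/r)^(m+2) to stay below the gain s^(m+1) |c m.+1|, see [h5]. *)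
pose s := Num.min (r / 2) (nrm (c m.+1) * r ^+ m.+2 / (2 * (B + 1))).
have rm : 0 < r ^+ m.+2 by rewrite exprn_gt0.
have s0 : 0 < s by rewrite lt_min; apply/andP; split; rewrite divr_gt0 // mulr_gt0.
have sr : s < r.
  by apply: le_lt_trans (_ : r / 2 < r); [rewrite /s ge_min lexx | lra].
have sB : s * (2 * (B + 1)) <= nrm (c m.+1) * r ^+ m.+2.
  by rewrite -ler_pdivlMr ?mulr_gt0 // /s ge_min lexx orbT.
pose u := s%:C%C * w.
have nu : nrm u = s by rewrite /u nrmM nrm_real nw mulr1 gtr0_norm.
have ur : nrm u < r by rewrite nu.
have := H m.+2 u ur; rewrite nu psum_recl c0.
have -> : psum (fun k => c k.+1) m.+1 u = c m.+1 * u ^+ m.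
  rewrite psumS /psum big1 ?add0r // => i _.
  have [->|ci] := eqVneq (c i.+1) 0; first by rewrite mul0r.
  by have := mmin _ ci; rewrite leqNgt ltn_ord.
rewrite mulrCA -exprS.
have -> : c m.+1 * u ^+ m.+1 = f a * ((s ^+ m.+1 * nrm (c m.+1)) / nrm (f a))%:C%C.
  rewrite /u exprMn wm /x !rmorphM fmorphV rmorphXn /=.
  by field; rewrite cm !fmorph_eq0 !gt_eqF.
set q := _ / nrm (f a).
have q0 : 0 < q by rewrite /q divr_gt0 ?mulr_gt0 ?exprn_gt0.
have -> : f a + f a * q%:C%C = f a * (1 + q%:C%C) by ring.
move=> h.
have h2 := fM u (lt_le_trans ur rd).
have h3 := ler_nrmD (f (a + u)) (- (f (a + u) - f a * (1 + q%:C%C))).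
rewrite nrmN opprB addrCA subrr addr0 nrmM in h3.
set dist := nrm (_ - _) in h h3.
rewrite -[1 + _]/(1%:C%C + q%:C%C) -rmorphD nrm_real ger0_norm in h3; last by lra.
have h4 : nrm (f a) * q = s ^+ m.+1 * nrm (c m.+1) by rewrite /q mulrC divfK // gt_eqF.
have h5 : B * (s / r) ^+ m.+2 < s ^+ m.+1 * nrm (c m.+1).
  rewrite expr_div_n exprS mulrA ltr_pdivrMr //.
  have : 0 < s ^+ m.+1 by rewrite exprn_gt0.
  move: (s ^+ m.+1) => y y0.
  rewrite (_ : B * (s * y) = y * (B * s)); last by ring.
  rewrite -mulrA ltr_pM2l //.
  have ? := mulr_ge0 B0 (ltW s0); have ? := s0; lra.
rewrite mulrDr mulr1 h4 in h3; lra.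
Qed.

(** Suppose the maximum of |f| on the closed disk exceeds M. Among the points where it is attained
    take one, x, farthest from 0. It is not on the circle, so |f| is constant near x, and a step
    outwards yields a maximum point farther away. *)
Lemma max_principle f rho M : 0 < rho < 1 -> ana_disk f ->
  (forall z, nrm z = rho -> nrm (f z) <= M) ->
  forall z, nrm z <= rho -> nrm (f z) <= M.
Proof.
move=> /andP[r0 r1] af bM z zr.
have [|z0 z0r z0M] := @disk_max f rho _ af; first by rewrite r1 ltW.
apply: le_trans (z0M z zr) _; rewrite leNgt; apply/negP => Mz0.
pose P x := nrm x <= rho /\ nrm (f z0) <= nrm (f x).
have afz x : nrm x <= rho -> exists c, ana f x c by move=> xr; apply: af; exact: le_lt_trans r1.
have [||||x [xr xM] far] := @cpair_max P nrm rho.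
- by exists z0.
- by move=> x [].
- move=> x nP; have [xr|] := leP (nrm x) rho.
    have : nrm (f x) < nrm (f z0).
      by rewrite ltNge; apply/negP => h; apply: nP.
    rewrite -subr_gt0 => e0; have [c fc] := afz x xr.
    have [d d0 H] := ana_cts_nrm fc e0; exists d => // y /H.
    by rewrite ltr_norml => /andP[? ?] [_ ?]; lra.
  rewrite -subr_gt0 => e0; have [d d0 H] := cts_nrm x e0; exists d => // y /H.
  by rewrite ltr_norml => /andP[? ?] [? _]; lra.
- by move=> x _; exact: cts_nrm.
have xlt : nrm x < rho.
  rewrite lt_neqAle xr andbT; apply/eqP => /bM; lra.
have [c fc] := afz x xr.
have e0 : 0 < rho - nrm x by rewrite subr_gt0.
have [|d d0 H] := ana_locmax fc e0.
  move=> u ue; apply: le_trans xM; apply: z0M.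
  by have := ler_nrmD x u; lra.
(* The outward unit direction; at the center any direction leads outwards. *)
pose v : C := if x == 0 then 1 else x / (nrm x)%:C%C.
have v1 : nrm v = 1.
  rewrite /v; case: eqVneq => [_|x0]; first exact: nrm1.
  by rewrite nrmM nrmV nrm_real ger0_norm ?nrm_ge0 // divff // gt_eqF // nrm_gt0.
pose t := Num.min (d / 2) ((rho - nrm x) / 2).
have t0 : 0 < t by rewrite lt_min; apply/andP; split; rewrite divr_gt0.
have td : t < d by apply: le_lt_trans (_ : d / 2 < d); [rewrite /t ge_min lexx | lra].
have te : t <= (rho - nrm x) / 2 by rewrite /t ge_min lexx orbT.
have nt : nrm (t%:C%C * v) = t by rewrite nrmM nrm_real v1 mulr1 gtr0_norm.
have xt : nrm (x + t%:C%C * v) = nrm x + t.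
  rewrite /v; case: eqVneq => [->|x0]; first by rewrite add0r mulr1 nrm_real nrm0 add0r gtr0_norm.
  have nx : 0 < nrm x by rewrite nrm_gt0.
  have -> : x + t%:C%C * (x / (nrm x)%:C%C) = x * (1 + t / nrm x)%:C%C.
    by rewrite rmorphD rmorphM fmorphV rmorph1 /=; field; rewrite fmorph_eq0 gt_eqF.
  rewrite nrmM nrm_real ger0_norm; first by field; rewrite gt_eqF.
  by rewrite addr_ge0 // divr_ge0 // ltW.
have : nrm (x + t%:C%C * v) <= nrm x.
  apply: far; split; first by rewrite xt; lra.
  by rewrite H // nt.
rewrite xt; lra.
Qed.

End MaximumPrinciple.

(** * Cauchy estimates and convergence of the Taylor series on the whole disk *)

Section TaylorOnDisk.
Context {R : realType}.
Notation C := (cplx R).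
Notation nrm := (@Normc.normc R).
Implicit Types (z w u : C) (f g : C -> C) (c a : nat -> C).

(** [F n] is the Taylor remainder of order n at 0 divided by z^n, so the coefficients are the values
    [F n 0]. The iteration runs on functions packed with their analyticity. *)
Lemma iterated_shift f : ana_disk f -> exists F : nat -> C -> C,
  [/\ F 0%N = f, forall n, ana_disk (F n) &
      forall n z, F n z = F n 0 + z * F n.+1 z].
Proof.
move=> af; pose T := {g : C -> C | ana_disk g}.
have ex (g : T) : exists h : T, forall z, sval g z = sval g 0 + z * sval h z.
  by have [h ah hE] := ana_disk_shift (svalP g); exists (exist _ h ah).
have [s sE] := boolp.choice ex.
pose F n := iter n s (exist _ f af).
by exists (fun n => sval (F n)); split=> // n; exact: svalP.
Qed.

Lemma iterated_shiftE (F : nat -> C -> C) :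
  (forall n z, F n z = F n 0 + z * F n.+1 z) ->
  forall n z, F 0%N z = psum (fun k => F k 0) n z + z ^+ n * F n z.
Proof.
move=> H; elim=> [|n IH] z; first by rewrite psum0 add0r expr0 mul1r.
by rewrite psumS [LHS]IH (H n z) exprSr; ring.
Qed.

Lemma unity_root_sum w n j : (j < n.+1)%N ->
  w ^+ n.+1 = 1 -> (forall i, (0 < i < n.+1)%N -> w ^+ i != 1) ->
  \sum_(k < n.+1) w ^+ k * (w ^+ k) ^+ j = if j == n then n.+1%:R else 0.
Proof.
move=> jn w1 wi; have E k : w ^+ k * (w ^+ k) ^+ j = (w ^+ j.+1) ^+ k.
  by rewrite -exprS -!exprM mulnC.
under eq_bigr do rewrite E.
case: eqVneq => [->|jn'].
  by rewrite w1; under eq_bigr do rewrite expr1n; rewrite sumr_const card_ord.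
have wj : w ^+ j.+1 != 1 by apply: wi; rewrite /= ltnS ltn_neqAle jn' -ltnS.
have := subrX1 (w ^+ j.+1) n.+1; rewrite -exprM mulnC exprM w1 expr1n subrr => /esym/eqP.
by rewrite mulf_eq0 subr_eq0 (negbTE wj) => /eqP.
Qed.

(* Averaging [F (w ^+ k * z)] over the (n+1)-st roots of unity [w ^+ k], with
   weights [w ^+ k = (w ^+ k) ^- n], kills all the Taylor coefficients of [f]
   below the [n]-th one; the maximum principle then replaces Cauchy's integral
   formula. *)
Lemma cauchy_estimate (F : nat -> C -> C) rho M : 0 < rho < 1 ->
  (forall n, ana_disk (F n)) -> (forall n z, F n z = F n 0 + z * F n.+1 z) ->
  (forall z, nrm z = rho -> nrm (F 0%N z) <= M) ->
  forall n, nrm (F n 0) * rho ^+ n <= M.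
Proof.
move=> r01 aF FE bM n; have /andP[r0 r1] := r01.
have [w [w1 nw wi]] := @exists_root_of_unity R n.+1 isT.
pose u z : C := n.+1%:R^-1 * \sum_(k < n.+1) F n (w ^+ k * z).
have nwk k : nrm (w ^+ k) = 1 by rewrite nrmX nw expr1n.
have N0 : (n.+1%:R : C) != 0 by rewrite pnatr_eq0.
have nN : nrm (n.+1%:R : C) = n.+1%:R.
  by rewrite -(rmorph_nat (real_complex R)) nrm_real ger0_norm.
have au : ana_disk u.
  move=> z z1.
  have [|c hc] := @ana_sum R n.+1 (fun k z => F n (w ^+ k * z)) z.
    move=> k; have [|c hc] := aF n (w ^+ k * z); first by rewrite nrmM nwk mul1r.
    by have := ana_rotate (nwk k) hc; eexists; eassumption.
  by have := anaZ n.+1%:R^-1 hc; eexists; eassumption.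
(* Hence |u| <= M / rho^n on the circle of radius rho, while [u 0] is the coefficient to be
   bounded. *)
have key z : z ^+ n * u z = n.+1%:R^-1 * \sum_(k < n.+1) w ^+ k * F 0%N (w ^+ k * z).
  rewrite /u mulrCA; congr (_ * _); apply/eqP; rewrite eq_sym -subr_eq0; apply/eqP.
  rewrite mulr_sumr -sumrB.
  transitivity (\sum_(k < n.+1) w ^+ k * psum (fun k => F k 0) n (w ^+ k * z)).
    apply: eq_bigr => k _; rewrite (iterated_shiftE FE n) mulrDr exprMn.
    have -> : (w ^+ k) ^+ n = (w ^+ k)^-1.
      apply: (mulfI (_ : w ^+ k != 0)); first by rewrite -nrm_gt0 nwk.
      by rewrite -exprS -exprM mulnC exprM w1 expr1n divff // -nrm_gt0 nwk.
    have : w ^+ k != 0 by rewrite -nrm_gt0 nwk.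
    move: (w ^+ k) => x x0.
    by move: (psum _ _ _) (F n _) (z ^+ n) => p q y; field.
  under eq_bigr do rewrite /psum mulr_sumr.
  rewrite exchange_big big1 //= => j _.
  transitivity (F j 0 * z ^+ j * \sum_(k < n.+1) w ^+ k * (w ^+ k) ^+ j).
    by rewrite mulr_sumr; apply: eq_bigr => k _; rewrite exprMn; ring.
  rewrite unity_root_sum //; last by rewrite ltnW // ltnS ltn_ord.
  by rewrite ltn_eqF ?ltn_ord // mulr0.
have u0 : u 0 = F n 0.
  rewrite /u; under eq_bigr do rewrite mulr0.
  by rewrite sumr_const card_ord -[F n 0 *+ _]mulr_natl mulrA mulVf ?mul1r.
rewrite -ler_pdivlMr ?exprn_gt0 // -u0.
apply: (max_principle r01 au) => [z zr|]; last by rewrite nrm0 ltW.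
rewrite ler_pdivlMr ?exprn_gt0 // -{1}zr -nrmX -nrmM mulrC key nrmM nrmV nN.
rewrite ler_pdivrMl ?ltr0n //; apply: le_trans (ler_nrm_sum _ _ _) _.
rewrite mulr_natl -[X in _ *+ X](card_ord n.+1) -sumr_const; apply: ler_sum => k _.
by rewrite nrmM nwk mul1r bM // nrmM nwk mul1r.
Qed.

(** [M] may depend on rho, since f need not be bounded on the disk, but not on n. *)
Definition taylor_on_disk f a := forall rho : R, 0 < rho < 1 -> exists2 M : R, 0 <= M &
  forall n z, nrm z <= rho -> nrm (f z - psum a n z) <= M * (nrm z / rho) ^+ n.

(** On a circle of intermediate radius s the Cauchy estimates bound each Taylor term by M, hence the
    remainder by (n + 1) M. The maximum principle applied to [F n] divides by s^n, and as s > rho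
    the gain (s/rho)^n outweighs the factor n + 1. *)
Lemma ana_disk_taylor f : ana_disk f -> exists a, taylor_on_disk f a.
Proof.
move=> af; have [F [F0 aF FE]] := iterated_shift af.
exists (fun k => F k 0) => rho /andP[r0 r1].
pose s := (1 + rho) / 2.
have s01 : 0 < s < 1 by rewrite /s; apply/andP; split; lra.
have rs : rho < s by rewrite /s; lra.
have s0 : 0 < s by case/andP: s01.
clearbody s.
have [|zm _ zmM] := @disk_max R f s _ af; first by case/andP: s01 => /ltW -> ->.
set M := nrm (f zm) in zmM; have M0 : 0 <= M by exact: nrm_ge0.
have cM : forall n, nrm (F n 0) * s ^+ n <= M.
  by apply: cauchy_estimate => // z zs; rewrite F0 zmM // zs.
have fE n z : f z - psum (fun k => F k 0) n z = z ^+ n * F n z.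
  by rewrite -F0 [F 0%N z in LHS](iterated_shiftE FE n) addrAC subrr add0r.
have bF n : forall z, nrm z <= s -> nrm (F n z) <= n.+1%:R * M / s ^+ n.
  apply: max_principle => // z zs; rewrite ler_pdivlMr ?exprn_gt0 //.
  rewrite -{1}zs -nrmX -nrmM mulrC -fE; apply: le_trans (ler_nrmD _ _) _.
  rewrite nrmN mulrS mulrDl mul1r lerD ?zmM ?zs //.
  apply: le_trans (ler_nrm_sum _ _ _) _.
  rewrite mulr_natl -[X in _ *+ X](card_ord n) -sumr_const; apply: ler_sum => k _.
  by rewrite nrmM nrmX zs.
pose dl := s / rho - 1.
have dl0 : 0 < dl by rewrite /dl subr_gt0 ltr_pdivlMr // mul1r.
(* Bernoulli's inequality, which turns n + 1 into a constant times (s/rho)^n. *)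
have bern n : 1 + n%:R * dl <= (s / rho) ^+ n.
  elim: n => [|n IH]; first by rewrite mul0r addr0 expr0.
  have sr0 : 0 <= s / rho by rewrite divr_ge0 // ltW.
  rewrite exprS; apply: le_trans (ler_wpM2l sr0 IH).
  rewrite (_ : s / rho = 1 + dl); last by rewrite /dl; ring.
  by rewrite -natr1; have : (0 : R) <= n%:R by []; move: (n%:R : R) => x x0; nra.
exists ((1 + dl^-1) * M); first by rewrite mulr_ge0 // addr_ge0 // invr_ge0 ltW.
move=> n z zr; rewrite fE nrmM nrmX.
have h1 := bF n z (le_trans zr (ltW rs)).
apply: (@le_trans _ _ (nrm z ^+ n * (n.+1%:R * M / s ^+ n))).
  by rewrite ler_wpM2l // exprn_ge0 ?nrm_ge0.
have h2 : n.+1%:R <= (1 + dl^-1) * (s / rho) ^+ n.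
  apply: le_trans (_ : (1 + dl^-1) * (1 + n%:R * dl) <= _); last first.
    by rewrite ler_wpM2l // addr_ge0 // invr_ge0 ltW.
  rewrite mulrDr mulr1 mulrDl mul1r mulrCA mulVf ?gt_eqF // mulr1 -natr1.
  have : 0 < dl^-1 by rewrite invr_gt0.
  have : 0 <= n%:R * dl by rewrite mulr_ge0 // ltW.
  lra.
have -> : (1 + dl^-1) * M * (nrm z / rho) ^+ n = (nrm z ^+ n / s ^+ n * M) * ((1 + dl^-1) * (s / rho) ^+ n).
  rewrite !expr_div_n.
  have : s ^+ n != 0 by rewrite expf_neq0 // gt_eqF.
  have : rho ^+ n != 0 by rewrite expf_neq0 // gt_eqF.
  move: (s ^+ n) (rho ^+ n) (nrm z ^+ n) (dl^-1) => x y t v y0 x0.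
  by field; rewrite x0 y0.
have -> : nrm z ^+ n * (n.+1%:R * M / s ^+ n) = (nrm z ^+ n / s ^+ n * M) * n.+1%:R by ring.
by rewrite ler_wpM2l // mulr_ge0 // divr_ge0 ?exprn_ge0 ?nrm_ge0 // ltW.
Qed.

Lemma taylor_onB f g a b : taylor_on_disk f a -> taylor_on_disk g b ->
  taylor_on_disk (fun z => f z - g z) (fun k => a k - b k).
Proof.
move=> fa gb rho r01; have [M M0 HM] := fa rho r01; have [N N0 HN] := gb rho r01.
exists (M + N); first exact: addr_ge0.
move=> n z zr; have -> : psum (fun k => a k - b k) n z = psum a n z - psum b n z.
  rewrite psumD; congr (_ + _); rewrite /psum -sumrN.
  by apply: eq_bigr => i _; rewrite mulNr.
have -> : f z - g z - (psum a n z - psum b n z) = (f z - psum a n z) - (g z - psum b n z) by ring.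
apply: le_trans (ler_nrmD _ _) _; rewrite nrmN mulrDl lerD ?HM ?HN //.
Qed.

Lemma taylor_unif f a : taylor_on_disk f a -> forall rho e : R, 0 < rho < 1 -> 0 < e ->
  exists N, forall n z, (N <= n)%N -> nrm z <= rho -> nrm (f z - psum a n z) <= e.
Proof.
move=> fa rho e /andP[r0 r1] e0; pose s := (1 + rho) / 2.
have s01 : 0 < s < 1 by rewrite /s; apply/andP; split; lra.
have rs : rho < s by rewrite /s; lra.
have s0 : 0 < s by case/andP: s01.
clearbody s.
have [M M0 H] := fa s s01.
have q01 : `|rho / s| < 1.
  have rs0 : 0 <= rho / s by rewrite divr_ge0 // ltW.
  by rewrite ger0_norm // ltr_pdivrMr // mul1r.
have := @cvg_geometric R M _ q01 => /cvgrPdist_le/(_ e e0)[N _ HN].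
exists N => n z Nn zr; apply: le_trans (H n z (le_trans zr (ltW rs))) _.
have := HN n Nn; rewrite sub0r normrN /= => h.
apply: le_trans (le_trans (ler_norm _) h); rewrite ler_wpM2l //.
rewrite lerXn2r ?nnegrE ?divr_ge0 ?nrm_ge0 ?(ltW r0) ?(ltW s0) //.
by rewrite ler_wpM2r // invr_ge0 ltW.
Qed.

End TaylorOnDisk.

(** * Continuous functions of the angle and their means over a full turn *)

Section CircleMeans.
Context {R : realType}.
Notation C := (cplx R).
Notation nrm := (@Normc.normc R).
Notation mu := (@lebesgue_measure R).
Implicit Types (z w : C) (f g : R -> C) (u v : R -> R) (c a : nat -> C).

Definition rcont f := continuous (fun t => complex.Re (f t)) /\
                      continuous (fun t => complex.Im (f t)).

Lemma rcont_cst z : rcont (fun=> z).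
Proof. by split=> t; exact: cvg_cst. Qed.

Lemma rcontD f g : rcont f -> rcont g -> rcont (fun t => f t + g t).
Proof.
move=> [f1 f2] [g1 g2]; split=> t.
  under eq_fun do rewrite cReD.
  by apply: cvgD; [exact: f1|exact: g1].
under eq_fun do rewrite cImD.
by apply: cvgD; [exact: f2|exact: g2].
Qed.

Lemma rcontN f : rcont f -> rcont (fun t => - f t).
Proof.
move=> [f1 f2]; split=> t.
  under eq_fun do rewrite cReN.
  by apply: cvgN; exact: f1.
under eq_fun do rewrite cImN.
by apply: cvgN; exact: f2.
Qed.

Lemma rcontM f g : rcont f -> rcont g -> rcont (fun t => f t * g t).
Proof.
move=> [f1 f2] [g1 g2]; split=> t.
  under eq_fun do rewrite cReM.
  by apply: cvgB; apply: cvgM; [exact: f1|exact: g1|exact: f2|exact: g2].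
under eq_fun do rewrite cImM.
by apply: cvgD; apply: cvgM; [exact: f1|exact: g2|exact: f2|exact: g1].
Qed.

Lemma rcontJ f : rcont f -> rcont (fun t => (f t)^*).
Proof.
move=> [f1 f2]; split=> t.
  under eq_fun do rewrite cReJ; exact: f1.
under eq_fun do rewrite cImJ.
by apply: cvgN; exact: f2.
Qed.

Lemma rcontX f n : rcont f -> rcont (fun t => f t ^+ n).
Proof.
move=> cf; elim: n => [|n IH]; first exact: rcont_cst.
have -> : (fun t => f t ^+ n.+1) = (fun t => f t * f t ^+ n).
  by apply/funext => t; rewrite exprS.
exact: rcontM.
Qed.

Lemma rcont_expi : rcont (fun t => expi t).
Proof. by split; [exact: continuous_cos|exact: continuous_sin]. Qed.

Lemma rcont_nrm2 f : rcont f -> continuous (fun t => nrm (f t) ^+ 2).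
Proof.
move=> [f1 f2] t; under eq_fun do rewrite nrm2E !expr2.
by apply: cvgD; apply: cvgM; (exact: f1 || exact: f2).
Qed.

Lemma rcontV f : rcont f -> (forall t, f t != 0) -> rcont (fun t => (f t)^-1).
Proof.
move=> cf f0.
have -> : (fun t => (f t)^-1) = (fun t => (f t)^* * ((nrm (f t) ^+ 2)^-1)%:C%C).
  apply/funext => t; rewrite fmorphV /= -mulcJ.
  have fJ : (f t)^* != 0 by rewrite fmorph_eq0.
  by field; rewrite fJ f0.
apply: rcontM; first exact: rcontJ.
split=> t /=; last exact: cvg_cst.
apply: cvgV; last exact: rcont_nrm2.
by rewrite expf_neq0 // gt_eqF // nrm_gt0.
Qed.

Lemma rcont_psum c f n : rcont f -> rcont (fun t => psum c n (f t)).
Proof.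
move=> cf; elim: n => [|n IH].
  have -> : (fun t => psum c 0 (f t)) = (fun=> 0) by apply/funext => t; rewrite psum0.
  exact: rcont_cst.
have -> : (fun t => psum c n.+1 (f t)) = (fun t => psum c n (f t) + c n * f t ^+ n).
  by apply/funext => t; rewrite psumS.
by apply: rcontD => //; apply: rcontM; [exact: rcont_cst|exact: rcontX].
Qed.

(** The starting point varies because the maximal estimate at the angle t integrates over the turn
    centered at t. *)
Definition full_turn (x : R) : set R := `[x, x + 2 * pi].

Lemma measurable_full_turn x : measurable (full_turn x : set (measurableTypeR R)).
Proof. exact: measurable_itv. Qed.

Definition mean x u : R := (2 * pi)^-1 * \int[mu]_(t in full_turn x) u t.

Definition turn_int x u := mu.-integrable (full_turn x) (EFin \o u).

Lemma continuous_itv_integrable u (x y : R) : continuous u ->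
  mu.-integrable `[x, y] (EFin \o u).
Proof.
move=> cu; apply: continuous_compact_integrable; first exact: segment_compact.
exact: continuous_subspaceT.
Qed.

Lemma continuous_turn_int u x : continuous u -> turn_int x u.
Proof. exact: continuous_itv_integrable. Qed.

Lemma rcont_turn_int f x : rcont f -> turn_int x (fun t => complex.Re (f t)).
Proof. by move=> [] + _; exact: continuous_turn_int. Qed.

Lemma meanD x u v : turn_int x u -> turn_int x v ->
  mean x (fun t => u t + v t) = mean x u + mean x v.
Proof.
move=> iu iv; rewrite /mean RintegralD;
  by [rewrite mulrDr|exact: measurable_full_turn|exact: iu|exact: iv].
Qed.

Lemma meanB x u v : turn_int x u -> turn_int x v ->
  mean x (fun t => u t - v t) = mean x u - mean x v.
Proof.
move=> iu iv; rewrite /mean RintegralB;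
  by [rewrite mulrBr|exact: measurable_full_turn|exact: iu|exact: iv].
Qed.

Lemma meanZ x k u : turn_int x u -> mean x (fun t => k * u t) = k * mean x u.
Proof.
move=> iu; rewrite /mean RintegralZl;
  by [rewrite mulrCA|exact: measurable_full_turn|exact: iu].
Qed.

Lemma pi2_gt0 : 0 < 2 * pi :> R.
Proof. by rewrite mulr_gt0 // pi_gt0. Qed.

Lemma mean_cst x k : mean x (fun=> k) = k.
Proof.
rewrite /mean Rintegral_cst; last exact: measurable_full_turn.
rewrite /full_turn /= lebesgue_measure_itv /= lte_fin.
by rewrite ltrDl pi2_gt0 /= addrAC subrr add0r mulrCA mulVf ?mulr1 // gt_eqF // pi2_gt0.
Qed.

Lemma mean_ge0 x u : (forall t, 0 <= u t) -> 0 <= mean x u.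
Proof.
by move=> u0; rewrite mulr_ge0 ?invr_ge0 ?(ltW pi2_gt0) // Rintegral_ge0.
Qed.

Lemma mean_le x u v : turn_int x u -> turn_int x v -> (forall t, u t <= v t) ->
  mean x u <= mean x v.
Proof.
move=> iu iv uv; rewrite ler_wpM2l ?invr_ge0 ?(ltW pi2_gt0) //.
by apply: le_Rintegral => //; exact: measurable_full_turn.
Qed.

Lemma turn_intD x u v : turn_int x u -> turn_int x v -> turn_int x (fun t => u t + v t).
Proof. by move=> iu iv; exact: (integrableD (measurable_full_turn x) iu iv). Qed.

Lemma turn_intZ x k u : turn_int x u -> turn_int x (fun t => k * u t).
Proof. by move=> iu; exact: (integrableZl (measurable_full_turn x) k iu). Qed.

Lemma turn_intN x u : turn_int x u -> turn_int x (fun t => - u t).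
Proof.
move=> iu; have := turn_intZ (-1) iu; rewrite (_ : (fun t => -1 * u t) = (fun t => - u t)) //.
by apply/funext => t; rewrite mulN1r.
Qed.

Lemma meanN x u : turn_int x u -> mean x (fun t => - u t) = - mean x u.
Proof.
move=> iu; rewrite -[in RHS]mulN1r -meanZ //; congr (mean x _).
by apply/funext => t; rewrite mulN1r.
Qed.

Lemma mean_expiX x z n : mean x (fun t => complex.Re (z * expi t ^+ n.+1)) = 0.
Proof.
case: z => p q; pose N : R := n.+1%:R.
have N0 : N != 0 by rewrite pnatr_eq0.
(* An antiderivative of the integrand. It is the imaginary part of (z / N) * expi t ^+ N, see [FE],
   from which its periodicity is read off. *)
pose F t := p / N * sin (N * t) + q / N * cos (N * t).
pose f t := p * cos (N * t) - q * sin (N * t).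
have fE t : complex.Re ((p +i* q)%C * expi t ^+ n.+1 : C) = f t.
  by rewrite expiX cReM /= /f -mulr_natl.
have dF (t : R) : is_derive t (1 : R) F (f t).
  have dN : is_derive t (1:R) (fun t : R => N * t) N.
    by apply: is_derive_eq; rewrite /GRing.scale /= mulr1.
  have ds := @is_derive1_comp R sin (fun t => N * t) t _ _ (is_derive_sin (N * t)) dN.
  have dc := @is_derive1_comp R cos (fun t => N * t) t _ _ (is_derive_cos (N * t)) dN.
  have := is_deriveD (is_deriveZ (p / N) ds) (is_deriveZ (q / N) dc).
  move=> h; apply: (@is_derive_eq _ _ _ _ _ _ _ _ h).
  by rewrite /GRing.scale /= /f; field.
have cf : continuous f.
  have : rcont (fun t => (p +i* q)%C * expi t ^+ n.+1 : C).
    by apply: rcontM; [exact: rcont_cst|apply: rcontX; exact: rcont_expi].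
  by move=> [+ _]; under eq_fun do rewrite fE.
have cF : continuous F.
  by move=> t; apply: differentiable_continuous; apply/derivable1_diffP; apply: ex_derive.
rewrite (_ : (fun t => _) = f); last by apply/funext => t; rewrite fE.
rewrite /mean /Rintegral.
rewrite (@continuous_FTC2 _ f F).
- have FE t : F t = complex.Im ((p / N +i* (q / N))%C * expi t ^+ n.+1 : C).
    by rewrite expiX cImM /= /F -mulr_natl; ring.
  rewrite -EFinB /= !FE expiD expi2pi mulr1 subrr mulr0 //.
- by rewrite ltrDl pi2_gt0.
- exact: continuous_subspaceT.
- split=> [t _||]; first exact: ex_derive.
  + by apply: cvg_at_right_filter; exact: cF.
  + by apply: cvg_at_left_filter; exact: cF.
- by move=> t _; rewrite derive1E; exact: derive_val.
Qed.

End CircleMeans.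

(** * Orthogonality, Parseval's identity, and the Szego and Poisson kernels on polynomials *)

Section Kernels.
Context {R : realType}.
Notation C := (cplx R).
Notation nrm := (@Normc.normc R).
Implicit Types (z w : C) (f g : R -> C) (u v : R -> R) (c a : nat -> C).

Lemma nrm2D z w : nrm (z + w) ^+ 2 =
  nrm z ^+ 2 + nrm w ^+ 2 + 2 * complex.Re (z * w^*).
Proof. by rewrite !nrm2E cReD cImD cReM cReJ cImJ; ring. Qed.

Lemma expiJ t : (expi t : C)^* = (expi t)^-1.
Proof.
have e0 : expi t != 0 :> C by rewrite -nrm_gt0 expi_nrm.
by apply: (mulfI e0); rewrite expi_mulJ divff.
Qed.

Lemma expi_neq0 t : expi t != 0 :> C.
Proof. by rewrite -nrm_gt0 expi_nrm. Qed.

Lemma rcont_mulX z n : rcont (fun t => z * expi t ^+ n : C).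
Proof.
by apply: rcontM; [exact: rcont_cst|apply: rcontX; exact: rcont_expi].
Qed.

Lemma rcont_Re f : rcont f -> continuous (fun t => complex.Re (f t)).
Proof. by case. Qed.

Lemma mean_expiJX x z n : mean x (fun t => complex.Re (z * (expi t)^* ^+ n.+1)) = 0.
Proof.
transitivity (mean x (fun t => complex.Re (z^* * expi t ^+ n.+1))).
  apply: (congr1 (mean x)); apply/funext => t.
  rewrite -[LHS]cReJ; congr complex.Re.
  by rewrite rmorphM; congr (_ * _); rewrite rmorphXn /= conjCK.
exact: mean_expiX.
Qed.

Lemma mean_psum_orth x a z m n : (m <= n)%N ->
  mean x (fun t => complex.Re (z * expi t ^+ n * (psum a m (expi t))^*)) = 0.
Proof.
elim: m => [|m IH] mn.
  under eq_fun do rewrite psum0 conjC0 mulr0; exact: mean_cst.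
have -> : (fun t => complex.Re (z * expi t ^+ n * (psum a m.+1 (expi t))^*)) =
  (fun t => complex.Re (z * expi t ^+ n * (psum a m (expi t))^*) +
            complex.Re ((z * (a m)^*) * expi t ^+ (n - m))).
  apply/funext => t; rewrite psumS rmorphD mulrDr cReD; congr (_ + complex.Re _).
  rewrite rmorphM rmorphXn /= expiJ exprB ?unitfE ?expi_neq0 ?(ltnW mn) //.
  by rewrite exprVn; ring.
rewrite meanD; last 2 first.
- apply: rcont_turn_int; apply: rcontM; first exact: rcont_mulX.
  by apply: rcontJ; apply: rcont_psum; exact: rcont_expi.
- by apply: rcont_turn_int; exact: rcont_mulX.
rewrite IH ?(ltnW mn) // add0r -(subnSK mn); exact: mean_expiX.
Qed.

Lemma turn_int_psum2 x a n : turn_int x (fun t => nrm (psum a n (expi t)) ^+ 2).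
Proof.
by apply: continuous_turn_int; apply: rcont_nrm2; apply: rcont_psum; exact: rcont_expi.
Qed.

Lemma parseval x a n :
  mean x (fun t => nrm (psum a n (expi t)) ^+ 2) = \sum_(k < n) nrm (a k) ^+ 2.
Proof.
elim: n => [|n IH].
  by under eq_fun do rewrite psum0 nrm0 expr0n; rewrite mean_cst big_ord0.
rewrite big_ord_recr /= -IH.
have -> : (fun t => nrm (psum a n.+1 (expi t)) ^+ 2) =
  (fun t => (nrm (psum a n (expi t)) ^+ 2 + nrm (a n) ^+ 2) +
    2 * complex.Re (a n * expi t ^+ n * (psum a n (expi t))^*)).
  apply/funext => t; rewrite psumS addrC nrm2D nrmM nrmX expi_nrm expr1n mulr1.
  by rewrite [nrm (a n) ^+ 2 + _]addrC.
have i1 : turn_int x (fun t => complex.Re (a n * expi t ^+ n * (psum a n (expi t))^*)).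
  apply: rcont_turn_int; apply: rcontM; first exact: rcont_mulX.
  by apply: rcontJ; apply: rcont_psum; exact: rcont_expi.
have i2 : turn_int x (fun=> nrm (a n) ^+ 2).
  by apply: continuous_turn_int => t; exact: cvg_cst.
have i3 := turn_int_psum2 x a n.
rewrite meanD; [|exact: turn_intD|exact: turn_intZ].
by rewrite meanD ?i2 ?i3 // (meanZ 2 i1) mean_psum_orth ?leqnn // mulr0 addr0 mean_cst.
Qed.

Definition szego w t : C := (1 - w^* * expi t)^-1.

Lemma szego_den w t : nrm w < 1 -> 1 - nrm w <= nrm (1 - w^* * expi t).
Proof.
move=> w1; have := ler_nrmD (1 - w^* * expi t) (w^* * expi t).
by rewrite subrK nrm1 nrmM nrmJ expi_nrm mulr1; lra.
Qed.

Lemma szego_den_neq0 w t : nrm w < 1 -> 1 - w^* * expi t != 0.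
Proof. by move=> w1; rewrite -nrm_gt0; have := szego_den t w1; lra. Qed.

Lemma szego_le w t : nrm w < 1 -> nrm (szego w t) <= (1 - nrm w)^-1.
Proof.
move=> w1; rewrite nrmV lef_pV2 ?posrE ?szego_den //; last lra.
by have := szego_den t w1; lra.
Qed.

Lemma rcont_szego w : nrm w < 1 -> rcont (szego w).
Proof.
move=> w1; apply: rcontV => [|t]; last exact: szego_den_neq0.
apply: rcontD; first exact: rcont_cst.
by apply: rcontN; apply: rcontM; [exact: rcont_cst|exact: rcont_expi].
Qed.

Lemma szegoJE w t : nrm w < 1 ->
  (szego w t)^* = 1 + w * (expi t)^* * (szego w t)^*.
Proof.
move=> w1; have e0 := expi_neq0 t.
have : (1 - w^* * expi t)^* != 0 by rewrite fmorph_eq0 szego_den_neq0.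
rewrite /szego fmorphV /= (_ : (1 - w^* * expi t)^* = 1 - w * (expi t)^*); last first.
  by rewrite rmorphB rmorph1 rmorphM /= conjCK.
by move=> d0; field.
Qed.

Lemma mean_norm_le x u B : turn_int x u -> (forall t, `|u t| <= B) -> `|mean x u| <= B.
Proof.
move=> iu uB; rewrite ler_norml; apply/andP; split.
  rewrite -(mean_cst x (- B)); apply: mean_le => // [|t].
    by apply: continuous_turn_int => t; exact: cvg_cst.
  by have := uB t; rewrite ler_norml => /andP[].
rewrite -[leRHS](mean_cst x B); apply: mean_le => // [|t].
  by apply: continuous_turn_int => t; exact: cvg_cst.
by have := uB t; rewrite ler_norml => /andP[].
Qed.

Lemma turn_int_szego x f w : rcont f -> nrm w < 1 ->
  turn_int x (fun t => complex.Re (f t * (szego w t)^*)).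
Proof.
move=> cf w1; apply: rcont_turn_int; apply: rcontM => //.
by apply: rcontJ; exact: rcont_szego.
Qed.

Lemma rcont_mulJX z n : rcont (fun t => z * (expi t)^* ^+ n : C).
Proof.
apply: rcontM; first exact: rcont_cst.
by apply: rcontX; apply: rcontJ; exact: rcont_expi.
Qed.

(* The recursion [K^* = 1 + w zeta^-1 K^*] for the kernel [K = szego w] relates
   consecutive Fourier coefficients of [K^*]; boundedness then forces the
   vanishing of those on one side, without summing any series. *)
Lemma mean_szegoJ_neg x z w n : nrm w < 1 ->
  mean x (fun t => complex.Re (z * (expi t)^* ^+ n.+1 * (szego w t)^*)) = 0.
Proof.
move=> w1; pose v n z := mean x (fun t => complex.Re (z * (expi t)^* ^+ n.+1 * (szego w t)^*)).
have vS m y : v m y = v m.+1 (y * w).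
  rewrite /v (_ : (fun t => _) = (fun t => complex.Re (y * (expi t)^* ^+ m.+1) +
     complex.Re (y * w * (expi t)^* ^+ m.+2 * (szego w t)^*))).
    rewrite meanD; [|apply: rcont_turn_int; exact: rcont_mulJX|].
      by rewrite mean_expiJX add0r.
    by apply: turn_int_szego => //; exact: rcont_mulJX.
  apply/funext => t; rewrite {1}szegoJE // mulrDr cReD mulr1; congr (_ + complex.Re _).
  by rewrite [_ ^+ m.+2]exprS; ring.
have vn k m y : v m y = v (m + k)%N (y * w ^+ k).
  elim: k => [|k IH] in m y *; first by rewrite addn0 expr0 mulr1.
  by rewrite vS IH addnS addSn exprS mulrA.
have bv m y : `|v m y| <= nrm y / (1 - nrm w).
  apply: mean_norm_le => [|t]; first by apply: turn_int_szego => //; exact: rcont_mulJX.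
  apply: le_trans (ler_Re_nrm _) _; rewrite !nrmM nrmX !nrmJ expi_nrm expr1n mulr1.
  by rewrite ler_wpM2l ?nrm_ge0 // szego_le.
rewrite -/(v n z); apply/eqP; rewrite -normr_le0.
apply: (@le0_geometric _ _ (nrm z / (1 - nrm w)) (nrm w)); first by rewrite nrm_ge0.
by move=> k; rewrite (vn k.+1); apply: le_trans (bv _ _) _; rewrite nrmM nrmX mulrAC.
Qed.

(** The same recursion now terminates: each use trades one power of zeta for a factor w, at the cost
    of a monomial of mean zero, until only the constant term is left. *)
Lemma mean_szegoJ_pos x z w n : nrm w < 1 ->
  mean x (fun t => complex.Re (z * expi t ^+ n * (szego w t)^*)) = complex.Re (z * w ^+ n).
Proof.
move=> w1; elim: n => [|n IH] in z *.
  rewrite (_ : (fun t => _) = (fun t => complex.Re z +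
     complex.Re (z * w * (expi t)^* ^+ 1 * (szego w t)^*))).
    rewrite meanD; [|by apply: continuous_turn_int => t; exact: cvg_cst|].
      by rewrite mean_szegoJ_neg // mean_cst addr0 expr0 mulr1.
    by apply: turn_int_szego => //; exact: rcont_mulJX.
  apply/funext => t; rewrite {1}szegoJE // expr0 mulr1 mulrDr cReD mulr1; congr (_ + complex.Re _).
  by rewrite expr1; ring.
rewrite exprS mulrA -IH (_ : (fun t => _) = (fun t => complex.Re (z * expi t ^+ n.+1) +
    complex.Re (z * w * expi t ^+ n * (szego w t)^*))).
  rewrite meanD; [|by apply: rcont_turn_int; exact: rcont_mulX|].
    by rewrite mean_expiX add0r.
  by apply: turn_int_szego => //; exact: rcont_mulX.
apply/funext => t; rewrite {1}szegoJE // mulrDr cReD mulr1; congr (_ + complex.Re _).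
by rewrite expiJ exprS; field; exact: expi_neq0.
Qed.

Lemma reproducing_psum x z a n w : nrm w < 1 ->
  mean x (fun t => complex.Re (z * psum a n (expi t) * (szego w t)^*)) =
  complex.Re (z * psum a n w).
Proof.
move=> w1; elim: n => [|n IH].
  under eq_fun do rewrite psum0 mulr0 mul0r.
  by rewrite mean_cst psum0 mulr0.
rewrite (_ : (fun t => _) = (fun t => complex.Re (z * psum a n (expi t) * (szego w t)^*) +
    complex.Re (z * a n * expi t ^+ n * (szego w t)^*))).
  rewrite meanD; last 2 first.
  - apply: turn_int_szego => //; apply: rcontM; first exact: rcont_cst.
    by apply: rcont_psum; exact: rcont_expi.
  - by apply: turn_int_szego => //; exact: rcont_mulX.
  by rewrite IH mean_szegoJ_pos // psumS mulrDr cReD mulrA.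
by apply/funext => t; rewrite psumS -cReD; congr complex.Re; ring.
Qed.

(** In this form the Poisson kernel acts on monomials through the known means of the Szego kernel;
    its usual quotient is [poissonE]. *)
Definition poisson w t : R := 2 * complex.Re (szego w t) - 1.

Lemma poissonE w t : nrm w < 1 ->
  poisson w t = (1 - nrm w ^+ 2) / nrm (1 - w^* * expi t) ^+ 2.
Proof.
move=> w1; have d0 := szego_den_neq0 t w1.
have n0 : nrm (1 - w^* * expi t) ^+ 2 != 0 by rewrite expf_neq0 // gt_eqF // nrm_gt0.
apply: (mulIf n0); rewrite divfK // /poisson.
have -> : szego w t = (1 - w^* * expi t)^* * ((nrm (1 - w^* * expi t) ^+ 2)^-1)%:C%C.
  rewrite fmorphV /= -mulcJ /szego; move: (1 - w^* * expi t) d0 => y y0.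
  have yJ : y^* != 0 by rewrite fmorph_eq0.
  by field; rewrite yJ y0.
set D := 1 - _ in n0 *.
have -> : complex.Re (D^* * ((nrm D ^+ 2)^-1)%:C%C : C) = complex.Re D / nrm D ^+ 2.
  by rewrite cReM /= cReJ mulr0 subr0.
rewrite mulrBl mul1r mulrA divfK //.
have nE : nrm w ^+ 2 = nrm (w^* * expi t) ^+ 2 by rewrite nrmM nrmJ expi_nrm mulr1.
rewrite nE /D; move: (w^* * expi t) => y.
by rewrite !nrm2E cReD cImD cReN cImN /=; ring.
Qed.

Lemma poisson_ge0 w t : nrm w < 1 -> 0 <= poisson w t.
Proof.
move=> w1; rewrite poissonE //; apply: divr_ge0; last by rewrite exprn_ge0 ?nrm_ge0.
by have := nrm_ge0 w; rewrite expr2; nra.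
Qed.

Lemma continuous_poisson w : nrm w < 1 -> continuous (poisson w).
Proof.
move=> w1 t; apply: cvgB; last exact: cvg_cst.
have [h _] := rcont_szego w1; by apply: cvgM; [exact: cvg_cst|exact: h].
Qed.

Lemma poisson_int x w u : nrm w < 1 -> continuous u ->
  turn_int x (fun t => poisson w t * u t).
Proof.
move=> w1 cu; apply: continuous_turn_int => t.
by apply: cvgM; [exact: continuous_poisson|exact: cu].
Qed.

(** With y = z zeta^n, the integrand is Re(y conj K) + Re(conj y conj K) - Re y. The first mean is
    the result; the other two vanish for n > 0 and cancel each other for n = 0. *)
Lemma poisson_mono x z w n : nrm w < 1 ->
  mean x (fun t => poisson w t * complex.Re (z * expi t ^+ n)) = complex.Re (z * w ^+ n).
Proof.
move=> w1; rewrite (_ : (fun t => _) = (fun t =>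
   (complex.Re (z * expi t ^+ n * (szego w t)^*) +
    complex.Re (z^* * (expi t)^* ^+ n * (szego w t)^*)) - complex.Re (z * expi t ^+ n))).
  have i1 : turn_int x (fun t => complex.Re (z * expi t ^+ n * (szego w t)^*)).
    by apply: turn_int_szego => //; exact: rcont_mulX.
  have i2 : turn_int x (fun t => complex.Re (z^* * (expi t)^* ^+ n * (szego w t)^*)).
    by apply: turn_int_szego => //; exact: rcont_mulJX.
  have i3 : turn_int x (fun t => complex.Re (z * expi t ^+ n)).
    by apply: rcont_turn_int; exact: rcont_mulX.
  rewrite (meanB (turn_intD i1 i2) i3) (meanD i1 i2) (mean_szegoJ_pos x z n w1) -addrA.
  case: n i1 i2 i3 => [|n] i1 i2 i3.
    have -> : mean x (fun t => complex.Re (z^* * (expi t)^* ^+ 0 * (szego w t)^*)) =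
      complex.Re (z^* * w ^+ 0).
      by rewrite -(mean_szegoJ_pos x (z^*) 0 w1).
    under eq_fun do rewrite expr0 mulr1.
    by rewrite mean_cst expr0 !mulr1 cReJ subrr addr0.
  by rewrite mean_szegoJ_neg // mean_expiX subrr addr0.
apply/funext => t; rewrite -rmorphXn -rmorphM /=.
rewrite /poisson; move: (z * _) (szego w t) => y k; rewrite !cReM !cReJ !cImJ; ring.
Qed.

Lemma poisson_psum x z w a n : nrm w < 1 ->
  mean x (fun t => poisson w t * complex.Re (z * psum a n (expi t))) =
  complex.Re (z * psum a n w).
Proof.
move=> w1; elim: n => [|n IH].
  by under eq_fun do rewrite psum0 mulr0 mulr0; rewrite mean_cst psum0 mulr0.
rewrite (_ : (fun t => _) = (fun t => poisson w t * complex.Re (z * psum a n (expi t)) +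
   poisson w t * complex.Re (z * a n * expi t ^+ n))).
  rewrite meanD; last 2 first.
  - apply: poisson_int => //; apply: rcont_Re; apply: rcontM; first exact: rcont_cst.
    by apply: rcont_psum; exact: rcont_expi.
  - by apply: poisson_int => //; apply: rcont_Re; exact: rcont_mulX.
  by rewrite IH poisson_mono // psumS mulrDr cReD mulrA.
by apply/funext => t; rewrite psumS mulrDr cReD mulrDr mulrA.
Qed.

(** A variance argument: the Poisson mean of |p - p(w)|^2 is nonnegative, and expands by the
    reproduction of 1 and of p into the Poisson mean of |p|^2 minus |p(w)|^2. *)
Lemma poisson_subharmonic x w a n : nrm w < 1 ->
  nrm (psum a n w) ^+ 2 <= mean x (fun t => poisson w t * nrm (psum a n (expi t)) ^+ 2).
Proof.
move=> w1; set p := fun t => psum a n (expi t); set pw := psum a n w.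
have cp : rcont p by apply: rcont_psum; exact: rcont_expi.
have : 0 <= mean x (fun t => poisson w t * nrm (p t - pw) ^+ 2).
  by apply: mean_ge0 => t; rewrite mulr_ge0 ?poisson_ge0 ?exprn_ge0 ?nrm_ge0.
rewrite (_ : (fun t => _) = (fun t => poisson w t * nrm (p t) ^+ 2 +
   (nrm pw ^+ 2 * (poisson w t * complex.Re (1 * expi t ^+ 0)) +
   (-2) * (poisson w t * complex.Re (pw^* * p t))))); last first.
  apply/funext => t; rewrite expr0 mulr1 mulr1 nrm2D nrmN rmorphN mulrN cReN.
  by rewrite [pw^* * _]mulrC; ring.
have i1 : turn_int x (fun t => poisson w t * nrm (p t) ^+ 2).
  by apply: poisson_int => //; exact: rcont_nrm2.
have i2 : turn_int x (fun t => poisson w t * complex.Re (1 * expi t ^+ 0)).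
  by apply: poisson_int => //; apply: rcont_Re; exact: rcont_mulX.
have i3 : turn_int x (fun t => poisson w t * complex.Re (pw^* * p t)).
  apply: poisson_int => //; apply: rcont_Re; apply: rcontM => //; exact: rcont_cst.
rewrite meanD //; last by apply: turn_intD; exact: turn_intZ.
rewrite meanD; [|exact: turn_intZ|exact: turn_intZ].
rewrite !meanZ // poisson_mono // poisson_psum // -/pw expr0 mulr1 mulr1.
by rewrite [pw^* * pw]mulrC mulcJ /=; lra.
Qed.

End Kernels.

(** * Comparison of integrals of nonnegative functions up to null sets *)

Section IntegralMonotone.
Context d (T : measurableType d) (R : realType) (mu : {measure set T -> \bar R}).
Local Open Scope ereal_scope.
Import HBNNSimple.

(* No measurability of [f] or [g] is needed, [integral] being a supremum over
   the simple functions below; this matters for [radial_limit], which is a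
   default value outside of an uncontrolled null set. *)
Lemma ge0_le_integral_ae (D E N : set T) (f g : T -> \bar R) :
  measurable N -> mu N = 0 -> (forall x, D x -> 0 <= f x) -> (forall x, E x -> 0 <= g x) ->
  (forall x, ~ N x -> (f \_ D) x <= (g \_ E) x) ->
  \int[mu]_(x in D) f x <= \int[mu]_(x in E) g x.
Proof.
move=> mN N0 f0 g0 fg; rewrite integral_mkcond [leRHS]integral_mkcond.
have fp x : 0 <= (f \_ D) x by apply: erestrict_ge0.
have gp x : 0 <= (g \_ E) x by apply: erestrict_ge0.
rewrite ge0_integralTE // [leRHS]ge0_integralTE //.
apply: ge_ereal_sup => _ [h hf <-].
(* Cut off on [N], the simple function lies below the second integrand everywhere and keeps its
   integral. *)
apply: ereal_sup_ubound; exists (proj_nnsfun h (measurableC mN)) => [x|].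
  rewrite -mrestrict /patch; case: ifPn => [|_]; last exact: gp.
  by move=> /set_mem Nx; apply: le_trans (hf x) (fg x Nx).
rewrite -!integralT_nnsfun; apply: ae_eq_integral => //.
- by apply/measurable_EFinP; exact: measurable_funPT.
- by apply/measurable_EFinP; exact: measurable_funPT.
- exists N; split=> // x /=; apply: contra_notP => Nx _.
  by rewrite mindicE mem_set //= mulr1.
Qed.

Lemma ge0_eq_integral_ae (D N : set T) (f g : T -> \bar R) :
  measurable N -> mu N = 0 -> (forall x, D x -> 0 <= f x) -> (forall x, D x -> 0 <= g x) ->
  (forall x, D x -> ~ N x -> f x = g x) ->
  \int[mu]_(x in D) f x = \int[mu]_(x in D) g x.
Proof.
move=> mN N0 f0 g0 fg.
by apply/eqP; rewrite eq_le; apply/andP; split; apply: (ge0_le_integral_ae mN) => // x Nx;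
  rewrite /patch; case: ifPn => // /set_mem Dx; rewrite fg.
Qed.

End IntegralMonotone.

(** * The Poisson kernel bounded by a sum of indicators of dyadic intervals *)

Section MaximalFunction.
Context {R : realType}.
Notation C := (cplx R).
Notation nrm := (@Normc.normc R).
Notation mu := (@lebesgue_measure R).
Implicit Types (z w : C) (f g : R -> C) (u v : R -> R) (c a : nat -> C).

(** On [0, pi/4] the mean value theorem applies with cos >= 1/2, which comes from cos(2t) >= 0.
    Beyond pi/4, monotonicity gives sin x > sin(pi/4) >= pi/8 >= x/4. *)
Lemma sin_ge (x : R) : 0 <= x <= pi / 2 -> x / 4 <= sin x.
Proof.
have p0 := @pi_gt0 R.
have small (y : R) : 0 <= y <= pi / 4 -> y / 2 <= sin y.
  move=> /andP[y0 y1].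
  have [|t] := @MVT_segment R sin cos 0 y y0 (fun x _ => is_derive_sin x).
    by apply: continuous_subspaceT; exact: continuous_sin.
  rewrite in_itv /= => /andP[t0 ty]; rewrite sin0 !subr0 => ->.
  have c2 : 0 <= cos (t *+ 2) by apply: cos_ge0_pihalf; rewrite (mulr2n t); apply/andP; split; lra.
  have c1 : 0 <= cos t by apply: cos_ge0_pihalf; apply/andP; split; lra.
  rewrite cos_mulr2n (mulr2n (_ ^+ 2)) in c2.
  have : 1 / 2 <= cos t by nra.
  by move=> ?; nra.
move=> /andP[x0 x1]; have [xs|xb] := leP x (pi / 4).
  by have := small x; rewrite x0 xs => /(_ isT) ?; lra.
have h1 : (pi / 4 : R) / 2 <= sin (pi / 4).
  by apply: small; rewrite lexx andbT; lra.
have h2 : sin (pi / 4) < sin x.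
  by rewrite ltr_sin // in_itv /=; apply/andP; split; lra.
lra.
Qed.

(** The constant comes from 1 - cos s = 2 sin(s/2)^2 and sin(s/2) >= s/8. *)
Lemma one_minus_cos_ge (s : R) : `|s| <= pi -> s ^+ 2 / 32 <= 1 - cos s.
Proof.
wlog s0 : s / 0 <= s.
  move=> H; have [s0|s0] := leP 0 s; first exact: H.
  by have := H (- s); rewrite normrN cosN sqrrN; apply; lra.
rewrite ger0_norm // => sp.
have h : s / 2 / 4 <= sin (s / 2) by apply: sin_ge; apply/andP; split; lra.
have -> : cos s = 1 - sin (s / 2) ^+ 2 *+ 2.
  rewrite -{1}(_ : (s / 2) *+ 2 = s); last by rewrite (mulr2n (s / 2)); lra.
  by rewrite cos_mulr2n sin2cos2 !(mulr2n (_ - _)) !(mulr2n (_ ^+ 2)); lra.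
by rewrite (mulr2n (_ ^+ 2)) !expr2; nra.
Qed.

(** The denominator is (1 - rho)^2 + 2 rho (1 - cos(s - t)), where 2 rho >= 1, and the numerator 1 -
    rho^2 is at most 2 (1 - rho). *)
Lemma poisson_le (rho t s : R) : 1 / 2 <= rho < 1 -> `|s - t| <= pi ->
  poisson (rho%:C%C * expi t) s <= 2 * (1 - rho) / ((1 - rho) ^+ 2 + (s - t) ^+ 2 / 32).
Proof.
move=> /andP[r0 r1] sp; have w1 : nrm (rho%:C%C * expi t : C) < 1.
  by rewrite nrmM expi_nrm mulr1 nrm_real ger0_norm; lra.
have e0 : 0 < (1 - rho) ^+ 2 by rewrite exprn_gt0 // subr_gt0.
have s0 : 0 <= (s - t) ^+ 2 / 32 by rewrite divr_ge0 ?sqr_ge0.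
rewrite poissonE // nrmM expi_nrm mulr1 nrm_real ger0_norm; last lra.
have le : (1 - rho) ^+ 2 + (s - t) ^+ 2 / 32 <= nrm (1 - (rho%:C%C * expi t : C)^* * expi s) ^+ 2.
  have -> : nrm (1 - (rho%:C%C * expi t : C)^* * expi s) ^+ 2 =
      (1 - rho) ^+ 2 + 2 * rho * (1 - cos (s - t)).
    rewrite nrm2E !cReD !cImD !cReN !cImN cReM cImM /= cosB.
    have := cos2Dsin2 s; have := cos2Dsin2 t.
    move: (cos s) (sin s) (cos t) (sin t) => a b c e h1 h2.
    transitivity (1 - 2 * rho * (a * c + b * e) + rho ^+ 2 * (c ^+ 2 + e ^+ 2) * (a ^+ 2 + b ^+ 2)).
      by ring.
    by rewrite h1 h2; ring.
  rewrite lerD2l; apply: le_trans (one_minus_cos_ge sp) _.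
  have : cos (s - t) <= 1 by exact: cos_le1.
  by move=> ?; nra.
rewrite ler_pM ?invr_ge0 ?sqr_ge0 //.
- by rewrite expr2; nra.
- by rewrite expr2; nra.
- by rewrite lef_pV2 ?posrE //; [apply: lt_le_trans le; lra|lra].
Qed.

(** Where |s| >= 2^L e the kernel is at most 64 e / s^2 <= 64 / (4^L e) = 256 / (4^(L+1) e), so the
    indicator of the next interval suffices; closer to 0 the induction hypothesis applies. *)
Lemma dyadic_kernel_le (e s : R) L : 0 < e -> `|s| < 2 ^+ L * e ->
  2 * e / (e ^+ 2 + s ^+ 2 / 32) <=
  \sum_(k < L.+1) 256 / (4 ^+ k * e) * (`|s| < 2 ^+ k * e)%R%:R.
Proof.
move=> e0; have den : 0 < e ^+ 2 + s ^+ 2 / 32.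
  by rewrite ltr_wpDr ?exprn_gt0 // divr_ge0 ?sqr_ge0.
have tp k : 0 <= 256 / (4 ^+ k * e) * (`|s| < 2 ^+ k * e)%R%:R :> R.
  apply: mulr_ge0; last exact: ler0n.
  apply: divr_ge0; first exact: ler0n.
  by rewrite mulr_ge0 ?exprn_ge0 // ltW.
elim: L => [|L IH] sL.
  rewrite big_ord1 sL expr0 mulr1 mul1r ler_pdivrMr // mulrDr.
  have -> : 256 / e * e ^+ 2 = 256 * e by field; rewrite gt_eqF.
  have : 0 <= 256 / e * (s ^+ 2 / 32) by apply: mulr_ge0; apply: divr_ge0; rewrite ?ler0n ?sqr_ge0 ?(ltW e0).
  lra.
rewrite big_ord_recr /=; have [sl|sg] := ltP `|s| (2 ^+ L * e).
  by apply: le_trans (IH sl) _; rewrite lerDl tp.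
apply: le_trans (_ : 256 / (4 ^+ L.+1 * e) <= _); last first.
  by rewrite sL mulr1 lerDr sumr_ge0.
have s2 : 4 ^+ L * e ^+ 2 <= s ^+ 2.
  rewrite -(real_normK (num_real s)) (_ : 4 = 2 ^+ 2 :> R); last by ring.
  rewrite -exprM mulnC exprM -exprMn lerXn2r ?nnegrE //.
  by rewrite mulr_ge0 ?exprn_ge0 // ltW.
have p4 : 0 < 4 ^+ L :> R by rewrite exprn_gt0.
rewrite ler_pdivrMr // mulrAC ler_pdivlMr; last by rewrite mulr_gt0 ?exprn_gt0.
rewrite exprS; have := exprn_gt0 2 e0 => ?.
by move: (4 ^+ L) p4 s2 => y y0 s2; rewrite !expr2 in s2 *; nra.
Qed.

End MaximalFunction.

(** * Polynomials on radii bounded by the Hardy-Littlewood maximal function *)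

Section PolynomialMaximal.
Context {R : realType}.
Notation C := (cplx R).
Notation nrm := (@Normc.normc R).
Notation mu := (@lebesgue_measure R).
Implicit Types (z w : C) (f g : R -> C) (u v : R -> R) (c a : nat -> C).

Definition psum2 a n t : R := nrm (psum a n (expi t)) ^+ 2.

Lemma psum2_ge0 a n t : 0 <= psum2 a n t.
Proof. by rewrite exprn_ge0 ?nrm_ge0. Qed.

Lemma continuous_psum2 a n : continuous (psum2 a n).
Proof. by apply: rcont_nrm2; apply: rcont_psum; exact: rcont_expi. Qed.

Definition three_turns : set R := `[- (2 * pi), 4 * pi].

(* Truncated so as to be integrable; [three_turns] contains every full turn centered at a
   point of [0, 2 pi]. *)
Definition psum2t a n : R -> R := psum2 a n \_ three_turns.

Lemma HL_ball (f : R -> R) (t c r : R) : (HL_maximal f t <= c%:E)%E -> 0 < r ->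
  (\int[mu]_(y in ball t r) `|(f y)%:E| <= (c * (r *+ 2))%:E)%E.
Proof.
move=> fc r0; have r2 : 0 < r *+ 2 by rewrite mulrn_wgt0.
have : (iavg f (ball t r) <= c%:E)%E.
  by apply: le_trans fc; apply: ereal_sup_ubound; exists r => //=; rewrite in_itv /= r0.
rewrite /iavg lebesgue_measure_ball ?(ltW r0) // inver gt_eqF //.
by rewrite lee_pdivrMl // -EFinM mulrC.
Qed.

Lemma measurable_psum2 a n (D : set (measurableTypeR R)) :
  measurable_fun D (psum2 a n : measurableTypeR R -> R).
Proof.
apply: measurable_funTS; apply: continuous_measurable_fun; exact: continuous_psum2.
Qed.

Lemma full_turn_sub_three_turns (t : R) : 0 <= t <= 2 * pi -> full_turn (t - pi) `<=` three_turns.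
Proof.
move=> /andP[t0 t1] s; rewrite /full_turn /three_turns /= !in_itv /= => /andP[s0 s1].
by have := @pi_gt0 R => ?; apply/andP; split; lra.
Qed.

(** The bound is uniform in rho and n. The interval of radius 2^k e contributes at most 256 / (4^k
    e) * c * 2 * 2^k e = 512 c / 2^k, and the sum over k gives 1024 c; the factor 1 / (2 pi) of the
    mean is simply bounded by 1. *)
Lemma poisson_HL a n (rho t c : R) : 0 <= t <= 2 * pi -> 1 / 2 <= rho < 1 ->
  (HL_maximal (psum2t a n) t <= c%:E)%E ->
  nrm (psum a n (rho%:C%C * expi t)) ^+ 2 <= 1024 * c.
Proof.
move=> t01 r01 HLc; have /andP[r0 r1] := r01.
have p0 := @pi_gt0 R; have p2 := @pi_ge2 R.
set w : C := rho%:C%C * expi t.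
have w1 : nrm w < 1 by rewrite nrmM expi_nrm mulr1 nrm_real ger0_norm //; lra.
pose e := 1 - rho; have e0 : 0 < e by rewrite subr_gt0.
(* Enough dyadic intervals to cover the turn centered at t. *)
have [L hL] : exists L, pi < 2 ^+ L * e.
  have := archi_boundP (ltW (divr_gt0 p0 e0)); set L := Num.bound _ => hL.
  exists L; rewrite -ltr_pdivrMr //; apply: lt_trans hL _.
  by rewrite -natrX ltr_nat ltn_expl.
have c0 : 0 <= c.
  rewrite -lee_fin; apply: le_trans HLc.
  by apply: le_trans (iavg_ge0 (psum2t a n) (ball t 1)) _; apply: ereal_sup_ubound; exists 1 => //=; rewrite in_itv /= ltr01.
pose d k : R := 256 / (4 ^+ k * e).
have d0 k : 0 <= d k by rewrite divr_ge0 ?ler0n // mulr_ge0 ?exprn_ge0 // ltW.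
pose h k s : R := d k * (`|s - t| < 2 ^+ k * e)%R%:R * psum2 a n s.
have h0 k s : 0 <= h k s by rewrite /h mulr_ge0 ?psum2_ge0 // mulr_ge0.
have mh k : measurable_fun (full_turn (t - pi) : set (measurableTypeR R)) (EFin \o h k).
  apply/measurable_EFinP; apply: measurable_funM; last exact: measurable_psum2.
  apply: measurable_funM; first exact: measurable_cst.
  rewrite (_ : (fun x : R => _) = \1_(ball t (2 ^+ k * e))); last first.
    apply/funext => s; rewrite indicE; congr (_%:R); congr nat_of_bool.
    by apply/idP/idP; rewrite inE -ball_normE /= distrC.
  by apply: measurable_indic; exact: measurable_ball.
have step : (\int[mu]_(s in full_turn (t - pi)) (poisson w s * psum2 a n s)%:E <= (1024 * c)%:E)%E.
  apply: (@le_trans _ _ (\int[mu]_(s in full_turn (t - pi)) \sum_(k < L.+1) (h k s)%:E)%E).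
    apply: (ge0_le_integral_ae measurable0) => // [s _|s _|s _].
    - by rewrite lee_fin mulr_ge0 ?poisson_ge0 ?psum2_ge0.
    - by apply: sume_ge0 => k _; rewrite lee_fin.
    rewrite /patch; case: ifPn => // /set_mem; rewrite /full_turn /= in_itv /= => /andP[s0 s1].
    have st : `|s - t| <= pi by rewrite ler_norml; apply/andP; split; lra.
    rewrite sumEFin lee_fin -mulr_suml ler_wpM2r ?psum2_ge0 //.
    apply: le_trans (poisson_le r01 st) _; apply: dyadic_kernel_le => //.
    exact: le_lt_trans hL.
  rewrite ge0_integral_sum; last 3 first.
  - exact: measurable_full_turn.
  - by move=> k; exact: mh.
  - by move=> k s _; rewrite lee_fin.
  apply: (@le_trans _ _ (\sum_(k < L.+1) (512 * c * (1 / 2) ^+ k)%:E)%E).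
    apply: lee_sum => k _.
    have rk : 0 < 2 ^+ k * e by rewrite mulr_gt0 ?exprn_gt0.
    apply: (@le_trans _ _ (\int[mu]_(y in ball t (2 ^+ k * e)) ((d k)%:E * `|(psum2t a n y)%:E|))%E).
      apply: (ge0_le_integral_ae measurable0) => // [s _|s _|s _].
      - by rewrite lee_fin.
      - by rewrite mule_ge0 // lee_fin.
      rewrite /patch; case: ifPn => [/set_mem sa|_]; last first.
        by case: ifPn => // _; rewrite mule_ge0 // lee_fin.
      have [sb|sb] := boolP (`|s - t| < 2 ^+ k * e).
        rewrite ifT; last by rewrite inE -ball_normE /= distrC.
        rewrite -EFinM lee_fin /h sb mulr1 ler_wpM2l //.
        by rewrite /psum2t /patch mem_set ?ger0_norm ?psum2_ge0 //; exact: (full_turn_sub_three_turns t01).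
      rewrite /h (negbTE sb) mulr0 mul0r; case: ifPn => // _.
      by rewrite mule_ge0 // lee_fin.
    rewrite ge0_integralZl_EFin //; last 2 first.
    - exact: measurable_ball.
    - apply/measurable_EFinP; apply: measurableT_comp => //.
      apply: measurable_funTS; apply/(measurable_restrictT _ _).1; first exact: measurable_itv.
      exact: measurable_psum2.
    have := HL_ball HLc rk.
    have dk : ((0 : R)%:E <= (d k)%:E)%E by rewrite lee_fin.
    move=> /(lee_wpmul2l dk) hb; apply: le_trans hb _; rewrite -EFinM lee_fin.
    have -> : (1 / 2) ^+ k = 2 ^+ k / 4 ^+ k :> R.
      by rewrite -expr_div_n; congr (_ ^+ _); lra.
    rewrite /d mulr2n le_eqVlt; apply/orP; left; apply/eqP.
    have : 4 ^+ k != 0 :> R by rewrite expf_neq0.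
    by move: (4 ^+ k) (2 ^+ k) => y x y0; field; rewrite y0 gt_eqF.
  rewrite sumEFin lee_fin -mulr_sumr.
  have : \sum_(i < L.+1) (1 / 2) ^+ i <= (1 - 1 / 2)^-1 :> R.
    by apply: ler_sum_geometric; apply/andP; split; lra.
  have -> : (1 - 1 / 2)^-1 = 2 :> R by field.
  by move=> ?; nra.
apply: le_trans (poisson_subharmonic (t - pi) a n w1) _.
have iP : turn_int (t - pi) (fun s => poisson w s * psum2 a n s).
  by apply: poisson_int => //; exact: continuous_psum2.
rewrite /mean /Rintegral.
have := integrable_fin_num (measurable_full_turn (t - pi)) iP => ifin.
have : fine (\int[mu]_(s in full_turn (t - pi)) (poisson w s * psum2 a n s)%:E)%E <= 1024 * c.
  by rewrite -lee_fin fineK.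
rewrite -/(psum2 _ _ _) /psum2; set I := fine _ => hI.
rewrite ler_pdivrMl ?mulr_gt0 //; apply: le_trans hI _.
have y0 : 0 <= 1024 * c by lra.
by move: (1024 * c) y0 => y y0; nra.
Qed.

End PolynomialMaximal.

(** * The weak type estimate for polynomials, and tails of square summable coefficients *)

Section MaximalInequality.
Context {R : realType}.
Notation C := (cplx R).
Notation nrm := (@Normc.normc R).
Notation mu := (@lebesgue_measure R).
Implicit Types (z w : C) (f g : R -> C) (u v : R -> R) (a : nat -> C).

Lemma full_turn_integralE x u : turn_int x u ->
  (\int[mu]_(t in full_turn x) (u t)%:E = (2 * pi * mean x u)%:E)%E.
Proof.
move=> iu; rewrite /mean mulrA divff ?mul1r ?gt_eqF ?pi2_gt0 //.
by rewrite /Rintegral fineK //; exact: (integrable_fin_num (measurable_full_turn x) iu).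
Qed.

Lemma psum2t_locally_integrable a n : locally_integrable [set: R] (psum2t a n).
Proof.
apply: integrable_locally; first exact: measurable_itv.
by apply: continuous_itv_integrable; exact: continuous_psum2.
Qed.

(** [three_turns] is covered by three full turns, and Parseval's identity evaluates the integral
    over each as 2 pi times the sum of squares. *)
Lemma psum2t_integral a n :
  (\int[mu]_(y in setT) `|(psum2t a n y)%:E| <=
   (6 * pi * \sum_(k < n) nrm (a k) ^+ 2)%:E)%E.
Proof.
have p0 := @pi_gt0 R.
pose x i : R := - (2 * pi) + 2 * pi * i%:R.
pose F i : R -> \bar R := (EFin \o psum2 a n) \_ (full_turn (x i)).
have F0 i s : (0 <= F i s)%E by apply: erestrict_ge0 => y _; rewrite lee_fin psum2_ge0.
have mF i : measurable_fun setT (F i : measurableTypeR R -> _).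
  apply/(measurable_restrictT _ _).1; first exact: measurable_full_turn.
  by apply/measurable_EFinP; exact: measurable_psum2.
apply: (@le_trans _ _ (\int[mu]_(y in setT) \sum_(i < 3) F i y)%E).
  apply: (ge0_le_integral_ae measurable0) => // [s _|s _]; first by apply: sume_ge0.
  rewrite !patch_setT /psum2t /patch; case: ifPn => [|_]; last first.
    by rewrite abse0; apply: sume_ge0.
  rewrite gee0_abs ?lee_fin ?psum2_ge0 // => /set_mem; rewrite /three_turns /= in_itv /= => /andP[s0 s1].
  have [i hi] : exists i : 'I_3, full_turn (x i) s.
    rewrite /full_turn /x; have [h|h] := leP s 0.
      by exists ord0; rewrite /= in_itv /= mulr0; apply/andP; split; lra.
    have [h'|h'] := leP s (2 * pi).
      by exists (lift ord0 ord0); rewrite /= in_itv /= mulr1; apply/andP; split; lra.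
    by exists ord_max; rewrite /= in_itv /=; apply/andP; split; lra.
  rewrite (bigD1 i) //= {1}/F /patch mem_set // leeDl //.
  by apply: sume_ge0.
rewrite ge0_integral_sum //.
rewrite (eq_bigr (fun=> (2 * pi * \sum_(k < n) nrm (a k) ^+ 2)%:E)) => [|i _].
  by rewrite sumEFin lee_fin sumr_const card_ord -mulr_natr; lra.
rewrite -integral_mkcond -(parseval (x i)) full_turn_integralE //.
exact: turn_int_psum2.
Qed.

Definition HLset a n (c : R) : set R := [set t | (c%:E < HL_maximal (psum2t a n) t)%E].

Lemma measurable_HLset a n c : measurable (HLset a n c : set (measurableTypeR R)).
Proof.
rewrite -[X in measurable X]setTI; apply: emeasurable_fun_o_infty => //.
apply: measurable_HL_maximal; exact: psum2t_locally_integrable.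
Qed.

(** 18 pi is the constant 3 of the maximal inequality times the 6 pi of [psum2t_integral]. *)
Lemma HLset_measure a n (c B : R) : 0 < c -> \sum_(k < n) nrm (a k) ^+ 2 <= B ->
  (mu (HLset a n c) <= (18 * pi * B / c)%:E)%E.
Proof.
move=> c0 hB; have p0 := @pi_gt0 R.
apply: le_trans (maximal_inequality (psum2t_locally_integrable a n) c0) _.
have h0 : (0%:E <= (3 / c)%:E :> \bar R)%E by rewrite lee_fin divr_ge0 // ltW.
apply: le_trans (lee_wpmul2l h0 (psum2t_integral a n)) _.
rewrite -EFinM lee_fin (_ : 3 / c * _ = 18 * pi * (\sum_(k < n) nrm (a k) ^+ 2) / c); last first.
  by field; rewrite gt_eqF.
by rewrite ler_wpM2r ?invr_ge0 ?(ltW c0) // ler_wpM2l // mulr_ge0 // ltW.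
Qed.

Definition ctail a m k : C := if (m <= k)%N then a k else 0.

Lemma ctail_lt a m k : (k < m)%N -> ctail a m k = 0.
Proof. by move=> km; rewrite /ctail leqNgt km. Qed.

Lemma psum_ctail a m n z : (m <= n)%N -> psum (ctail a m) n z = psum a n z - psum a m z.
Proof.
move=> /subnKC <-; elim: (n - m)%N => [|j IH].
  rewrite addn0 subrr /psum big1 // => i _.
  by rewrite ctail_lt ?mul0r.
by rewrite addnS !psumS IH /ctail leq_addr addrAC.
Qed.

Definition ctail_bounded a m (B : R) := forall n, \sum_(k < n) nrm (ctail a m k) ^+ 2 <= B.

Lemma ctail_small a (K : R) : (forall n, \sum_(k < n) nrm (a k) ^+ 2 <= K) ->
  forall e : R, 0 < e -> exists m0, forall m, (m0 <= m)%N -> ctail_bounded a m e.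
Proof.
move=> aK e e0; pose s n := \sum_(k < n) nrm (a k) ^+ 2.
have sS n : s n.+1 = s n + nrm (a n) ^+ 2 by rewrite /s big_ord_recr.
have nd m n : (m <= n)%N -> s m <= s n.
  move=> /subnKC <-; elim: (n - m)%N => [|j IH]; first by rewrite addn0.
  by rewrite addnS sS; apply: le_trans IH _; rewrite lerDl exprn_ge0 ?nrm_ge0.
pose S := [set s n | n in [set: nat]].
have hS : has_sup S.
  by split; [exists (s 0%N), 0%N|exists K => _ [n _ <-]; exact: aK].
have [_ [m0 _ <-] hm0] := sup_adherent e0 hS.
exists m0 => m m0m n; have [nm|mn] := leqP n m.
  rewrite big1 ?(ltW e0) // => i _.
  by rewrite ctail_lt ?nrm0 ?expr0n // (leq_trans (ltn_ord i) nm).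
have -> : \sum_(k < n) nrm (ctail a m k) ^+ 2 = s n - s m.
  move: mn => /ltnW /subnKC <-; elim: (n - m)%N => [|j IH].
    rewrite addn0 subrr big1 // => i _.
    by rewrite ctail_lt // nrm0 expr0n.
  by rewrite addnS big_ord_recr /= IH sS /ctail leq_addr addrAC.
have : s n <= sup S by apply: (ub_le_sup hS.2); exists n.
have := nd _ _ m0m; lra.
Qed.

(* Blocks so short in L^2 that the exceptional sets of the maximal inequality
   are summable. *)
Lemma exists_blocks a (K : R) : (forall n, \sum_(k < n) nrm (a k) ^+ 2 <= K) ->
  exists N : nat -> nat, [/\ forall k, (k <= N k)%N, forall k, (N k <= N k.+1)%N &
    forall k, ctail_bounded a (N k) ((1 / 8) ^+ k)].
Proof.
move=> aK.
have ex k : exists m0, forall m, (m0 <= m)%N -> ctail_bounded a m ((1 / 8) ^+ k).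
  by apply: ctail_small aK _ _; rewrite exprn_gt0.
have [N' HN'] := boolp.choice ex.
(* Summing the thresholds makes the sequence monotone and at least [N' k]; the successors make it at
   least k. *)
exists (fun k => \sum_(j < k.+1) (N' j).+1)%N; split=> k.
- elim: k => // k IH; rewrite big_ord_recr /=.
  by apply: leq_ltn_trans IH _; rewrite -addn1 leq_add.
- by rewrite [X in (_ <= X)%N]big_ord_recr leq_addr.
- by apply: HN'; rewrite big_ord_recr /= -addSnnS ltnW // ltnS leq_addl.
Qed.

(** [A] grows with n; the lemma serves for one fixed polynomial at a time, while rho tends to 1. *)
Lemma psum_radial a n t : exists A : R, 0 <= A /\ forall rho : R, 0 <= rho <= 1 ->
  nrm (psum a n (rho%:C%C * expi t) - psum a n (expi t)) <= A * (1 - rho).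
Proof.
elim: n => [|n [A [A0 HA]]].
  by exists 0; split=> // rho _; rewrite !psum0 subrr nrm0 mul0r.
exists (A + nrm (a n) * n%:R); split=> [|rho r01].
  by rewrite addr_ge0 ?mulr_ge0 ?nrm_ge0.
have /andP[r0 r1] := r01; rewrite !psumS.
have -> : psum a n (rho%:C%C * expi t) + a n * (rho%:C%C * expi t) ^+ n -
    (psum a n (expi t) + a n * expi t ^+ n) =
  (psum a n (rho%:C%C * expi t) - psum a n (expi t)) +
  a n * expi t ^+ n * (rho%:C%C ^+ n - 1).
  rewrite exprMn; move: (psum _ _ _) (psum _ _ _) (a n) (expi t ^+ n) (_ ^+ n).
  by move=> x1 x2 x3 x4 x5; ring.
apply: le_trans (ler_nrmD _ _) _; rewrite mulrDl lerD ?HA //.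
rewrite nrmM nrmM nrmX expi_nrm expr1n mulr1 -mulrA ler_wpM2l ?nrm_ge0 //.
rewrite -rmorphXn -[1]/(1%:C%C) -rmorphB nrm_real ler0_norm; last first.
  by rewrite subr_le0 exprn_ile1.
rewrite opprB; elim: n {HA} => [|n IH]; first by rewrite expr0 subrr mul0r.
rewrite exprS -natr1; have : rho ^+ n <= 1 by rewrite exprn_ile1.
by have := exprn_ge0 n r0; move: (rho ^+ n) (n%:R : R) IH => x y *; nra.
Qed.

End MaximalInequality.

(** * Fatou's theorem on radial limits *)

Section RadialLimits.
Context {R : realType}.
Notation C := (cplx R).
Notation nrm := (@Normc.normc R).
Notation mu := (@lebesgue_measure R).
Implicit Types (z w : C) (a : nat -> C).

Lemma geometric_half_small (B e : R) : 0 < e -> exists k0, forall k, (k0 <= k)%N ->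
  B * (1 / 2) ^+ k < e.
Proof.
move=> e0; have h : `|1 / 2 : R| < 1 by rewrite ger0_norm; lra.
have /cvgrPdist_lt/(_ e e0)[k0 _ H] := @cvg_geometric R B _ h.
exists k0 => k /H; rewrite sub0r normrN /= => h'; exact: le_lt_trans (ler_norm _) h'.
Qed.

Lemma cvg_geometric_cauchy (x : nat -> R) k0 B :
  (forall k m, (k0 <= k <= m)%N -> `|x m - x k| <= B * (1 / 2) ^+ k) -> cvgn x.
Proof.
move=> H; apply/cauchy_cvgP/cauchy_exP => e e0.
have [k1 Hk] := geometric_half_small B e0; pose k := maxn k0 k1.
exists (x k); exists k => // m /= km; rewrite -ball_normE /= distrC.
by apply: le_lt_trans (H k m _) (Hk k _); rewrite ?leq_maxr // leq_maxl.
Qed.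

Lemma radial_closure (x y A : R) : 0 <= A ->
  (forall rho, 1 / 2 <= rho < 1 -> x <= y + A * (1 - rho)) -> x <= y.
Proof.
move=> A0 H; apply/ler_addgt0Pr => e e0.
pose d := Num.min (1 / 2) (e / (A + 1)).
have A1 : 0 < A + 1 by lra.
have d0 : 0 < d by rewrite lt_min !divr_gt0.
have dh : d <= 1 / 2 by rewrite ge_min lexx.
have dA : A * d <= e.
  have : d * (A + 1) <= e by rewrite -ler_pdivlMr // ge_min lexx orbT.
  by move=> ?; nra.
have hd : 1 / 2 <= 1 - d < 1 by clearbody d; apply/andP; split; lra.
by have := H _ hd; rewrite opprB addrCA subrr addr0; lra.
Qed.

Lemma limn_einf_le (u : nat -> \bar R) (B : \bar R) k0 :
  (forall k, (k0 <= k)%N -> (u k <= B)%E) -> (limn_einf u <= B)%E.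
Proof.
move=> H; rewrite limn_einf_lim; apply: lime_le; first exact: is_cvg_einfs.
apply: nearW => k; apply: le_trans (H (maxn k k0) (leq_maxr _ _)).
by apply: ereal_inf_lbound; exists (maxn k k0) => //=; exact: leq_maxl.
Qed.

Lemma ler_nrm_dist3 (x y z w : C) :
  nrm (x - w) <= nrm (y - z) + nrm (y - x) + nrm (z - w).
Proof.
have := ler_nrmD (y - z - (y - x)) (z - w); have := ler_nrmD (y - z) (- (y - x)).
by rewrite nrmN (_ : y - z - (y - x) + (z - w) = x - w); [lra|ring].
Qed.

Lemma ltr_nrm_dist4 (u x y z w : C) (e : R) : nrm (u - x) <= e / 4 ->
  nrm (x - y) < e / 4 -> nrm (y - z) < e / 4 -> nrm (z - w) < e / 4 -> nrm (u - w) < e.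
Proof.
have := ler_nrmD (u - x) (x - y); have := ler_nrmD (y - z) (z - w).
have := ler_nrmD (u - x + (x - y)) (y - z + (z - w)).
by rewrite (_ : u - x + (x - y) + (y - z + (z - w)) = u - w); [lra|ring].
Qed.

Lemma continuous_measurable (u : R -> R) (D : set (measurableTypeR R)) :
  continuous u -> measurable_fun D (u : measurableTypeR R -> R).
Proof. by move=> cu; apply: measurable_funTS; apply: continuous_measurable_fun. Qed.

Definition radially_cvg (f : C -> C) t (l : C) := forall e : R, 0 < e ->
  exists2 d : R, 0 < d & forall rho : R, 1 - d < rho < 1 ->
    nrm (f (rho%:C%C * expi t) - l) < e.

Lemma fatou_radial f a (K : R) : taylor_on_disk f a ->
  (forall n, \sum_(k < n) nrm (a k) ^+ 2 <= K) ->
  exists (E : R -> C) (Z : set (measurableTypeR R)), [/\ measurable Z, mu Z = 0%E,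
    measurable_fun setT (fun t : measurableTypeR R => complex.Re (E t)) /\
    measurable_fun setT (fun t : measurableTypeR R => complex.Im (E t)),
    forall t, full_turn 0 t -> ~ Z t -> radially_cvg f t (E t) &
    forall n B, ctail_bounded a n B ->
      (\int[mu]_(t in full_turn 0) (nrm (E t - psum a n (expi t)) ^+ 2)%:E <= (2 * pi * B)%:E)%E].
Proof.
move=> fa aK; have [N [Nk NS HN]] := exists_blocks aK; have p0 := @pi_gt0 R.
have Nm k m : (k <= m)%N -> (N k <= N m)%N.
  by move=> /subnKC <-; elim: (m - k)%N => [|j IH]; rewrite ?addn0 // addnS (leq_trans IH).
(* Block k has energy at most 8^-k. The level 4^-k leaves an exceptional set of measure at most 18
   pi / 2^k, which is summable, and off it bounds the block on radii by the square root of 1024 /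
   4^k, that is 32 / 2^k. *)
pose X k : set (measurableTypeR R) := HLset (ctail a (N k)) (N k.+1) ((1 / 4) ^+ k).
have mX k : measurable (X k) by exact: measurable_HLset.
have X2 k : (mu (X k) <= (18 * pi * (1 / 2) ^+ k)%:E)%E.
  have := @HLset_measure R _ _ _ _ (exprn_gt0 k (_ : 0 < 1 / 4 :> R)) (HN k (N k.+1)).
  rewrite -mulrA -expr_div_n (_ : 1 / 8 / (1 / 4) = 1 / 2 :> R); last by field.
  by apply; lra.
pose Z := lim_sup_set X.
have mZ : measurable Z.
  by apply: bigcap_measurable => // n _; apply: bigcup_measurable => k _; exact: mX.
have Z0 : mu Z = 0%E.
  apply: lim_sup_set_cvg0 => //; apply: (@le_lt_trans _ _ (36 * pi)%:E); last exact: ltry.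
  apply: lime_le; first by apply: is_cvg_nneseries.
  apply: nearW => n; rewrite /= big_mkord.
  apply: (@le_trans _ _ (\sum_(i < n) (18 * pi * (1 / 2) ^+ i)%:E)%E).
    by apply: lee_sum => i _; exact: X2.
  rewrite sumEFin lee_fin -mulr_sumr.
  have : \sum_(i < n) (1 / 2) ^+ i <= (1 - 1 / 2)^-1 :> R.
    by apply: ler_sum_geometric; apply/andP; split; lra.
  have -> : (1 - 1 / 2)^-1 = 2 :> R by field.
  by move=> ?; nra.
pose D : set (measurableTypeR R) := full_turn 0 `\` Z.
have mD : measurable D by apply: measurableD => //; exact: measurable_full_turn.
have goodz t : D t -> exists k0, forall k m rho, (k0 <= k <= m)%N -> 1 / 2 <= rho < 1 ->
    nrm (psum a (N m) (rho%:C%C * expi t) - psum a (N k) (rho%:C%C * expi t)) <= 64 * (1 / 2) ^+ k.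
  move=> [tt nZ]; have t01 : 0 <= t <= 2 * pi.
    by move: tt; rewrite /full_turn /= in_itv /= add0r.
  have [k0 Hk0] : exists k0, forall k, (k0 <= k)%N -> ~ X k t.
    apply: contrapT => /forallNP h; apply: nZ => n _.
    have /existsNP[k /not_implyP[nk /contrapT Xk]] := h n.
    by exists k.
  exists k0 => k m rho /andP[k0k km] r01.
  (* The telescoping form of the geometric bound is the one that goes through the induction on m. *)
  suff : nrm (psum a (N m) (rho%:C%C * expi t) - psum a (N k) (rho%:C%C * expi t))
      <= 64 * ((1 / 2) ^+ k - (1 / 2) ^+ m).
    move=> h; apply: le_trans h _; rewrite ler_pM2l // gerBl exprn_ge0 //; lra.
  rewrite -(subnKC km); elim: (m - k)%N => [|j IH]; first by rewrite addn0 !subrr nrm0 mulr0.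
  rewrite addnS; set i := (k + j)%N in IH *.
  have k0i : (k0 <= i)%N by rewrite (leq_trans k0k) // leq_addr.
  have step : nrm (psum a (N i.+1) (rho%:C%C * expi t) - psum a (N i) (rho%:C%C * expi t)) <= 32 * (1 / 2) ^+ i.
    rewrite -psum_ctail //.
    have HL : (HL_maximal (psum2t (ctail a (N i)) (N i.+1)) t <= ((1 / 4) ^+ i)%:E)%E.
      by rewrite leNgt; apply/negP; exact: Hk0.
    have := poisson_HL t01 r01 HL.
    have -> : 1024 * (1 / 4) ^+ i = (32 * (1 / 2) ^+ i) ^+ 2 :> R.
      rewrite (_ : 1 / 4 = (1 / 2) ^+ 2 :> R); last by field.
      by rewrite -exprM mulnC exprM; ring.
    by rewrite ler_pXn2r ?nnegrE ?nrm_ge0 // mulr_ge0 // exprn_ge0.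
  rewrite (_ : _ - _ = (psum a (N i.+1) (rho%:C%C * expi t) - psum a (N i) (rho%:C%C * expi t)) +
     (psum a (N i) (rho%:C%C * expi t) - psum a (N k) (rho%:C%C * expi t))); last by ring.
  apply: le_trans (ler_nrmD _ _) _; rewrite [(1 / 2) ^+ i.+1]exprS; lra.
(* The bound extends to the circle itself by letting rho tend to 1 with both polynomials fixed. *)
have good1 t : D t -> exists k0, forall k m, (k0 <= k <= m)%N ->
    nrm (psum a (N m) (expi t) - psum a (N k) (expi t)) <= 64 * (1 / 2) ^+ k.
  move=> /goodz[k0 H]; exists k0 => k m km.
  have [A [A0 HA]] := psum_radial a (N m) t; have [A' [A'0 HA']] := psum_radial a (N k) t.
  apply: (@radial_closure _ _ (A + A')) => [|rho r01]; first exact: addr_ge0.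
  have r01' : 0 <= rho <= 1 by case/andP: r01 => ? ?; apply/andP; split; lra.
  have h1 := HA rho r01'; have h2 := HA' rho r01'; have h3 := H k m rho km r01.
  apply: le_trans (ler_nrm_dist3 _ (psum a (N m) (rho%:C%C * expi t))
    (psum a (N k) (rho%:C%C * expi t)) _) _.
  rewrite [(A + A') * _]mulrDl [leRHS]addrA.
  exact: lerD (lerD h3 h1) h2.
(* Set to 0 off [D], the sequences converge at every angle, so that their limits are measurable on
   the whole line. *)
pose U1 k : R -> R := (fun t => complex.Re (psum a (N k) (expi t))) \_ D.
pose U2 k : R -> R := (fun t => complex.Im (psum a (N k) (expi t))) \_ D.
pose E t : C := (limn (U1 ^~ t) +i* limn (U2 ^~ t))%C.
have UE t k : D t -> (U1 k t +i* U2 k t)%C = psum a (N k) (expi t) :> C.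
  by move=> Dt; rewrite /U1 /U2 /patch mem_set //; case: (psum _ _ _).
have cU t : cvgn (U1 ^~ t) /\ cvgn (U2 ^~ t).
  have [Dt|nD] := pselect (D t); last first.
    have e1 : U1 ^~ t = fun=> 0 by apply/funext => k; rewrite /U1 /patch memNset.
    have e2 : U2 ^~ t = fun=> 0 by apply/funext => k; rewrite /U2 /patch memNset.
    by rewrite e1 e2; split; exact: is_cvg_cst.
  have [k0 H] := good1 t Dt; split; apply: (@cvg_geometric_cauchy _ k0 64) => k m km;
    apply: le_trans (H k m km); rewrite /U1 /U2 /patch mem_set //.
    by rewrite -cReN -cReD ler_Re_nrm.
  by rewrite -cImN -cImD ler_Im_nrm.
have contRe k : measurable_fun setT (U1 k : measurableTypeR R -> R).
  apply/(measurable_restrictT _ _).1; [exact: mD|]; apply: continuous_measurable.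
  by have [] : rcont (fun t => psum a (N k) (expi t)) by apply: rcont_psum; exact: rcont_expi.
have contIm k : measurable_fun setT (U2 k : measurableTypeR R -> R).
  apply/(measurable_restrictT _ _).1; [exact: mD|]; apply: continuous_measurable.
  by have [] : rcont (fun t => psum a (N k) (expi t)) by apply: rcont_psum; exact: rcont_expi.
have Elim t k0 : D t -> (forall k m, (k0 <= k <= m)%N ->
    nrm (psum a (N m) (expi t) - psum a (N k) (expi t)) <= 64 * (1 / 2) ^+ k) ->
    forall k, (k0 <= k)%N -> nrm (psum a (N k) (expi t) - E t) <= 64 * (1 / 2) ^+ k.
  move=> Dt H k k0k; apply/ler_addgt0Pr => e e0; have [c1 c2] := cU t.
  have e2 : 0 < e / 2 by rewrite divr_gt0.
  have /cvgrPdist_lt/(_ _ e2)[m1 _ H1] := c1; have /cvgrPdist_lt/(_ _ e2)[m2 _ H2] := c2.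
  pose m := maxn k (maxn m1 m2).
  have h1 := H1 m; have h2 := H2 m; rewrite /= /m !leq_max leqnn orbT /= in h1.
  rewrite /= /m !leq_max leqnn !orbT /= -/m in h2; rewrite -/m in h1.
  have h3 := H k m; rewrite k0k leq_maxl /= in h3.
  rewrite (_ : _ - _ = (psum a (N m) (expi t) - E t) - (psum a (N m) (expi t) - psum a (N k) (expi t))); last by ring.
  apply: le_trans (ler_nrmD _ _) _; rewrite nrmN addrC lerD ?h3 //.
  apply: le_trans (ler_nrm_ReIm _) _; rewrite -UE // cReD cImD cReN cImN /=.
  have := h1 isT; have := h2 isT; rewrite distrC (distrC (limn (U1 ^~ t))).
  lra.
exists E, Z; split=> //.
- split.
    apply: (@measurable_fun_cvg _ _ _ _ (fun k t => U1 k t)) => // t _.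
    by have [] := cU t.
  apply: (@measurable_fun_cvg _ _ _ _ (fun k t => U2 k t)) => // t _.
  by have [] := cU t.
(* Four terms: f to the partial sum of index N m inside the disk, then to that of index N k, then
   along the radius to the circle, then to E. Here k is fixed before rho, whereas m depends on
   rho. *)
- move=> t tt nZ e e0; have Dt : D t by split.
  have [k1 H1] := goodz t Dt; have [k2 H2] := good1 t Dt.
  have e4 : 0 < e / 4 by rewrite divr_gt0.
  have [k3 H3] := geometric_half_small 64 e4.
  pose k := maxn k1 (maxn k2 k3).
  have k1k : (k1 <= k)%N by rewrite leq_max leqnn.
  have k2k : (k2 <= k)%N by rewrite !leq_max leqnn orbT.
  have k3k : (k3 <= k)%N by rewrite !leq_max leqnn !orbT.
  have h3 := H3 k k3k; have hE := Elim t k2 Dt H2 k k2k.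
  have [A [A0 HA]] := psum_radial a (N k) t.
  have A1 : 0 < A + 1 by lra.
  exists (Num.min (1 / 2) (e / 4 / (A + 1))); first by rewrite lt_min !divr_gt0.
  move=> rho /andP[r0 r1]; have [rA rB] : 1 / 2 < rho /\ (1 - rho) * (A + 1) < e / 4.
    have : 1 - rho < Num.min (1 / 2) (e / 4 / (A + 1)) by lra.
    by rewrite lt_min => /andP[? ?]; split; [lra|rewrite -ltr_pdivlMr].
  have r01 : 0 <= rho <= 1 by apply/andP; split; lra.
  have r02 : 0 < rho < 1 by apply/andP; split; lra.
  have r03 : 1 / 2 <= rho < 1 by apply/andP; split; lra.
  have [M HM] := taylor_unif fa r02 e4.
  pose m := maxn k M.
  have km : (k <= m)%N by rewrite leq_maxl.
  have Mm : (M <= N m)%N by apply: leq_trans (Nk m); rewrite leq_maxr.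
  set z : C := rho%:C%C * expi t.
  have zr : nrm z <= rho by rewrite nrmM expi_nrm mulr1 nrm_real ger0_norm //; lra.
  have h4 := HM _ z Mm zr.
  have k1km : (k1 <= k <= m)%N by rewrite k1k km.
  have h5 := H1 k m rho k1km r03; rewrite -/z in h5.
  have h6 := HA rho r01; rewrite -/z in h6.
  apply: (ltr_nrm_dist4 h4 (le_lt_trans h5 h3) _ (le_lt_trans hE h3)).
  apply: le_lt_trans h6 (le_lt_trans _ rB).
  by rewrite mulrC ler_wpM2l ?lerDl // subr_ge0; case/andP: r01.
move=> n B aB.
(* The mean square estimate for E follows from those for the polynomials by Fatou's lemma. *)
pose V k : R -> R := (fun t => nrm (psum a (N k) (expi t) - psum a n (expi t)) ^+ 2) \_ D.
pose V' : R -> R := (fun t => nrm (E t - psum a n (expi t)) ^+ 2) \_ D.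
have mV k : measurable_fun setT (V k : measurableTypeR R -> R).
  apply/(measurable_restrictT _ _).1; [exact: mD|]; apply: continuous_measurable; apply: rcont_nrm2; apply: rcontD.
    by apply: rcont_psum; exact: rcont_expi.
  by apply: rcontN; apply: rcont_psum; exact: rcont_expi.
have V0 k t : 0 <= V k t by rewrite /V /patch; case: ifP => // _; rewrite exprn_ge0 ?nrm_ge0.
have cV t : V k t @[k --> \oo] --> V' t.
  have [Dt|nD] := pselect (D t); last first.
    have -> : V ^~ t = fun=> 0 by apply/funext => k; rewrite /V /patch memNset.
    by rewrite /V' /patch memNset //; exact: cvg_cst.
  have -> : V ^~ t = fun k => (U1 k t - complex.Re (psum a n (expi t))) ^+ 2 +
     (U2 k t - complex.Im (psum a n (expi t))) ^+ 2.
    by apply/funext => k; rewrite /V /patch mem_set // nrm2E !cReD !cImD cReN cImN -UE.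
  rewrite /V' /patch mem_set // nrm2E !cReD !cImD cReN cImN /= !expr2.
  have [c1 c2] := cU t.
  apply: cvgD; under eq_fun do rewrite expr2.
    by apply: cvgM; apply: cvgB => //; exact: cvg_cst.
  by apply: cvgM; apply: cvgB => //; exact: cvg_cst.
rewrite (@ge0_eq_integral_ae _ _ _ mu _ Z _ (fun t => (V' t)%:E)) //; last 3 first.
- by move=> t _; rewrite lee_fin exprn_ge0 ?nrm_ge0.
- move=> t _; rewrite lee_fin /V' /patch; case: ifP => // _; exact: exprn_ge0 (nrm_ge0 _).
- by move=> t tt nZ; rewrite /V' /patch mem_set.
have cVe t : (V k t)%:E @[k --> \oo] --> (V' t)%:E by apply: cvg_EFin; [exact: nearW|exact: cV].
have -> : (\int[mu]_(t in full_turn 0) (V' t)%:E =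
           \int[mu]_(t in full_turn 0) limn_einf (fun k => (V k t)%:E))%E.
  by apply: eq_integral => t _; have [->] := cvg_limn_einf_sup (cVe t).
apply: le_trans (@fatou _ _ _ mu _ (measurable_full_turn 0) (fun k t => (V k t)%:E) _ _) _.
- by move=> k; apply: measurable_funTS; apply/measurable_EFinP; exact: mV.
- by move=> k t _; rewrite lee_fin.
apply: (@limn_einf_le _ _ n) => k nk.
have nN : (n <= N k)%N by rewrite (leq_trans nk).
apply: (@le_trans _ _ (\int[mu]_(t in full_turn 0) (psum2 (ctail a n) (N k) t)%:E)%E).
  apply: (ge0_le_integral_ae measurable0) => // [t _|t _|t _]; rewrite ?lee_fin ?psum2_ge0 //.
  rewrite /patch; case: ifP => // _; rewrite lee_fin /V /patch /psum2.
  by case: ifP => _; [rewrite psum_ctail | rewrite exprn_ge0 ?nrm_ge0].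
rewrite full_turn_integralE; last exact: turn_int_psum2.
by rewrite lee_fin (parseval 0) ler_wpM2l // ltW // mulr_gt0.
Qed.

End RadialLimits.

(** * Square summability of the Taylor coefficients of a function in the Hardy space *)

Section HardySpace.
Context {R : realType}.
Notation C := (cplx R).
Notation nrm := (@Normc.normc R).
Notation mu := (@lebesgue_measure R).
Implicit Types (z w : C) (f F : C -> C) (a : nat -> C).

Lemma subr1X_le (rho : R) n : 0 <= rho <= 1 -> 1 - rho ^+ n <= n%:R * (1 - rho).
Proof.
move=> /andP[r0 r1]; elim: n => [|n IH]; first by rewrite expr0 subrr mul0r.
rewrite exprS -natr1; have : rho ^+ n <= 1 by rewrite exprn_ile1.
by have := exprn_ge0 n r0; move: (rho ^+ n) (n%:R : R) IH => x y *; nra.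
Qed.

Lemma full_turn0 : full_turn 0 = `[0, 2 * pi] :> set R.
Proof. by rewrite /full_turn add0r. Qed.

Lemma hardy2_mean_bound F : hardy2 F -> exists K : R, forall rho : R, 0 < rho < 1 ->
  (\int[mu]_(t in full_turn 0) (nrm (F (rho%:C%C * expi t)) ^+ 2)%:E <= (2 * pi * K)%:E)%E.
Proof.
move=> [_]; set S := (X in ereal_sup X) => supS.
have p2 := @pi2_gt0 R.
have S0 : (0%:E <= ereal_sup S)%E.
  apply: le_trans (_ : _ <= _)%E; last first.
    apply: ereal_sup_ubound; exists (1 / 2) => //=.
    by rewrite in_itv /=; apply/andP; split; lra.
  rewrite mule_ge0 ?lee_fin ?invr_ge0 ?(ltW p2) //.
  by apply: integral_ge0 => t _; rewrite lee_fin exprn_ge0 ?nrm_ge0.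
have Sfin : ereal_sup S \is a fin_num.
  by rewrite fin_real // supS andbT (lt_le_trans _ S0) // ltNyr.
exists (fine (ereal_sup S)) => rho r01.
have : (((2 * pi)^-1)%:E * \int[mu]_(t in full_turn 0) (nrm (F (rho%:C%C * expi t)) ^+ 2)%:E
    <= ereal_sup S)%E.
  by apply: ereal_sup_ubound; exists rho => //=; rewrite full_turn0.
by rewrite -(fineK Sfin) lee_pdivrMl // -EFinM.
Qed.

(** The left side is the positive part of x^2 / 2 - 1, because [ge0_le_integral_ae] compares
    nonnegative functions. The bound itself is x^2 <= (y + 1)^2 <= 2 y^2 + 2. *)
Lemma half_square_pos (x y d : R) : 0 <= x -> 0 <= y -> d <= 1 -> x <= y + d ->
  (`|x ^+ 2 / 2 - 1| + (x ^+ 2 / 2 - 1)) / 2 <= y ^+ 2.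
Proof.
move=> x0 y0 d1 xd.
have xy1 : x * x <= (y + 1) * (y + 1) by rewrite ler_pM //; lra.
have xy : x ^+ 2 / 2 - 1 <= y ^+ 2 by have := sqr_ge0 (y - 1); rewrite !expr2; lra.
have := sqr_ge0 y; have [u0|u0] := leP 0 (x ^+ 2 / 2 - 1) => ?.
  by rewrite ger0_norm //; lra.
by rewrite ltr0_norm //; lra.
Qed.

(** On the circle of radius rho some Taylor polynomial is within 1 of F, so half its square minus 1
    is at most |F|^2. Parseval's identity then gives sum |a k|^2 rho^(2k) <= 2 K + 2, and for a
    fixed n rho may tend to 1, the loss being at most [S] * (1 - rho). *)
Lemma hardy2_coef F : hardy2 F -> exists a, taylor_on_disk F a /\
  exists K : R, forall n, \sum_(k < n) nrm (a k) ^+ 2 <= K.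
Proof.
move=> hF; have [K HK] := hardy2_mean_bound hF.
have p2 := @pi2_gt0 R.
have [|a Fa] := @ana_disk_taylor R F.
  by move=> z z1; apply: (analytic_on_ana hF.1); rewrite unit_diskE.
exists a; split=> //; exists (2 * K + 2) => n.
pose S := \sum_(k < n) nrm (a k) ^+ 2 * (k * 2)%:R.
have S0 : 0 <= S by apply: sumr_ge0 => k _; rewrite mulr_ge0 // exprn_ge0 ?nrm_ge0.
apply: (radial_closure S0) => rho r01; have /andP[r0 r1] := r01.
have r02 : 0 < rho < 1 by apply/andP; split; lra.
have r03 : 0 <= rho <= 1 by apply/andP; split; lra.
pose b k : C := a k * rho%:C%C ^+ k.
have bE k : nrm (b k) ^+ 2 = nrm (a k) ^+ 2 * rho ^+ (k * 2).
  by rewrite nrmM nrmX nrm_real ger0_norm; [rewrite exprMn exprM|lra].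
apply: (@le_trans _ _ (\sum_(k < n) nrm (b k) ^+ 2 + S * (1 - rho))).
  rewrite /S mulr_suml -big_split /=; apply: ler_sum => k _; rewrite bE -mulrA -mulrDr.
  have := subr1X_le (k * 2) r03; have := exprn_ge0 2 (nrm_ge0 (a k)).
  by move: (nrm (a k) ^+ 2) (rho ^+ _) (_ * (1 - rho)) => x y v *; nra.
rewrite lerD2r.
have [M HM] := taylor_unif Fa r02 ltr01.
have [m nm Mm] : exists2 m, (n <= m)%N & (M <= m)%N.
  by exists (maxn n M); rewrite ?leq_maxl ?leq_maxr.
apply: (@le_trans _ _ (\sum_(k < m) nrm (b k) ^+ 2)).
  rewrite -(subnKC nm) big_split_ord /= lerDl.
  by apply: sumr_ge0 => k _; rewrite exprn_ge0 ?nrm_ge0.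
rewrite -(parseval 0 b m).
pose u t := psum2 b m t / 2 - 1.
pose v t := (`|u t| + u t) / 2.
have cu : continuous u.
  move=> t; apply: cvgB; last exact: cvg_cst.
  by apply: cvgM; [exact: continuous_psum2|exact: cvg_cst].
have cv : continuous v.
  move=> t; apply: cvgM; last exact: cvg_cst.
  by apply: cvgD; [apply: cvg_norm|]; exact: cu.
have v0 t : 0 <= v t.
  by have := ler_norm (- u t); rewrite normrN /v => ?; lra.
have vF t : v t <= nrm (F (rho%:C%C * expi t)) ^+ 2.
  set z : C := rho%:C%C * expi t.
  have zr : nrm z <= rho by rewrite nrmM expi_nrm mulr1 nrm_real ger0_norm //; lra.
  have h := HM m z Mm zr.
  have bz : psum b m (expi t) = psum a m z by rewrite /b psum_dilate.
  have h2 := ler_nrmD (F z) (- (F z - psum a m z)).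
  rewrite nrmN opprB addrC subrK in h2.
  rewrite /v /u /psum2 bz; have := nrm_ge0 (F z); have := nrm_ge0 (psum a m z).
  move=> x0 y0; exact: half_square_pos x0 y0 h h2.
have : ((2 * pi * mean 0 v)%:E <= (2 * pi * K)%:E)%E.
  rewrite -full_turn_integralE; last exact: continuous_turn_int.
  apply: le_trans (HK rho r02).
  apply: (ge0_le_integral_ae measurable0) => // [t _|t _|t _]; rewrite ?lee_fin ?exprn_ge0 ?nrm_ge0 //.
  by rewrite /patch; case: ifP => // _; rewrite lee_fin.
rewrite lee_fin ler_pM2l // => hv.
have : mean 0 u <= mean 0 v.
  apply: mean_le => [||t]; [exact: continuous_turn_int|exact: continuous_turn_int|].
  by have := ler_norm (u t); rewrite /v => ?; lra.
have i1 : turn_int 0 (psum2 b m) by exact: turn_int_psum2.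
have -> : mean 0 u = 2^-1 * mean 0 (psum2 b m) - 1.
  rewrite -(meanZ 2^-1 i1) -[X in _ - X](mean_cst 0 1) -meanB.
  - by congr (mean 0 _); apply/funext => t; rewrite /u mulrC.
  - exact: turn_intZ.
  - by apply: continuous_turn_int => t; exact: cvg_cst.
by rewrite /psum2 => ?; lra.
Qed.

Lemma radial_limitE f t l : radially_cvg f t l -> radial_limit f t = l.
Proof.
move=> H; apply: cvg_lim; first exact: norm_hausdorff.
apply/cvgC => e e0; have [d d0 Hd] := H e e0.
near=> rho; apply: Hd; apply/andP; split; near: rho.
  by apply: nbhs_left_gt; lra.
exact: nbhs_left_lt.
Unshelve. all: by end_near. Qed.

Lemma radially_cvgB f g t l l' : radially_cvg f t l -> radially_cvg g t l' ->
  radially_cvg (fun z => f z - g z) t (l - l').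
Proof.
move=> H H' e e0; have e2 : 0 < e / 2 by rewrite divr_gt0.
have [d d0 Hd] := H _ e2; have [d' d'0 Hd'] := H' _ e2.
exists (Num.min d d'); first by rewrite lt_min d0.
move=> rho /andP[r0 r1].
have [rd rd'] : 1 - d < rho /\ 1 - d' < rho.
  have : 1 - rho < Num.min d d' by lra.
  by rewrite lt_min => /andP[? ?]; split; lra.
have h1 := Hd rho; rewrite rd r1 in h1; have h2 := Hd' rho; rewrite rd' r1 in h2.
have := h1 isT; have := h2 isT.
set x := f _; set y := g _; rewrite (_ : x - y - (l - l') = (x - l) - (y - l')); last by ring.
by have := ler_nrmD (x - l) (- (y - l')); rewrite nrmN; lra.
Qed.

End HardySpace.

(** * Square integrable boundary values, the norm, and the reproducing property *)

Section BoundaryValues.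
Context {R : realType}.
Notation C := (cplx R).
Notation nrm := (@Normc.normc R).
Notation mu := (@lebesgue_measure R).
Implicit Types (z w : C) (f F : C -> C) (a : nat -> C) (E h : R -> C).

Definition rmeas E :=
  measurable_fun setT (fun t : measurableTypeR R => complex.Re (E t)) /\
  measurable_fun setT (fun t : measurableTypeR R => complex.Im (E t)).

Lemma rcont_rmeas h : rcont h -> rmeas h.
Proof. by move=> [h1 h2]; split; exact: continuous_measurable. Qed.

Lemma rmeasB E h : rmeas E -> rmeas h -> rmeas (fun t => E t - h t).
Proof.
move=> [e1 e2] [h1 h2]; split.
  by under eq_fun do rewrite cReD cReN; exact: measurable_funB.
by under eq_fun do rewrite cImD cImN; exact: measurable_funB.
Qed.

Lemma rmeas_Re_mulJ E h : rmeas E -> rmeas h ->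
  measurable_fun setT (fun t : measurableTypeR R => complex.Re (E t * (h t)^*)).
Proof.
move=> [e1 e2] [h1 h2]; under eq_fun do rewrite cReM cReJ cImJ mulrN opprK.
by apply: measurable_funD; apply: measurable_funM.
Qed.

Lemma rmeas_nrm2 E : rmeas E ->
  measurable_fun setT (fun t : measurableTypeR R => nrm (E t) ^+ 2).
Proof.
move=> [e1 e2]; under eq_fun do rewrite nrm2E !expr2.
by apply: measurable_funD; apply: measurable_funM.
Qed.

Definition sq_int E := rmeas E /\ turn_int 0 (fun t => nrm (E t) ^+ 2).

Lemma ler_Re_mulJ z w : `|complex.Re (z * w^*)| <= nrm z ^+ 2 + nrm w ^+ 2.
Proof.
apply: le_trans (ler_Re_nrm _) _; rewrite nrmM nrmJ.
have := sqr_ge0 (nrm z - nrm w); have := sqr_ge0 (nrm z + nrm w).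
by rewrite !expr2; lra.
Qed.

Lemma rcont_sq_int h : rcont h -> sq_int h.
Proof.
by move=> ch; split; [exact: rcont_rmeas|apply: continuous_turn_int; exact: rcont_nrm2].
Qed.

Lemma sq_int_mulJ E h : sq_int E -> sq_int h -> turn_int 0 (fun t => complex.Re (E t * (h t)^*)).
Proof.
move=> [mE iE] [mh ih]; have i2 := turn_intD iE ih.
apply: (le_integrable (measurable_full_turn 0) _ _ i2) => [|t _].
  by apply/measurable_EFinP; apply: measurable_funTS; exact: rmeas_Re_mulJ.
rewrite /= lee_fin; apply: le_trans (ler_Re_mulJ _ _) _; exact: ler_norm.
Qed.

Lemma sqr_distE z w : nrm (z - w) ^+ 2 = (nrm z ^+ 2 + nrm w ^+ 2) + (-2) * complex.Re (z * w^*).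
Proof. by rewrite nrm2D nrmN rmorphN mulrN cReN; ring. Qed.

Lemma sq_intB E h : sq_int E -> sq_int h -> sq_int (fun t => E t - h t).
Proof.
move=> sE sh; have [mE iE] := sE; have [mh ih] := sh; split; first exact: rmeasB.
under eq_fun do rewrite sqr_distE.
by apply: turn_intD; [exact: turn_intD|apply: turn_intZ; exact: sq_int_mulJ].
Qed.

Lemma mean_sqr_dist E h : sq_int E -> sq_int h ->
  mean 0 (fun t => nrm (E t - h t) ^+ 2) =
  mean 0 (fun t => nrm (E t) ^+ 2) + mean 0 (fun t => nrm (h t) ^+ 2)
  - 2 * mean 0 (fun t => complex.Re (E t * (h t)^*)).
Proof.
move=> sE sh; have [mE iE] := sE; have [mh ih] := sh; have ip := sq_int_mulJ sE sh.
under eq_fun do rewrite sqr_distE.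
rewrite meanD; [|exact: turn_intD|exact: turn_intZ].
by rewrite (meanD iE ih) (meanZ (-2) ip) mulNr.
Qed.

Definition has_boundary f E := exists Z : set (measurableTypeR R),
  [/\ measurable Z, mu Z = 0%E &
      forall t, full_turn 0 t -> ~ Z t -> radially_cvg f t (E t)].

Lemma hardy2_normE f E : has_boundary f E ->
  hardy2_norm f = Num.sqrt (mean 0 (fun t => nrm (E t) ^+ 2)).
Proof.
move=> [Z [mZ Z0 HE]]; rewrite /hardy2_norm /hardy2_inner /circle_mean /=.
congr (Num.sqrt _); rewrite /mean full_turn0; congr (_ * _); congr fine.
have sq z : complex.Re (z * z^*) = nrm z ^+ 2 by rewrite mulcJ.
apply: (ge0_eq_integral_ae mZ) => // [t _|t _|t tt nZ].
- by rewrite lee_fin sq exprn_ge0 ?nrm_ge0.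
- by rewrite lee_fin exprn_ge0 ?nrm_ge0.
- by rewrite sq (radial_limitE (HE t _ nZ)) // full_turn0.
Qed.

Lemma has_boundaryB f g E h : has_boundary f E -> (forall t, radially_cvg g t (h t)) ->
  has_boundary (fun z => f z - g z) (fun t => E t - h t).
Proof.
move=> [Z [mZ Z0 HE]] Hg; exists Z; split=> // t tt nZ.
by apply: radially_cvgB; [exact: HE|exact: Hg].
Qed.

(** The arbitrary factor z makes these real parts equivalent to the complex identity <E, K_w> =
    f(w). *)
Definition reproduces f E := forall z w, nrm w < 1 ->
  mean 0 (fun t => complex.Re (z * E t * (szego w t)^*)) = complex.Re (z * f w).

(** Applied pointwise under the integral, it takes the place of the Cauchy-Schwarz inequality. *)
Lemma ler_AMGM (x B eta : R) : 0 < eta -> x * B <= x ^+ 2 / eta + eta * B ^+ 2.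
Proof.
move=> e0; have := sqr_ge0 (x / eta - B).
have -> : (x / eta - B) ^+ 2 = (x ^+ 2 / eta + eta * B ^+ 2 - 2 * (x * B)) / eta.
  by field; rewrite gt_eqF.
rewrite pmulr_lge0 ?invr_gt0 // => h1.
have h2 : 0 <= x ^+ 2 / eta by rewrite divr_ge0 ?sqr_ge0 // ltW.
have h3 : 0 <= eta * B ^+ 2 by rewrite mulr_ge0 ?sqr_ge0 // ltW.
lra.
Qed.

Lemma reproduces_limit f a E (K : R) : taylor_on_disk f a -> sq_int E ->
  (forall n, \sum_(k < n) nrm (a k) ^+ 2 <= K) ->
  (forall n B, ctail_bounded a n B ->
    mean 0 (fun t => nrm (E t - psum a n (expi t)) ^+ 2) <= B) ->
  reproduces f E.
Proof.
move=> fa sE aK aE z w w1.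
set x := mean 0 _; set y := complex.Re _.
pose B := nrm z / (1 - nrm w).
have close (e : R) : 0 < e -> `|x - y| <= e * (2 + nrm z).
  (* B bounds |conj z * K_w| on the circle. With this weight the term eta * B^2 is at most e, and a
     tail of energy at most e * eta makes the other term at most e too. *)
  move=> e0; pose eta := e / (B ^+ 2 + 1).
  have B1 : 0 < B ^+ 2 + 1 by rewrite ltr_wpDl ?sqr_ge0.
  have eta0 : 0 < eta by rewrite divr_gt0.
  have etaB : eta * B ^+ 2 <= e.
    by rewrite /eta mulrAC ler_pdivrMr // ler_pM2l // lerDl.
  have [m0 Hm0] := ctail_small aK (mulr_gt0 e0 eta0).
  have rho01 : 0 < (1 + nrm w) / 2 < 1.
    by have := nrm_ge0 w; move=> ?; apply/andP; split; lra.
  have [M HM] := taylor_unif fa rho01 e0.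
  pose n := maxn m0 M; have n0 : (m0 <= n)%N by rewrite leq_maxl.
  have Mn : (M <= n)%N by rewrite leq_maxr.
  have wr : nrm w <= (1 + nrm w) / 2 by lra.
  have h1 := HM n w Mn wr; have h2 := aE n _ (Hm0 n n0).
  pose p t := psum a n (expi t).
  have sp : sq_int p by apply: rcont_sq_int; apply: rcont_psum; exact: rcont_expi.
  have sk : sq_int (fun t => z^* * szego w t).
    by apply: rcont_sq_int; apply: rcontM; [exact: rcont_cst|exact: rcont_szego].
  have kE (q : R -> C) t : complex.Re (z * q t * (szego w t)^*) = complex.Re (q t * (z^* * szego w t)^*).
    by rewrite rmorphM /= conjCK; congr complex.Re; ring.
  have xE : x = mean 0 (fun t => complex.Re (E t * (z^* * szego w t)^*)).
    by congr (mean 0 _); apply/funext => t; rewrite kE.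
  have yE : complex.Re (z * psum a n w) = mean 0 (fun t => complex.Re (p t * (z^* * szego w t)^*)).
    by rewrite -(reproducing_psum 0) //; congr (mean 0 _); apply/funext => t; rewrite -(kE p).
  have d1 : `|x - complex.Re (z * psum a n w)| <= e + e.
    rewrite xE yE -meanB; [|exact: sq_int_mulJ|exact: sq_int_mulJ].
    have sd := sq_intB sE sp.
    have i1 : turn_int 0 (fun t => complex.Re (E t * (z^* * szego w t)^*) -
                                  complex.Re (p t * (z^* * szego w t)^*)).
      by apply: turn_intD; [|apply: turn_intN]; exact: sq_int_mulJ.
    pose b t := eta^-1 * nrm (E t - p t) ^+ 2 + eta * B ^+ 2.
    have ib1 := turn_intZ eta^-1 sd.2.
    have ib2 : turn_int 0 (fun=> eta * B ^+ 2) by apply: continuous_turn_int => t; exact: cvg_cst.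
    have ib : turn_int 0 b by exact: turn_intD.
    have ub t : `|complex.Re (E t * (z^* * szego w t)^*) - complex.Re (p t * (z^* * szego w t)^*)| <= b t.
      rewrite -cReN -cReD -mulrBl; apply: le_trans (ler_Re_nrm _) _.
      rewrite nrmM nrmJ nrmM nrmJ; apply: le_trans (_ : nrm (E t - p t) * B <= _).
        by rewrite ler_wpM2l ?nrm_ge0 // /B ler_wpM2l ?nrm_ge0 // szego_le.
      by rewrite /b [eta^-1 * _]mulrC; exact: ler_AMGM.
    have mb : mean 0 b <= e + e.
      rewrite /b (meanD ib1 ib2) mean_cst (meanZ _ sd.2) lerD //.
      by rewrite mulrC ler_pdivrMr //; exact: h2.
    rewrite ler_norml; apply/andP; split.
      rewrite -(opprK (mean 0 _)) lerN2 -meanN //; apply: le_trans mb.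
      apply: mean_le => // [|t]; first exact: turn_intN.
      by apply: le_trans (ub t); rewrite -normrN ler_norm.
    apply: le_trans mb; apply: mean_le => // t.
    by apply: le_trans (ub t); exact: ler_norm.
  have d2 : `|complex.Re (z * psum a n w) - y| <= nrm z * e.
    rewrite /y -cReN -cReD -mulrBr; apply: le_trans (ler_Re_nrm _) _.
    by rewrite nrmM ler_wpM2l ?nrm_ge0 // nrmB.
  move: d1 d2; clear; move: (complex.Re (z * psum a n w)) => v d1 d2.
  have := ler_distD v x y; lra.
apply/eqP; rewrite -subr_eq0 -normr_le0.
have nz := nrm_ge0 z; have z2 : 0 < 2 + nrm z by lra.
apply/ler_addgt0Pr => e e0; rewrite add0r.
have := close (e / (2 + nrm z)); rewrite divfK ?gt_eqF //; apply.
by rewrite divr_gt0.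
Qed.

Lemma hardy2_boundary f a (K : R) : taylor_on_disk f a ->
  (forall n, \sum_(k < n) nrm (a k) ^+ 2 <= K) ->
  exists E, [/\ sq_int E, has_boundary f E & reproduces f E].
Proof.
move=> fa aK; have [E [Z [mZ Z0 mE HE HT]]] := fatou_radial fa aK.
have iE : turn_int 0 (fun t => nrm (E t) ^+ 2).
  apply/integrableP; split.
    by apply/measurable_EFinP; apply: measurable_funTS; exact: rmeas_nrm2.
  have t0 : ctail_bounded a 0 K.
    by move=> n; exact: aK.
  apply: le_lt_trans (_ : _ <= (2 * pi * K)%:E)%E (ltry _).
  apply: le_trans (HT 0%N K t0).
  rewrite le_eqVlt; apply/orP; left; apply/eqP; apply: eq_integral => t _.
  by rewrite psum0 subr0 /comp gee0_abs // lee_fin exprn_ge0 ?nrm_ge0.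
have sE : sq_int E by [].
exists E; split=> //; first by exists Z.
apply: (reproduces_limit fa sE aK) => n B aB; have := HT n B aB.
have sp : sq_int (fun t => psum a n (expi t)).
  by apply: rcont_sq_int; apply: rcont_psum; exact: rcont_expi.
have [_ id] := sq_intB sE sp.
by rewrite (full_turn_integralE id) lee_fin ler_pM2l ?pi2_gt0.
Qed.

Lemma first_variation f g E h : sq_int E -> has_boundary f E -> rcont h ->
  (forall t, radially_cvg g t (h t)) ->
  hardy2_norm f <= hardy2_norm (fun z => f z - g z) ->
  2 * mean 0 (fun t => complex.Re (E t * (h t)^*)) <= mean 0 (fun t => nrm (h t) ^+ 2).
Proof.
move=> sE bE ch gh; have sh := rcont_sq_int ch.
rewrite (hardy2_normE bE) (hardy2_normE (has_boundaryB bE gh)) ler_psqrt ?nnegrE; last 2 first.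
- by apply: mean_ge0 => t; rewrite exprn_ge0 ?nrm_ge0.
- by apply: mean_ge0 => t; rewrite exprn_ge0 ?nrm_ge0.
rewrite mean_sqr_dist //; lra.
Qed.

End BoundaryValues.

(** * First order conditions for a constant, a residue and a pole *)

Section Stationarity.
Context {R : realType}.
Notation C := (cplx R).
Notation nrm := (@Normc.normc R).
Implicit Types (z w v : C) (f e : C -> C) (a c : nat -> C) (E h : R -> C).

(** Test with v = - t * conj k: the left side is 2 t |k|^2 and the right side only B t^2 |k|^2,
    which is impossible for small t > 0 unless k = 0. *)
Lemma quadratic_bound_eq0 (k : C) (B r : R) : 0 < r ->
  (forall v, nrm v < r -> - 2 * complex.Re (k * v) <= B * nrm v ^+ 2) -> k = 0.
Proof.
move=> r0 H; apply/eqP/negPn/negP => k0.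
have nk : 0 < nrm k by rewrite nrm_gt0.
pose B' := `|B| + 1; have B'0 : 0 < B' by rewrite ltr_wpDl.
pose t := Num.min (r / (2 * nrm k)) B'^-1.
have t0 : 0 < t by rewrite lt_min invr_gt0 B'0 andbT divr_gt0 // mulr_gt0.
have t1 : t * (2 * nrm k) <= r by rewrite -ler_pdivlMr ?mulr_gt0 // ge_min lexx.
have t2 : t * B' <= 1 by rewrite -ler_pdivlMr // mul1r ge_min lexx orbT.
clearbody t.
have nv : nrm (- t%:C%C * k^*) = t * nrm k.
  by rewrite mulNr nrmN nrmM nrmJ nrm_real gtr0_norm.
have vr : nrm (- t%:C%C * k^*) < r.
  by rewrite nv; have := mulr_gt0 t0 nk; lra.
have := H _ vr; rewrite nv.
have -> : complex.Re (k * (- t%:C%C * k^*)) = - t * nrm k ^+ 2.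
  by rewrite mulrCA mulcJ -rmorphN -rmorphM.
have : B <= `|B| by exact: ler_norm.
have n2 : 0 < nrm k ^+ 2 by rewrite exprn_gt0.
have tn : 0 < t * nrm k ^+ 2 by rewrite mulr_gt0.
rewrite exprMn => h1 h2.
have : (t * nrm k ^+ 2) * 2 <= (t * nrm k ^+ 2) * (B * t).
  by move: h2; rewrite [t ^+ 2]expr2; lra.
rewrite ler_pM2l // => h3.
have : B * t <= `|B| * t by rewrite ler_pM2r.
by move: t2; rewrite /B'; lra.
Qed.

(** Reflection in the unit circle, an involution exchanging the poles outside with the interpolation
    nodes inside. *)
Definition cauchy_pole (l : C) : C := (l^*)^-1.

Lemma nrm_cauchy_pole l : nrm (cauchy_pole l) = (nrm l)^-1.
Proof. by rewrite nrmV nrmJ. Qed.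

Lemma cauchy_pole_lt1 l : 1 < nrm l -> nrm (cauchy_pole l) < 1.
Proof. by move=> l1; rewrite nrm_cauchy_pole invf_lt1 //; lra. Qed.

Lemma cauchy_poleK l : cauchy_pole (cauchy_pole l) = l.
Proof. by rewrite /cauchy_pole fmorphV /= invrK conjCK. Qed.

Lemma sub_pole_ge (x l : C) : nrm x <= 1 -> nrm l - 1 <= nrm (x - l).
Proof. by move=> x1; have := ler_nrmD (l - x) x; rewrite subrK nrmB; lra. Qed.

Lemma sub_pole_neq0 (x l : C) : nrm x <= 1 -> 1 < nrm l -> x - l != 0.
Proof. by move=> x1 l1; rewrite -nrm_gt0; have := sub_pole_ge l x1; lra. Qed.

Lemma cauchy_kernelE l t : 1 < nrm l ->
  (expi t - l)^-1 = - (cauchy_pole l)^* * szego (cauchy_pole l) t :> C.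
Proof.
move=> l1; have l0 : l != 0 by rewrite -nrm_gt0; lra.
have e1 : nrm (expi t : C) <= 1 by rewrite expi_nrm.
have := sub_pole_neq0 e1 l1.
have pE : (cauchy_pole l)^* = l^-1 by rewrite /cauchy_pole fmorphV /= conjCK.
have := szego_den_neq0 t (cauchy_pole_lt1 l1).
rewrite /szego pE => h1 h2.
have h3 : l - expi t != 0 by rewrite -opprB oppr_eq0.
have -> : 1 - l^-1 * expi t = (l - expi t) / l by field.
by field; rewrite h2 h3 l0.
Qed.

Lemma rcont_cauchy l : 1 < nrm l -> rcont (fun t => (expi t - l)^-1 : C).
Proof.
move=> l1; apply: rcontV => [|t]; last by apply: sub_pole_neq0 => //; rewrite expi_nrm.
by apply: rcontD; [exact: rcont_expi|exact: rcont_cst].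
Qed.

Lemma radially_cvg_cst k t : radially_cvg (fun=> k : C) t k.
Proof. by move=> e e0; exists 1 => // rho _; rewrite subrr nrm0. Qed.

Lemma radially_cvgZ k f t l : radially_cvg f t l ->
  radially_cvg (fun z => k * f z) t (k * l).
Proof.
move=> H e e0; have k1 : 0 < nrm k + 1 by have := nrm_ge0 k; lra.
have [d d0 Hd] := H _ (divr_gt0 e0 k1); exists d => // rho /Hd.
rewrite ltr_pdivlMr // -mulrBr nrmM => h; apply: le_lt_trans h.
by rewrite mulrC ler_wpM2l ?nrm_ge0 // lerDl.
Qed.

Lemma nrm_radial_sub (rho t : R) : 0 <= rho <= 1 -> nrm (rho%:C%C * expi t - expi t : C) = 1 - rho.
Proof.
move=> /andP[r0 r1].
rewrite -[X in _ - X]mul1r -mulrBl nrmM expi_nrm mulr1.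
by rewrite -[1]/(1%:C%C) -rmorphB nrm_real ler0_norm ?subr_le0 // opprB.
Qed.

Lemma sub_invE (x y l : C) : x - l != 0 -> y - l != 0 ->
  (x - l)^-1 - (y - l)^-1 = (y - x) / ((x - l) * (y - l)).
Proof. by move=> h1 h2; field; rewrite h1 h2. Qed.

Lemma radially_cvg_cauchy l t : 1 < nrm l ->
  radially_cvg (fun z => (z - l)^-1) t ((expi t - l)^-1).
Proof.
move=> l1 e e0; pose D := nrm l - 1; have D0 : 0 < D by rewrite subr_gt0.
exists (Num.min 1 (e * D ^+ 2)); first by rewrite lt_min ltr01 mulr_gt0 // exprn_gt0.
move=> rho /andP[r0 r1].
have [ra rb] : 0 <= rho /\ 1 - rho < e * D ^+ 2.
  have : 1 - rho < Num.min 1 (e * D ^+ 2) by lra.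
  by rewrite lt_min => /andP[? ?]; split; lra.
have n1 : nrm (expi t : C) <= 1 by rewrite expi_nrm.
have n2 : nrm (rho%:C%C * expi t : C) <= 1.
  by rewrite nrmM expi_nrm mulr1 nrm_real ger0_norm // ltW.
rewrite sub_invE ?sub_pole_neq0 // nrmM nrmB nrm_radial_sub ?ra ?(ltW r1) //.
have h1 := sub_pole_ge l n1; have h2 := sub_pole_ge l n2.
have h3 : D ^+ 2 <= nrm ((rho%:C%C * expi t - l) * (expi t - l)).
  by rewrite nrmM expr2 ler_pM // ltW.
have d2 : 0 < D ^+ 2 by rewrite exprn_gt0.
rewrite nrmV ltr_pdivrMr; last exact: lt_le_trans h3.
by apply: lt_le_trans rb _; rewrite ler_pM2l.
Qed.

Lemma mean_cauchy f E k l : 1 < nrm l -> reproduces f E ->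
  mean 0 (fun t => complex.Re (E t * (k * (expi t - l)^-1)^*)) =
  - complex.Re (k^* * cauchy_pole l * f (cauchy_pole l)).
Proof.
move=> l1 rep; rewrite -cReN -!mulNr -(rep _ _ (cauchy_pole_lt1 l1)).
congr (mean 0 _); apply/funext => t; congr complex.Re.
by rewrite cauchy_kernelE // !rmorphM rmorphN /= conjCK; ring.
Qed.

Lemma mean_cst_mulJ f E k : reproduces f E ->
  mean 0 (fun t => complex.Re (E t * k^*)) = complex.Re (k^* * f 0).
Proof.
move=> rep; have n0 : nrm (0 : C) < 1 by rewrite nrm0.
rewrite -(rep _ _ n0); congr (mean 0 _); apply/funext => t; congr complex.Re.
by rewrite /szego conjC0 mul0r subr0 invr1 conjC1 mulr1 mulrC.
Qed.

Lemma stationary_const f E (d : R) : 0 < d -> reproduces f E ->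
  (forall k, nrm k < d ->
     2 * mean 0 (fun t => complex.Re (E t * k^*)) <= mean 0 (fun=> nrm k ^+ 2)) ->
  f 0 = 0.
Proof.
move=> d0 rep H; apply/eqP; rewrite -oppr_eq0; apply/eqP.
apply: (@quadratic_bound_eq0 _ 1 d d0) => v vd.
have := H (v^*); rewrite nrmJ mean_cst (mean_cst_mulJ _ rep) conjCK => /(_ vd).
by rewrite (_ : - f 0 * v = - (v * f 0)) ?cReN; [lra|ring].
Qed.

Lemma stationary_residue f E l (d : R) : 0 < d -> 1 < nrm l -> reproduces f E ->
  (forall k, nrm k < d ->
     2 * mean 0 (fun t => complex.Re (E t * (k * (expi t - l)^-1)^*)) <=
     mean 0 (fun t => nrm (k * (expi t - l)^-1) ^+ 2)) ->
  f (cauchy_pole l) = 0.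
Proof.
move=> d0 l1 rep H.
have p0 : cauchy_pole l != 0.
  by rewrite -nrm_gt0 nrm_cauchy_pole invr_gt0; lra.
apply: (mulfI p0); rewrite mulr0.
apply: (@quadratic_bound_eq0 _ ((nrm l - 1) ^- 2) d d0) => v vd.
have := H (v^*); rewrite nrmJ (mean_cauchy _ l1 rep) conjCK => /(_ vd).
rewrite mulrN -mulNr -mulrA [v * _]mulrC => h; apply: le_trans h _.
rewrite -[leRHS](mean_cst 0); apply: mean_le => [||t].
- apply: continuous_turn_int; apply: rcont_nrm2; apply: rcontM; first exact: rcont_cst.
  exact: rcont_cauchy.
- by apply: continuous_turn_int => t; exact: cvg_cst.
rewrite nrmM nrmJ nrmV exprMn exprVn mulrC ler_wpM2r ?exprn_ge0 ?nrm_ge0 //.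
have e1 : nrm (expi t : C) <= 1 by rewrite expi_nrm.
have h1 := sub_pole_ge l e1; have h2 : 0 < nrm l - 1 by rewrite subr_gt0.
rewrite lef_pV2 ?posrE ?exprn_gt0 //; last exact: lt_le_trans h1.
by rewrite lerXn2r ?nnegrE ?nrm_ge0 // ltW.
Qed.

(** Here x stands for f(w + v), equal to v * c1 up to second order as f(w) = 0. In the pairing conj
    k * (w + v) * x the part linear in v is isolated; everything else is quadratic. *)
Lemma remainder_bound (k w v c1 x : C) (B r : R) : nrm (w + v) <= 1 -> 0 <= B -> 0 < r ->
  nrm (x - v * c1) <= B * (nrm v / r) ^+ 2 ->
  - 2 * complex.Re ((k^* * w * c1) * v) <=
  - 2 * complex.Re (k^* * (w + v) * x) +
  2 * (nrm k * (nrm c1 + B / r ^+ 2)) * nrm v ^+ 2.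
Proof.
move=> wv B0 r0 hx.
have E : k^* * (w + v) * x = k^* * w * c1 * v + k^* * (v * v * c1 + (w + v) * (x - v * c1)).
  by ring.
rewrite E cReD; set q := k^* * (_ + _).
have : complex.Re q <= nrm k * (nrm c1 + B / r ^+ 2) * nrm v ^+ 2.
  apply: le_trans (ler_norm _) _; apply: le_trans (ler_Re_nrm _) _.
  rewrite /q nrmM nrmJ -[leRHS]mulrA ler_wpM2l ?nrm_ge0 //.
  apply: le_trans (ler_nrmD _ _) _; rewrite [leRHS]mulrDl lerD //.
    by rewrite !nrmM mulrC expr2.
  rewrite nrmM; apply: le_trans (_ : 1 * (B * (nrm v / r) ^+ 2) <= _).
    by rewrite ler_pM ?nrm_ge0.
  by rewrite mul1r expr_div_n mulrA mulrAC.
by lra.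
Qed.

(** Taking the reflection w + v of the moved pole as variable makes the pairing -Re(conj k * (w + v)
    * f(w + v)), the term of the old pole being 0. The squared norm of the perturbation is O(|v|^2),
    so the linear coefficient conj k * w * c 1 vanishes, and k != 0 leaves c 1 = 0. *)
Lemma stationary_pole f E l k c (d : R) : 0 < d -> 1 < nrm l -> reproduces f E -> sq_int E ->
  k != 0 -> ana f (cauchy_pole l) c -> f (cauchy_pole l) = 0 ->
  (forall m, nrm (m - l) < d -> 1 < nrm m ->
     2 * mean 0 (fun t => complex.Re (E t * (k * (expi t - m)^-1 - k * (expi t - l)^-1)^*)) <=
     mean 0 (fun t => nrm (k * (expi t - m)^-1 - k * (expi t - l)^-1) ^+ 2)) ->
  c 1%N = 0.
Proof.
move=> d0 l1 rep sE k0 fc f0 H.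
set w := cauchy_pole l in fc f0.
have w1 : nrm w < 1 := cauchy_pole_lt1 l1.
have w0 : 0 < nrm w by rewrite nrm_cauchy_pole invr_gt0; lra.
have wn : w != 0 by rewrite -nrm_gt0.
have c0 := ana_coef0 fc; rewrite f0 in c0.
have [r [B [r0 B0 HB]]] := fc.
suff /eqP : k^* * w * c 1%N = 0.
  by rewrite !mulf_eq0 fmorph_eq0 (negbTE k0) (negbTE wn) /= => /eqP.
(* In turn: the expansion of f holds at w + v; |w + v| >= |w|/2; |w + v| <= (1 + |w|)/2; and the
   moved pole stays within d of l, by |m - l| <= 2 |v| / |w|^2. *)
pose r' := Num.min r (Num.min (nrm w / 2) (Num.min ((1 - nrm w) / 2) (d * nrm w ^+ 2 / 4))).
(* Lower bounds for the distances from the circle to the moved pole and to l; the first is 2 / (1 +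
   |w|) - 1. *)
pose B1 := (1 - nrm w) / (1 + nrm w); pose B2 := nrm l - 1.
have B10 : 0 < B1 by rewrite divr_gt0; lra.
have B20 : 0 < B2 by rewrite subr_gt0.
have nw2 : 0 < nrm w ^+ 2 by rewrite exprn_gt0.
pose Q := (nrm k * (2 / nrm w ^+ 2) / (B1 * B2)) ^+ 2.
apply: (@quadratic_bound_eq0 _ (Q + 2 * (nrm k * (nrm (c 1%N) + B / r ^+ 2))) r').
  by rewrite !lt_min r0 !divr_gt0 ?mulr_gt0 // subr_gt0.
move=> v; rewrite !lt_min => /and4P[vr vw vw1 vd].
have wv1 : nrm (w + v) <= (1 + nrm w) / 2 by have := ler_nrmD w v; lra.
have wv0 : nrm w / 2 <= nrm (w + v).
  by have := ler_nrmD (w + v) (- v); rewrite addrK nrmN; lra.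
have wv2 : nrm (w + v) <= 1 by lra.
have wvp : 0 < nrm (w + v) by lra.
have wvn : w + v != 0 by rewrite -nrm_gt0.
pose m := cauchy_pole (w + v).
have mp : cauchy_pole m = w + v by exact: cauchy_poleK.
have nm : nrm m = (nrm (w + v))^-1 by exact: nrm_cauchy_pole.
have mB : 1 + B1 <= nrm m.
  rewrite nm -[leLHS]invrK lef_pV2 ?posrE ?invr_gt0 //; last by lra.
  rewrite /B1 (_ : 1 + _ = 2 / (1 + nrm w)); last by field; rewrite gt_eqF //; lra.
  by rewrite invf_div.
have m1 : 1 < nrm m by lra.
have ml : nrm (m - l) <= 2 / nrm w ^+ 2 * nrm v.
  have -> : m - l = - (v^* / ((w + v)^* * w^*)).
    rewrite -(cauchy_poleK l) -/w /m /cauchy_pole.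
    have : (w + v)^* != 0 by rewrite fmorph_eq0.
    have : w^* != 0 by rewrite fmorph_eq0.
    rewrite rmorphD /= => h1 h2; field; rewrite h1 h2 //.
  rewrite nrmN nrmM nrmV nrmM !nrmJ ler_pdivrMr ?mulr_gt0 //.
  rewrite [leRHS](_ : _ = nrm v * (nrm (w + v) / (nrm w / 2))); last first.
    by move: (nrm (w + v)) (nrm v) (nrm w) w0 => y1 y2 y3 y0; field; rewrite gt_eqF.
  by rewrite ler_peMr ?nrm_ge0 // ler_pdivlMr ?divr_gt0 // mul1r.
have mld : nrm (m - l) < d.
  apply: le_lt_trans ml _; rewrite mulrAC ltr_pdivrMr //.
  by rewrite ltr_pdivlMr // in vd; have := mulr_gt0 d0 nw2; lra.
have := H m mld m1.
have sm x : 1 < nrm x -> sq_int (fun t => k * (expi t - x)^-1).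
  by move=> x1; apply: rcont_sq_int; apply: rcontM; [exact: rcont_cst|exact: rcont_cauchy].
have -> : mean 0 (fun t => complex.Re (E t * (k * (expi t - m)^-1 - k * (expi t - l)^-1)^*)) =
   - complex.Re (k^* * (w + v) * f (w + v)).
  rewrite (_ : (fun t => _) = (fun t => complex.Re (E t * (k * (expi t - m)^-1)^*) -
      complex.Re (E t * (k * (expi t - l)^-1)^*))); last first.
    by apply/funext => t; rewrite rmorphB mulrBr cReD cReN.
  rewrite meanB; [|apply: sq_int_mulJ => //; exact: sm|apply: sq_int_mulJ => //; exact: sm].
  by rewrite !(mean_cauchy _ _ rep) // mp -/w f0 mulr0 oppr0 subr0.
have hB : mean 0 (fun t => nrm (k * (expi t - m)^-1 - k * (expi t - l)^-1) ^+ 2) <= Q * nrm v ^+ 2.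
  rewrite -[leRHS](mean_cst 0); apply: mean_le => [||t].
  - by have [] := sq_intB (sm _ m1) (sm _ l1).
  - by apply: continuous_turn_int => t; exact: cvg_cst.
  have e1 : nrm (expi t : C) <= 1 by rewrite expi_nrm.
  have n1 := sub_pole_neq0 e1 m1; have n2 := sub_pole_neq0 e1 l1.
  have h1 := sub_pole_ge m e1; have h2 := sub_pole_ge l e1.
  have -> : k * (expi t - m)^-1 - k * (expi t - l)^-1 =
     k * (m - l) / ((expi t - m) * (expi t - l)) by field; rewrite n1 n2.
  rewrite -exprMn lerXn2r ?nnegrE ?nrm_ge0 //.
    apply: mulr_ge0; last exact: nrm_ge0.
    apply: divr_ge0; last by rewrite ltW // mulr_gt0.
    by apply: mulr_ge0; [exact: nrm_ge0|rewrite divr_ge0 // ltW].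
  have D0 : 0 < B1 * B2 by rewrite mulr_gt0.
  have D1 : B1 * B2 <= nrm ((expi t - m) * (expi t - l)).
    by rewrite nrmM ler_pM ?(ltW B10) ?(ltW B20) //; lra.
  rewrite nrmM nrmV mulrAC ler_pM ?invr_ge0 ?nrm_ge0 //.
    by rewrite nrmM -mulrA ler_wpM2l ?nrm_ge0.
  by rewrite lef_pV2 ?posrE //; exact: lt_le_trans D1.
have hx : nrm (f (w + v) - v * c 1%N) <= B * (nrm v / r) ^+ 2.
  by have := HB 2%N v vr; rewrite !psum_recl psum0 mulr0 addr0 c0 add0r.
have := remainder_bound k wv2 B0 r0 hx.
move: hB; set M := mean 0 _; clear; set x := complex.Re _; set y := complex.Re _.
by rewrite mulrDl; lra.
Qed.

End Stationarity.

(** * Variations of the reduced model, the chain rule, and the interpolation conditions *)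

Section OptimalModel.
Context {R : realType}.
Notation C := (cplx R).
Notation nrm := (@Normc.normc R).
Implicit Types (z w v : C) (f e F : C -> C) (a c : nat -> C) (E h : R -> C).

Lemma eq_hardy2_norm f g : (forall z, nrm z < 1 -> f z = g z) ->
  hardy2_norm f = hardy2_norm g.
Proof.
move=> fg; suff rE : radial_limit f = radial_limit g by rewrite /hardy2_norm /hardy2_inner rE.
apply/funext => t; rewrite /radial_limit; congr (lim _).
have near1 : \forall rho \near (1 : R)^'-, f (rho%:C%C * expi t) = g (rho%:C%C * expi t).
  near=> rho; apply: fg; rewrite nrmM expi_nrm mulr1 nrm_real ger0_norm.
    by near: rho; exact: nbhs_left_lt.
  by apply: ltW; near: rho; exact: nbhs_left_gt.
apply/funext => S; apply/propext; split; apply: filterS2 near1 => rho /= fgr;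
  by rewrite fgr.
Unshelve. all: by end_near. Qed.

Definition model r (q : params R r) z : C :=
  (\sum_(j < r) q.1.2 0 j / (z - q.1.1 0 j)) + q.2.

Definition upd r (x : 'rV[C]_r) (p : 'I_r) (v : C) : 'rV[C]_r :=
  \row_j (if j == p then v else x 0 j).

Definition params_close r (dl : R) (q q' : params R r) :=
  [/\ forall j, nrm (q'.1.1 0 j - q.1.1 0 j) < dl,
      forall j, nrm (q'.1.2 0 j - q.1.2 0 j) < dl & nrm (q'.2 - q.2) < dl].

Lemma near_params r (q : params R r) (P : params R r -> Prop) :
  (\forall q' \near q, P q') ->
  exists2 dl : R, 0 < dl & forall q', params_close dl q q' -> P q'.
Proof.
move=> /nbhs_ballP[eps /= /posC[dl dl0 ->] H]; exists dl => // q' [h1 h2 h3].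
apply: H; split; [split|].
- by split=> [|i j]; [rewrite ltcR|rewrite ord1 -ball_normE /= distrC ltr_norm_real].
- by split=> [|i j]; [rewrite ltcR|rewrite ord1 -ball_normE /= distrC ltr_norm_real].
- by rewrite -ball_normE /= distrC ltr_norm_real.
Qed.

Lemma params_close_trans r dl (q q' q'' : params R r) :
  params_close (dl / 2) q q' -> params_close (dl / 2) q' q'' -> params_close dl q q''.
Proof.
have tri (x y z : C) : nrm (y - x) < dl / 2 -> nrm (z - y) < dl / 2 -> nrm (z - x) < dl.
  by have := ler_nrmD (z - y) (y - x); rewrite addrA subrK; lra.
by move=> [h1 h2 h3] [k1 k2 k3]; split=> [j|j|]; [apply: tri (h1 j) (k1 j)|
  apply: tri (h2 j) (k2 j)|apply: tri h3 k3].
Qed.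

Lemma model_upd_res r (lam res : 'rV[C]_r) d p k z :
  model (lam, upd res p (res 0 p + k), d) z - model (lam, res, d) z =
  k * (z - lam 0 p)^-1.
Proof.
rewrite /model /= (bigD1 p) //= [in X in _ - X](bigD1 p) //= mxE eqxx.
rewrite (eq_bigr (fun j => res 0 j / (z - lam 0 j))); last first.
  by move=> j /negbTE jp; rewrite mxE jp.
by ring.
Qed.

Lemma model_upd_lam r (lam res : 'rV[C]_r) d p m z :
  model (upd lam p m, res, d) z - model (lam, res, d) z =
  res 0 p * (z - m)^-1 - res 0 p * (z - lam 0 p)^-1.
Proof.
rewrite /model /= (bigD1 p) //= [in X in _ - X](bigD1 p) //= mxE eqxx.
rewrite (eq_bigr (fun j => res 0 j / (z - lam 0 j))); last first.
  by move=> j /negbTE jp; rewrite mxE jp.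
by ring.
Qed.

Lemma upd_close r (x : 'rV[C]_r) p k (dl : R) : 0 < dl -> nrm (k - x 0 p) < dl ->
  forall j, nrm (upd x p k 0 j - x 0 j) < dl.
Proof.
move=> dl0 h j; rewrite mxE; case: eqVneq => [->|_] //.
by rewrite subrr nrm0.
Qed.

Lemma upd_admissible r (lam res : 'rV[C]_r) d p m : admissible (lam, res, d) ->
  1 < nrm m -> admissible (upd lam p m, res, d).
Proof.
by move=> adm m1 j; rewrite /= mxE; case: eqVneq => [_|_]; [rewrite norm_gt1|exact: adm].
Qed.

(** Local minimality with an explicit radius, so that it can be transferred, with half the radius,
    to nearby parameters defining the same model. *)
Definition delta_min r F (q : params R r) (dl : R) := forall q', params_close dl q q' ->
  admissible q' ->
  hardy2_norm (fun z => F z - model q z) <= hardy2_norm (fun z => F z - model q' z).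

Lemma delta_min_variation r F e E (q q' : params R r) (dl : R) g h :
  (forall z, nrm z < 1 -> e z = F z - model q z) -> sq_int E -> has_boundary e E ->
  delta_min F q dl -> params_close dl q q' -> admissible q' ->
  (forall z, nrm z < 1 -> model q' z - model q z = g z) ->
  rcont h -> (forall t, radially_cvg g t (h t)) ->
  2 * mean 0 (fun t => complex.Re (E t * (h t)^*)) <= mean 0 (fun t => nrm (h t) ^+ 2).
Proof.
move=> eE sE bE hm qq' aq' gE ch gh; apply: (first_variation sE bE ch gh).
have := hm q' qq' aq'.
rewrite -(eq_hardy2_norm eE) (@eq_hardy2_norm (fun z => F z - model q' z) (fun z => e z - g z)) //.
by move=> z z1; rewrite eE // -gE //; ring.
Qed.

Section Stationary.
Context (r : nat) (F e : C -> C) (E : R -> C)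
  (sE : sq_int E) (bE : has_boundary e E) (rep : reproduces e E).

Lemma delta_min_const (q : params R r) dl : 0 < dl -> admissible q -> delta_min F q dl ->
  (forall z, nrm z < 1 -> e z = F z - model q z) -> e 0 = 0.
Proof.
case: q => [[lam res] d] dl0 adm hm eE; apply: (stationary_const dl0 rep) => k kd.
pose q' : params R r := (lam, res, d + k).
apply: (@delta_min_variation _ _ _ _ _ q' _ (fun=> k) (fun=> k) eE sE bE hm) => //.
- by split=> [j|j|]; rewrite /= ?subrr ?nrm0 // addrC addKr.
- by move=> z _; rewrite /model /=; ring.
- exact: rcont_cst.
- by move=> t; exact: radially_cvg_cst.
Qed.

Lemma delta_min_residue (q : params R r) dl p : 0 < dl -> admissible q -> delta_min F q dl ->
  (forall z, nrm z < 1 -> e z = F z - model q z) -> e (cauchy_pole (q.1.1 0 p)) = 0.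
Proof.
case: q => [[lam res] d] dl0 adm hm eE.
have l1 : 1 < nrm (lam 0 p) by have := adm p; rewrite norm_gt1.
apply: (stationary_residue dl0 l1 rep) => k kd.
pose q' : params R r := (lam, upd res p (res 0 p + k), d).
apply: (@delta_min_variation _ _ _ _ _ q' _ (fun z => k * (z - lam 0 p)^-1)
  (fun t => k * (expi t - lam 0 p)^-1) eE sE bE hm) => //.
- split=> [j|j|]; rewrite /= ?subrr ?nrm0 //.
  by apply: upd_close => //; rewrite addrC addKr.
- by move=> z _; exact: model_upd_res.
- by apply: rcontM; [exact: rcont_cst|exact: rcont_cauchy].
- by move=> t; apply: radially_cvgZ; exact: radially_cvg_cauchy.
Qed.

(* If the residue vanishes then moving the pole leaves the model unchanged, so
   that the residue condition holds at all the nearby poles. *)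
Lemma delta_min_pole (q : params R r) dl p c : 0 < dl -> admissible q -> delta_min F q dl ->
  (forall z, nrm z < 1 -> e z = F z - model q z) ->
  ana e (cauchy_pole (q.1.1 0 p)) c -> c 1%N = 0.
Proof.
move=> dl0 adm hm eE ec.
have e0 := delta_min_residue p dl0 adm hm eE.
case: q adm hm eE ec e0 => [[lam res] d] /= adm hm eE ec e0.
have l1 : 1 < nrm (lam 0 p) by have := adm p; rewrite norm_gt1.
have [r0|r0] := eqVneq (res 0 p) 0; last first.
  apply: (stationary_pole dl0 l1 rep sE r0 ec e0) => m md m1.
  pose q' : params R r := (upd lam p m, res, d).
  apply: (@delta_min_variation _ _ _ _ _ q' _
    (fun z => res 0 p * (z - m)^-1 - res 0 p * (z - lam 0 p)^-1)
    (fun t => res 0 p * (expi t - m)^-1 - res 0 p * (expi t - lam 0 p)^-1) eE sE bE hm) => //.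
  - by split=> [j|j|]; rewrite /= ?subrr ?nrm0 //; exact: upd_close.
  - exact: upd_admissible.
  - by move=> z _; exact: model_upd_lam.
  - have cp x : 1 < nrm x -> rcont (fun t => res 0 p * (expi t - x)^-1).
      by move=> x1; apply: rcontM; [exact: rcont_cst|exact: rcont_cauchy].
    by apply: rcontD; [exact: cp|apply: rcontN; exact: cp].
  - by move=> t; apply: radially_cvgB; apply: radially_cvgZ; exact: radially_cvg_cauchy.
set w := cauchy_pole (lam 0 p) in ec e0.
have w0 : 0 < nrm w by rewrite nrm_cauchy_pole invr_gt0; lra.
have w1 : nrm w < 1 by exact: cauchy_pole_lt1.
have dl2 : 0 < dl / 2 by rewrite divr_gt0.
have near_zero : exists2 d' : R, 0 < d' & forall z, nrm (z - w) < d' -> 0 = e z.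
  (* The reflection m of z satisfies |m - lam 0 p| = |z - w| / (|z| |w|); with |z| >= |w|/2 the last
     bound keeps it within dl / 2. *)
  exists (Num.min (Num.min (nrm w / 2) (1 - nrm w)) (dl * nrm w ^+ 2 / 4)).
    by rewrite !lt_min subr_gt0 w1 !divr_gt0 ?mulr_gt0 ?exprn_gt0.
  move=> z; rewrite !lt_min => /andP[/andP[z1 z2] z3].
  have zw : nrm w / 2 <= nrm z by have := ler_nrmD z (w - z); rewrite addrC subrK nrmB; lra.
  have zl : nrm z < 1 by have := ler_nrmD (z - w) w; rewrite subrK; lra.
  have z0 : z != 0 by rewrite -nrm_gt0; lra.
  have wn : w != 0 by rewrite -nrm_gt0.
  pose m := cauchy_pole z.
  have m1 : 1 < nrm m by rewrite nrm_cauchy_pole invf_gt1 //; lra.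
  have md : nrm (m - lam 0 p) < dl / 2.
    have -> : m - lam 0 p = - ((z - w)^* / (z^* * w^*)).
      rewrite -(cauchy_poleK (lam 0 p)) -/w /m /cauchy_pole.
      have : z^* != 0 by rewrite fmorph_eq0.
      have : w^* != 0 by rewrite fmorph_eq0.
      by rewrite rmorphB /= => h1 h2; field; rewrite h1 h2.
    rewrite nrmN nrmM nrmV nrmM !nrmJ ltr_pdivrMr; last by rewrite mulr_gt0 //; lra.
    apply: lt_le_trans z3 _; rewrite expr2.
    by have := ler_wpM2r (ltW w0) zw; move: (mulr_gt0 w0 w0) => ? ?; nra.
  pose q1 : params R r := (upd lam p m, res, d).
  have M1 x : model q1 x = model (lam, res, d) x.
    by apply/eqP; rewrite -subr_eq0 model_upd_lam r0 !mul0r subrr.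
  have c1 : params_close (dl / 2) (lam, res, d) q1.
    by split=> [j|j|]; rewrite /= ?subrr ?nrm0 //; exact: upd_close.
  have hm1 : delta_min F q1 (dl / 2).
    move=> q' c2 a2; rewrite (_ : (fun x => F x - model q1 x) = (fun x => F x - model (lam, res, d) x)).
      by apply: hm => //; exact: params_close_trans c1 c2.
    by apply/funext => x; rewrite M1.
  have eE1 x : nrm x < 1 -> e x = F x - model q1 x by move=> x1; rewrite M1 eE.
  have := delta_min_residue p dl2 (upd_admissible p adm m1) hm1 eE1.
  by rewrite /= mxE eqxx cauchy_poleK => ->.
have h0 := ana_cst 0 w; have h1 := ana_eq_near near_zero h0.
by rewrite -(ana_derive1 ec) (ana_derive1 h1).
Qed.

End Stationary.

(** The chain rule in the form needed to cancel a factor g'(b) != 0. The expansion of the composite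
    is given rather than computed: at distance s from b it makes f o g of order s^2, whereas the
    expansions of f and g make it cf 1 * cg 1 * u plus terms of order s^2. *)
Lemma ana_comp_coef1 (f g : C -> C) b cf cg ch : ana g b cg -> ana f (g b) cf ->
  ana (f \o g) b ch -> f (g b) = 0 -> ch 1%N = 0 -> cg 1%N != 0 -> cf 1%N = 0.
Proof.
move=> ag af ah f0 h1 g1; apply/eqP/negPn/negP => fn.
have c0 := ana_coef0 af; rewrite f0 in c0.
have d0 := ana_coef0 ag; have e0 := ana_coef0 ah; rewrite /= f0 in e0.
have [rf [Bf [rf0 Bf0 Hf]]] := af; have [rg [Bg [rg0 Bg0 Hg]]] := ag.
have [rh [Bh [rh0 Bh0 Hh]]] := ah.
have [dg dg0 Hdg] := ana_continuous ag rf0.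
pose x := nrm (cf 1%N); have x0 : 0 < x by rewrite nrm_gt0.
pose y := nrm (cg 1%N); have y0 : 0 < y by rewrite nrm_gt0.
(* A positive constant bounded by a multiple of every small s is the contradiction sought; the rest
   of the proof only picks such an s. *)
have key (s : R) : 0 < s -> s < Num.min dg (Num.min rg rh) ->
    x * y <= (x * (Bg / rg ^+ 2) + Bh / rh ^+ 2 + Bf / rf ^+ 2 * (Bg / rg) ^+ 2) * s.
  move=> s0; rewrite !lt_min => /and3P[sd sg sh]; pose u : C := s%:C%C.
  have nu : nrm u = s by rewrite nrm_real gtr0_norm.
  pose k := g (b + u) - g b.
  have k1 : nrm k <= Bg * (s / rg).
    have := Hg 1%N u; rewrite nu psum_recl psum0 mulr0 addr0 d0 expr1.
    exact.
  have k2 : nrm (k - u * cg 1%N) <= Bg * (s / rg) ^+ 2.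
    have := Hg 2%N u; rewrite nu !psum_recl psum0 mulr0 addr0 d0 opprD addrA.
    exact.
  have k3 : nrm k < rf by apply: Hdg; rewrite addrC addKr nu.
  have h2 : nrm (f (g (b + u))) <= Bh * (s / rh) ^+ 2.
    have := Hh 2%N u; rewrite nu !psum_recl psum0 mulr0 addr0 e0 h1 mulr0 addr0 subr0.
    exact.
  have h3 : nrm (f (g (b + u)) - k * cf 1%N) <= Bf * (nrm k / rf) ^+ 2.
    have := Hf 2%N k k3; rewrite !psum_recl psum0 mulr0 addr0 c0 add0r.
    by rewrite {1}/k [g b + _]addrC subrK.
  have h4 : x * nrm k <= Bh * (s / rh) ^+ 2 + Bf * (nrm k / rf) ^+ 2.
    rewrite mulrC -nrmM; apply: le_trans (_ : nrm (f (g (b + u))) + nrm (f (g (b + u)) - k * cf 1%N) <= _).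
      have := ler_nrmD (f (g (b + u))) (- (f (g (b + u)) - k * cf 1%N)).
      by rewrite nrmN opprB addrC subrK.
    exact: lerD.
  have h5 : s * y <= nrm k + Bg * (s / rg) ^+ 2.
    rewrite -nu -nrmM; apply: le_trans (_ : nrm k + nrm (k - u * cg 1%N) <= _).
      have := ler_nrmD k (- (k - u * cg 1%N)).
      by rewrite nrmN opprB addrC subrK.
    by rewrite nu lerD2l.
  have h6 : Bf * (nrm k / rf) ^+ 2 <= Bf / rf ^+ 2 * (Bg / rg) ^+ 2 * s ^+ 2.
    have b0 : 0 <= Bg * (s / rg) by rewrite mulr_ge0 // divr_ge0 ?(ltW s0) ?(ltW rg0).
    apply: le_trans (_ : Bf * ((Bg * (s / rg)) / rf) ^+ 2 <= _).
      rewrite ler_wpM2l // lerXn2r ?nnegrE ?divr_ge0 ?nrm_ge0 ?(ltW rf0) //.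
      by rewrite ler_pM2r ?invr_gt0.
    rewrite le_eqVlt; apply/orP; left; apply/eqP.
    by field; rewrite !gt_eqF.
  rewrite -(ler_pM2l s0).
  have h7 : x * (s * y) <= x * nrm k + x * (Bg * (s / rg) ^+ 2).
    by rewrite -mulrDr ler_pM2l.
  have -> : s * ((x * (Bg / rg ^+ 2) + Bh / rh ^+ 2 + Bf / rf ^+ 2 * (Bg / rg) ^+ 2) * s) =
    x * (Bg * (s / rg) ^+ 2) + Bh * (s / rh) ^+ 2 + Bf / rf ^+ 2 * (Bg / rg) ^+ 2 * s ^+ 2.
    by field; rewrite !gt_eqF.
  rewrite mulrCA; move: h7 h4 h6; clear.
  move: (nrm k / rf) => j; lra.
set D := _ + _ + _ in key.
pose m := Num.min dg (Num.min rg rh); have m0 : 0 < m by rewrite !lt_min dg0 rg0.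
have D1 : 0 < `|D| + 1 by rewrite ltr_wpDl.
pose s := Num.min (m / 2) (x * y / (2 * (`|D| + 1))).
have s0 : 0 < s by rewrite lt_min !divr_gt0 ?mulr_gt0.
have sm : s < m by apply: le_lt_trans (_ : m / 2 < m); [rewrite ge_min lexx|lra].
have sD : s * (2 * (`|D| + 1)) <= x * y.
  by rewrite -ler_pdivlMr ?mulr_gt0 // ge_min lexx orbT.
have kss := key s s0 sm; clearbody s.
move: kss; have := ler_norm D; have := mulr_gt0 x0 y0.
move: s0 sD; clear; move: (x * y) s D => p s D s0 sD p0 dD h.
by have := ler_wpM2r (ltW s0) dD; nra.
Qed.

Lemma reduced_model_phi (A : set C) (phi : C -> C) r (q : params R r) z :
  set_bij unit_disk A phi -> nrm z < 1 -> reduced_model phi q (phi z) = model q z.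
Proof.
move=> [_ inj _] z1; rewrite /reduced_model /model pinvKV // inE.
exact/unit_diskE.
Qed.

Lemma sqr_nrmB_le z w : nrm (z - w) ^+ 2 <= 2 * nrm z ^+ 2 + 2 * nrm w ^+ 2.
Proof. by have := sqr_ge0 (nrm (z + w)); rewrite sqr_distE nrm2D; lra. Qed.

End OptimalModel.

Unset Implicit Arguments.
Set Strict Implicit.
Set Printing Implicit Defensive.

Theorem theorem3 (R : realType) (A : set (cplx R)) (phi : cplx R -> cplx R)
    (hA : simply_connected_domain A)
    (hbij : set_bij unit_disk A phi)
    (hconf : conformal_on unit_disk phi)
    (G : cplx R -> cplx R) (hG : hardy2_via phi A G)
    (r : nat) (hr : (0 < r)%N)
    (lam res : 'rV[cplx R]_r) (d : cplx R)
    (hGr : hardy2_via phi A (reduced_model phi (lam, res, d)))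
    (hmin : local_minimizer (@admissible R r)
              (fun q => hardy2_via_norm phi
                          (fun z => G z - reduced_model phi q z))
              (lam, res, d)) :
  let Gr := reduced_model phi (lam, res, d) in
  forall p : 'I_r,
    [/\ G (phi 0) = Gr (phi 0),
        G (phi (((lam 0 p)^*)^-1)) = Gr (phi (((lam 0 p)^*)^-1)) &
        G^`() (phi (((lam 0 p)^*)^-1)) = Gr^`() (phi (((lam 0 p)^*)^-1))].
Proof.
move=> Gr p; have [aG hF] := hG; have [aGr hFr] := hGr.
have [adm nmin] := hmin.
pose q : params R r := (lam, res, d).
pose F z := G (phi z); pose H z := G z - Gr z.
have eE z : Normc.normc z < 1 -> (H \o phi) z = F z - model q z.
  by move=> z1; rewrite /H /F /Gr /= (reduced_model_phi _ hbij).
have [a [Fa [K aK]]] := hardy2_coef hF; have [b [Fb [K' bK]]] := hardy2_coef hFr.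
have eT : taylor_on_disk (H \o phi) (fun k => a k - b k) by exact: taylor_onB Fa Fb.
(* The error inherits square summable coefficients from G o phi and Gr o phi, which is all that its
   boundary values require. *)
have eK n : \sum_(k < n) Normc.normc (a k - b k) ^+ 2 <= 2 * K + 2 * K'.
  apply: le_trans (_ : \sum_(k < n) (2 * Normc.normc (a k) ^+ 2 + 2 * Normc.normc (b k) ^+ 2) <= _).
    by apply: ler_sum => k _; exact: sqr_nrmB_le.
  by rewrite big_split -!mulr_sumr lerD // ler_pM2l.
have [E [sE bE rep]] := hardy2_boundary eT eK.
have [dl dl0 Hdl] := near_params nmin.
have hm : delta_min F q dl.
  move=> q' qq' aq'; have := Hdl q' qq' aq'.
  have JE s : hardy2_via_norm phi (fun z => G z - reduced_model phi s z) =
      hardy2_norm (fun z => F z - model s z).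
    by apply: eq_hardy2_norm => z z1; rewrite /= (reduced_model_phi _ hbij).
  by rewrite !JE.
have l1 : 1 < Normc.normc (lam 0 p) by have := adm p; rewrite norm_gt1.
set w := (_^-1); have w1 : Normc.normc w < 1 by exact: cauchy_pole_lt1 l1.
have [phiA _ _] := hbij.
have wD : unit_disk w by exact/unit_diskE.
have e0 : H (phi 0) = 0 by exact: (delta_min_const sE bE rep dl0 adm hm eE).
have ew : H (phi w) = 0 by exact: (delta_min_residue sE bE rep p dl0 adm hm eE).
have [cG aGw] := analytic_on_ana aG (phiA _ wD).
have [cR aRw] := analytic_on_ana aGr (phiA _ wD).
have [cF aFw] := analytic_on_ana hF.1 wD.
have [cS aSw] := analytic_on_ana hFr.1 wD.
have [cphi aphi] := analytic_on_ana hconf.1 wD.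
have HE : H = (fun z => G z + -1 * Gr z) by apply/funext => z; rewrite mulN1r.
have aH : ana H (phi w) (fun k => cG k + -1 * cR k) by rewrite HE; exact: anaD aGw (anaZ _ aRw).
have aE : ana (H \o phi) w (fun k => cF k + -1 * cS k).
  by rewrite HE; exact: anaD aFw (anaZ _ aSw).
have c1 := delta_min_pole sE bE rep dl0 adm hm eE aE.
(* Conformality of phi is what lets the vanishing derivative of the error at w descend to G - Gr at
   phi w. *)
have phi1 : cphi 1%N != 0 by rewrite -(ana_derive1 aphi); exact: hconf.2.
have := ana_comp_coef1 aphi aH aE ew c1 phi1.
rewrite mulN1r => /eqP; rewrite subr_eq0 => /eqP cc.
split.
- by apply/eqP; rewrite -subr_eq0; apply/eqP.
- by apply/eqP; rewrite -subr_eq0; apply/eqP.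
- by rewrite (ana_derive1 aGw) (ana_derive1 aRw).
Qed.
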